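(* Let $(X,d)$ be a complete separable metric space, $n\ge1$, and let $(\xi_k)_{k=1}^n$ be a stochastic process with state space $X$, initial distribution $P^{(1)}$ and conditional laws $p_k(\cdot\mid x^{(k-1)})$ of $\xi_k$ given $\xi^{(k-1)}=x^{(k-1)}$. Let $1\le s\le2$ and suppose there exist $\alpha>0$, $M>0$ and $0\le\rho_\ell\le M$ ($\ell=1,\dots,n$) such that: (i) $P^{(1)}$ and $p_k(\cdot\mid x^{(k-1)})$ ($k=2,\dots,n$, $x^{(k-1)}\in X^{k-1}$) satisfy $T_s(\alpha)$ on $(X,d)$; (ii) for $k=2,\dots,n$ and all $x^{(k-1)},y^{(k-1)}\in X^{k-1}$, $$W_s\bigl(p_k(\cdot\mid x^{(k-1)}),p_k(\cdot\mid y^{(k-1)})\bigr)^s\le\sum_{j=1}^{k-1}\rho_{k-j}\,d(x_j,y_j)^s.$$ Then the joint law $P^{(n)}$ satisfies $T_s(\alpha_n)$ on $(X^n,d^{(s)})$ with $$\alpha_n=\alpha\Bigl(\frac{(ne)^{1-s}M}{(1+M)^n}\Bigr)^{2/s}.$$ If moreover (iii) $\sum_{j=1}^n\rho_j\le R$ for some $R\ge0$, then $P^{(n)}$ satisfies $T_s(\alpha_n)$ with $$\alpha_n=\begin{cases} n^{1-2/s}(1-R^{1/s})^2\alpha & \text{if } R<1,\\ e^{(2/s)-2}(n+1)^{-(2/s)-1}\alpha & \text{if } R=1,\\ \Bigl(\dfrac{R-1}{e^{s-1}R^n}\Bigr)^{2/s}\dfrac{\alpha}{n+1} & \text{if } 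R>1.\end{cases}$$
   Context: $x^{(k)}=(x_1,\dots,x_k)\in X^k$. The joint law is $P^{(n)}(dx^{(n)})=p_n(dx_n\mid x^{(n-1)})\cdots p_2(dx_2\mid x_1)P^{(1)}(dx_1)$. $\mathrm{Prob}_s(X)$ is the set of Borel probability measures with finite $s$-th moment; $W_s(\mu,\nu)=\inf_\pi\bigl(\iint d(x,y)^s\pi(dx\,dy)\bigr)^{1/s}$ over couplings $\pi$ of $\mu,\nu$. $\mathrm{Ent}(\nu\mid\mu)=\int\log\frac{d\nu}{d\mu}d\nu$ if $\nu\ll\mu$, else $+\infty$. A measure $\mu$ satisfies $T_s(\alpha)$ if $W_s(\nu,\mu)\le(\frac2\alpha\mathrm{Ent}(\nu\mid\mu))^{1/2}$ for all $\nu\in\mathrm{Prob}_s$. On $X^k$, $d^{(s)}(x^{(k)},y^{(k)})=(\sum_{j=1}^kd(x_j,y_j)^s)^{1/s}$. *)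

(* Defs.v *)
From HB Require Import structures.
From mathcomp Require Import all_boot all_order all_algebra.
From mathcomp Require Import all_classical all_reals all_analysis.
From mathcomp Require Import measurable_realfun.

Set Implicit Arguments.
Unset Strict Implicit.
Unset Printing Implicit Defensive.

Import Order.TTheory GRing.Theory Num.Theory.
Local Open Scope classical_set_scope.
Local Open Scope ring_scope.

Section metric.
Context {R : realType} {d : measure_display} {X : measurableType d}.
Variable dist : X -> X -> R.

Definition is_metric : Prop :=
  [/\ forall x y, 0 <= dist x y,
      forall x y, dist x y = 0 <-> x = y,
      forall x y, dist x y = dist y x &
      forall x y z, dist x z <= dist x y + dist y z].

Definition metric_open (A : set X) : Prop :=
  forall x, A x -> exists2 e : R, 0 < e & [set y | dist x y < e] `<=` A.

Definition metric_borel : Prop :=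
  (@measurable d X) = <<s [set A | metric_open A] >>.

Definition metric_complete : Prop :=
  forall u : nat -> X,
    (forall e : R, 0 < e -> exists N : nat,
        forall m k : nat, (N <= m)%N -> (N <= k)%N -> dist (u m) (u k) < e) ->
    exists l : X, forall e : R, 0 < e -> exists N : nat,
        forall m : nat, (N <= m)%N -> dist (u m) l < e.

Definition metric_separable : Prop :=
  exists D : set X, countable D /\
    forall x (e : R), 0 < e -> exists2 y, D y & dist x y < e.

Definition polish_borel : Prop :=
  [/\ is_metric, metric_complete, metric_separable & metric_borel].

End metric.

Section transport.
Context {R : realType} {d : measure_display} {Y : measurableType d}.
Variable dY : Y -> Y -> R.

Definition couplings (mu nu : probability Y R) : set (probability (Y * Y)%type R) :=
  [set pi | forall A : set Y, measurable A ->
     pi (A `*` setT) = mu A /\ pi (setT `*` A) = nu A].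

Definition Wasserstein (s : R) (mu nu : probability Y R) : \bar R :=
  ereal_inf [set (poweR (\int[pi]_z ((dY z.1 z.2) `^ s)%:E) s^-1)%E
            | pi in couplings mu nu].

Definition finite_moment (s : R) (nu : probability Y R) : Prop :=
  exists y0 : Y, (\int[nu]_y ((dY y0 y) `^ s)%:E < +oo)%E.

End transport.

Section entropy.
Context {R : realType} {d : measure_display} {Y : measurableType d}.

Definition Ent (nu mu : probability Y R) : \bar R :=
  if pselect (charge_of_finite_measure nu `<< mu) then
    (\int[nu]_y (ln (fine (Radon_Nikodym (charge_of_finite_measure nu) mu y)))%:E)%E
  else +oo%E.

(** mu satisfies T_s(alpha) on (Y, dY):
    W_s(nu, mu) <= sqrt((2/alpha) Ent(nu|mu)) for all nu in Prob_s
    (the inequality being trivially true when Ent(nu|mu) = +oo) *)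
Definition transport_ineq (dY : Y -> Y -> R) (s alpha : R)
    (mu : probability Y R) : Prop :=
  forall nu : probability Y R, finite_moment dY s nu ->
    Ent nu mu \is a fin_num ->
    (Wasserstein dY s nu mu <= (Num.sqrt (2 / alpha * fine (Ent nu mu)))%:E)%E.

End entropy.

(** ** Finite products X^k, represented as k-tuples (with the product
    sigma-algebra provided by MathComp-Analysis) *)

Section products.
Context {R : realType} {d : measure_display} {X : measurableType d}.

Definition dist_pow (dist : X -> X -> R) (s : R) (k : nat)
    (x y : k.-tuple X) : R :=
  (\sum_(j < k) (dist (tnth x j) (tnth y j)) `^ s) `^ s^-1.

Definition tprefix (m k : nat) (h : (m <= k)%N) (x : k.-tuple X) : m.-tuple X :=
  [tuple tnth x (widen_ord h i) | i < m].

End products.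

(* Main.v *)
(** A measure of finite entropy relative to the joint law is coupled with it one
    coordinate at a time. Its density factors along the chain, and the relative
    entropies E_k of the successive conditional laws add up to at most the total
    entropy. Once the first k-1 coordinates are coupled, the next one is coupled
    by gluing a coupling of its conditional law with the kernel at the same past,
    of cost controlled by T_s(alpha), to a coupling of the kernels at the two
    pasts, of cost controlled by the Lipschitz hypothesis. Convexity of x^s
    gives D_k <= c2 (2 E_k / alpha)^(s/2) + c1 sum_(j < k) rho_(k-j) D_j + e for
    the expected costs D_k, and a discrete Gronwall argument bounds their sum;
    the weights n/(n+1) or R^(1/s) in the convexity inequality give the stated
    constants, and R = 0 is obtained in the limit.

    Couplings depending measurably on the past, and the gluing of two couplings,
    are obtained without disintegration theorems: the space is cut into countably
    many small cells, couplings are replaced by ones whose density relative to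
    the product of the marginals is constant on products of cells, up to a small
    remainder, and there are countably many rational choices for these constants. *)
Require Import Defs.
From HB Require Import structures.
From mathcomp Require Import all_boot all_order all_algebra.
From mathcomp Require Import all_classical all_reals all_analysis.
From mathcomp Require Import measurable_realfun.
From mathcomp Require Import ring lra.

Set Implicit Arguments.
Unset Strict Implicit.
Unset Printing Implicit Defensive.

Import Order.TTheory GRing.Theory Num.Theory.
Local Open Scope classical_set_scope.
Local Open Scope ring_scope.

(** The infimum defining [Wasserstein] is approached only by near-minimisers, so every estimate
    carries a slack; the transport inequality is therefore proved by contradiction, a strict failure
    leaving room for an arbitrarily small total error. The coupling of the next conditional laws
    must depend measurably on both pasts. What is selected is a coupling whose cost stays below a
    prescribed measurable bound, an explicit combination of the conditional entropy and the
    distances between the pasts, rather than an optimal one. The condition [s <= 2] enters mainly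
    through concavity of x^(s/2): it allows averaging over the past the power s/2 of the conditional
    entropies and, under (iii), summing over the coordinates at the price of a factor n^(1 - s/2).
    Convexity of x^s is applied at each coordinate, so its left constant is compounded up to n
    times. A weight that differs from 1 by 1/(n + 1) keeps the product below e^(s - 1); for R < 1
    the recursion contracts and a weight independent of n serves. *)

Definition is_kernel {R : realType} {d d'} {S : measurableType d}
    {Z : measurableType d'} (k : S -> probability Z R) : Prop :=
  forall U, measurable U -> measurable_fun [set: S] (fun s => k s U : \bar R).

(** * Kernels, mixtures and probabilities given by densities *)

Section kernel_integral.
Context {R : realType} {d d' : measure_display} {S : measurableType d}
  {Z : measurableType d'}.
Variables (k : S -> probability Z R) (hk : is_kernel k).

(** The measurability proof is an argument of the term, so that the kernel structures declared next
    can be inferred from it. *)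
Definition kernel_fun (_ : is_kernel k) (s : S) : {measure set Z -> \bar R} := k s.

HB.instance Definition _ := isKernel.Build _ _ _ _ R (kernel_fun hk) hk.

Let kernel_fun_setT s : kernel_fun hk s [set: Z] = 1%E.
Proof. exact: probability_setT. Qed.

HB.instance Definition _ :=
  Kernel_isProbability.Build _ _ _ _ R (kernel_fun hk) kernel_fun_setT.

Lemma measurable_kernel_integral (phi : S * Z -> \bar R) :
  (forall z, (0 <= phi z)%E) -> measurable_fun setT phi ->
  measurable_fun setT (fun s => \int[k s]_z phi (s, z))%E.
Proof.
exact: (@measurable_fun_integral_sfinite_kernel _ _ _ _ _ phi (kernel_fun hk)).
Qed.

(** The mixture is the composition of a constant kernel on [unit] with [k]. In a composition the
    second kernel also sees the first parameter, so [k] is read on [unit * S]. *)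
Definition snd_fun (_ : is_kernel k) (s : unit * S) : {measure set Z -> \bar R} :=
  k s.2.

Let snd_fun_kernel U : measurable U ->
  measurable_fun [set: unit * S] (fun s => snd_fun hk s U).
Proof. by move=> mU; exact: (measurableT_comp (hk mU) measurable_snd). Qed.

HB.instance Definition _ := isKernel.Build _ _ _ _ R (snd_fun hk) snd_fun_kernel.

Let snd_fun_setT s : snd_fun hk s [set: Z] = 1%E.
Proof. exact: probability_setT. Qed.

HB.instance Definition _ :=
  Kernel_isProbability.Build _ _ _ _ R (snd_fun hk) snd_fun_setT.

Variable pi : probability S R.

Definition cst_fun (_ : unit) : {measure set S -> \bar R} := pi.

Let cst_fun_kernel U : measurable U ->
  measurable_fun [set: unit] (fun s => cst_fun s U).
Proof. by move=> mU; exact: measurable_cst. Qed.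

HB.instance Definition _ := isKernel.Build _ _ _ _ R cst_fun cst_fun_kernel.

Let cst_fun_setT s : cst_fun s [set: S] = 1%E.
Proof. exact: probability_setT. Qed.

HB.instance Definition _ :=
  Kernel_isProbability.Build _ _ _ _ R cst_fun cst_fun_setT.

Definition mixture : set Z -> \bar R :=
  mkcomp cst_fun (snd_fun hk) tt.

HB.instance Definition _ := Measure.on mixture.

Let mixture_setT : mixture [set: Z] = 1%E.
Proof.
rewrite /mixture/= /mkcomp /kcomp/=.
transitivity (\int[pi]_s (cst 1 s : \bar R))%E.
  by apply: eq_integral => s _; exact: probability_setT.
by rewrite integral_cst// mul1e; exact: probability_setT.
Qed.

HB.instance Definition _ := Measure_isProbability.Build _ _ R mixture mixture_setT.

Lemma mixtureE U : mixture U = (\int[pi]_s k s U)%E.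
Proof. by []. Qed.

Lemma integral_mixture f : (forall z, (0 <= f z)%E) -> measurable_fun setT f ->
  (\int[mixture]_z f z = \int[pi]_s \int[k s]_z f z)%E.
Proof. by move=> f0 mf; rewrite integral_kcomp. Qed.

End kernel_integral.

Section density.
Context {R : realType} {d : measure_display} {Z : measurableType d}.
Variables (mu : probability Z R) (g : Z -> R).

Definition is_density : Prop :=
  [/\ forall z, 0 <= g z, measurable_fun setT g & (\int[mu]_z (g z)%:E = 1)%E].

Definition density (_ : is_density) (A : set Z) : \bar R :=
  (\int[mu]_(z in A) (g z)%:E)%E.

Hypothesis hg : is_density.

Let density0 : density hg set0 = 0%E.
Proof. exact: integral_set0. Qed.

Let density_ge0 A : (0 <= density hg A)%E.
Proof. by apply: integral_ge0 => z _; rewrite lee_fin; case: hg. Qed.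

Let density_sigma_additive : semi_sigma_additive (density hg).
Proof.
have [g0 mg _] := hg.
move=> F mF tF mUF; rewrite /density ge0_integral_bigcup//; last 2 first.
- by apply/measurable_EFinP; exact: measurable_funTS.
- by move=> x _; rewrite lee_fin.
by apply: is_cvg_nneseries => n _ _; exact: density_ge0.
Qed.

HB.instance Definition _ := isMeasure.Build _ _ _ (density hg)
  density0 density_ge0 density_sigma_additive.

Let density_setT : density hg setT = 1%E.
Proof. by have [] := hg. Qed.

HB.instance Definition _ := Measure_isProbability.Build _ _ R (density hg) density_setT.

Import HBNNSimple.

Let integral_density_nnsfun (f : {nnsfun Z >-> R}) :
  (\int[density hg]_z (f z)%:E = \int[mu]_z ((f z)%:E * (g z)%:E))%E.
Proof.
have [g0 mg _] := hg.
under [in LHS]eq_integral do rewrite fimfunE -fsumEFin//.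
rewrite ge0_integral_fsum//; last 2 first.
  - by move=> r; exact/measurable_EFinP/measurableT_comp.
  - by move=> r z _; rewrite EFinM nnfun_muleindic_ge0.
under [in RHS]eq_integral.
  move=> z _; rewrite fimfunE -fsumEFin// ge0_mule_fsuml; last first.
    by move=> r; rewrite EFinM nnfun_muleindic_ge0.
  over.
rewrite /= ge0_integral_fsum//; last 2 first.
  - move=> r; apply: emeasurable_funM; last exact/measurable_EFinP.
    exact/measurable_EFinP/measurableT_comp.
  - move=> r z _; rewrite mule_ge0 ?lee_fin//.
    by have := nnfun_muleindic_ge0 f r z; rewrite -EFinM lee_fin.
apply: eq_fsbigr => r _.
rewrite (integralZl_indic _ (fun r => f @^-1` [set r]))//; last first.
  by move=> r0; rewrite preimage_nnfun0.
rewrite integral_indic// setIT.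
have [r0|r0] := leP 0 r; last first.
  rewrite preimage_nnfun0// measure0 mule0 integral0_eq// => z _.
  by rewrite indic0 mulr0 mul0e.
rewrite /density -ge0_integralZl//; last 2 first.
- by apply/measurable_EFinP; exact: measurable_funTS.
- by move=> z _; rewrite lee_fin.
rewrite [LHS]integral_mkcond/=.
apply: eq_integral => z _; rewrite patchE indicE.
case: ifPn => _; first by rewrite mulr1.
by rewrite mulr0 mul0e.
Qed.

Lemma integral_density f : (forall z, (0 <= f z)%E) -> measurable_fun setT f ->
  (\int[density hg]_z f z = \int[mu]_z (f z * (g z)%:E))%E.
Proof.
move=> f0 mf; have [g0 mg _] := hg.
pose f_ := nnsfun_approx measurableT mf.
transitivity (\int[density hg]_z (lim ((f_ n z)%:E @[n --> \oo]))%E)%E.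
  by apply/eq_integral => z _; apply/esym/cvg_lim => //=; exact: cvg_nnsfun_approx.
rewrite monotone_convergence//; last 3 first.
  by move=> n; exact/measurable_EFinP.
  by move=> n z _; rewrite lee_fin.
  by move=> z _ a b ab; rewrite lee_fin; exact/lefP/nd_nnsfun_approx.
rewrite (_ : (fun _ => _) =
    (fun n => \int[mu]_z ((f_ n z)%:E * (g z)%:E)%E))%E//; last first.
  by apply/funext => n; rewrite integral_density_nnsfun.
rewrite -monotone_convergence//; last 3 first.
- by move=> n; apply: emeasurable_funM; exact/measurable_EFinP.
- by move=> n z _; rewrite mule_ge0 ?lee_fin.
- move=> z _ a b ab; rewrite lee_wpmul2r ?lee_fin//.
  exact/lefP/nd_nnsfun_approx.
apply: eq_integral => z _; apply/cvg_lim => //.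
apply: cvgeZr => //; exact: cvg_nnsfun_approx.
Qed.

End density.

Lemma measurable_invr {R : realType} : measurable_fun setT (fun x : R => x^-1).
Proof.
(* The square makes the base nonnegative, where the power -1 is the inverse; at 0 both sides
   vanish. *)
rewrite (_ : (fun x : R => x^-1) = (fun x => x * (x ^+ 2) `^ (-1))); last first.
  apply/funext => x; rewrite powR_inv1 ?sqr_ge0//.
  have [->|x0] := eqVneq x 0; first by rewrite invr0 mul0r.
  by field.
apply: measurable_funM => //.
apply: (measurableT_comp (measurable_powR _)).
exact: measurable_funX.
Qed.

Lemma integral_probability_cst {R : realType} {d} {S : measurableType d}
  (P : probability S R) (c : \bar R) : (\int[P]_s c = c)%E.
Proof.
by rewrite integral_cst// [X in (_ * X)%E](_ : _ = 1%E) ?mule1//; exact: probability_setT.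
Qed.

Section image_probability.
Context {R : realType} {d d' : measure_display} {S : measurableType d}
  {Z : measurableType d'}.
Variables (mu : probability S R) (f : S -> Z).

Definition image_probability (mf : measurable_fun setT f) : probability Z R :=
  distribution mu (HB.pack_for {mfun S >-> Z} f (isMeasurableFun.Build _ _ _ _ f mf)).

Hypothesis mf : measurable_fun setT f.

Lemma image_probabilityE A : image_probability mf A = mu (f @^-1` A).
Proof. by []. Qed.

Lemma integral_image_probability g : (forall z, (0 <= g z)%E) ->
  measurable_fun setT g ->
  (\int[image_probability mf]_z g z = \int[mu]_s g (f s))%E.
Proof.
by move=> g0 mg; rewrite ge0_integral_pushforward// preimage_setT.
Qed.

End image_probability.

(** * Countable partitions into small measurable cells *)

Section cells.
Context {R : realType} {d : measure_display} {X : measurableType d}.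
Variable dist : X -> X -> R.

(** The form in which separability and the Borel structure enter the constructions: a measurable
    integer label whose level sets, the cells, have diameter at most [eta]. *)
Definition cellular : Prop :=
  [/\ is_metric dist, measurable_fun setT (fun z : X * X => dist z.1 z.2) &
      forall eta : R, 0 < eta -> exists a : X -> nat,
        measurable_fun setT a /\ forall u v, a u = a v -> dist u v <= eta].

Lemma measurable_metric_ball (x : X) (e : R) : is_metric dist ->
  metric_borel dist -> measurable [set y | dist x y < e].
Proof.
move=> [_ _ _ tri] borel; rewrite borel; apply: sub_sigma_algebra => y /= xy.
exists (e - dist x y); first by rewrite subr_gt0.
by move=> z /= yz; rewrite (le_lt_trans (tri x y z))// -ltrBrDl.
Qed.

Lemma dense_sequence (x0 : X) : metric_separable dist ->
  exists ctr : nat -> X, forall x e, 0 < e -> exists i, dist x (ctr i) < e.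
Proof.
move=> [D [/countable_injP[f finj] sepD]].
(* An inverse of the injection [f] of [D] into the integers, with value [x0] off its range. *)
exists (fun i => xget x0 [set y | D y /\ f y = i]) => x e e0.
have [y Dy xy] := sepD x e e0; exists (f y).
have [Dz fz] := @xgetI _ x0 [set y' | D y' /\ f y' = f y] y (conj Dy erefl).
by rewrite (finj _ y _ _ fz) ?inE.
Qed.

Lemma polish_cellular (x0 : X) : polish_borel dist -> cellular.
Proof.
move=> [dm _ sep borel].
have [_ _ dC tri] := dm.
have [ctr oP] := dense_sequence x0 sep.
have mball x e : measurable [set y | dist x y < e].
  exact: measurable_metric_ball.
have mdist x : measurable_fun setT (dist x).
  apply: (measurability _ (RGenInftyO.measurableE R)) => _ -[_ [r ->] <-].
  by rewrite setTI preimage_itvNyo; exact: mball.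
split=> //.
  apply: (measurability _ (RGenInftyO.measurableE R)) => _ -[_ [r ->] <-].
  rewrite setTI preimage_itvNyo.
  (* A centre close to [u] makes the sum of its distances to [u] and [v] close to [dist u v]. This
     reduces joint measurability to measurability in one variable. *)
  rewrite (_ : [set z | _] =
      \bigcup_i [set z : X * X | dist (ctr i) z.1 + dist (ctr i) z.2 < r]).
    apply: bigcup_measurable => i _.
    have mf : measurable_fun [set: X * X]
        (fun z => dist (ctr i) z.1 + dist (ctr i) z.2).
      apply: measurable_funD.
        exact: (measurableT_comp (mdist (ctr i)) measurable_fst).
      exact: (measurableT_comp (mdist (ctr i)) measurable_snd).
    have := mf measurableT _ (measurable_itv `]-oo, r[).
    by rewrite setTI preimage_itvNyo.
  apply/seteqP; split => [[u v]/= uvr|[u v] [i _]/= uvr]; last first.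
    by rewrite (le_lt_trans _ uvr)// (dC _ u) tri.
  have r0 : 0 < (r - dist u v) / 2 by rewrite divr_gt0// subr_gt0.
  have [i ui] := oP u _ r0; exists i => //=.
  have := tri (ctr i) u v; rewrite (dC (ctr i) u); lra.
move=> eta eta0.
have eta2 : 0 < eta / 2 by rewrite divr_gt0.
have ex u : exists i, dist u (ctr i) < eta / 2 by exact: oP.
(* The label is the least index of a centre within [eta / 2]; minimality writes each cell as a ball
   minus the earlier balls. *)
pose a u := ex_minn (ex u); exists a; split; last first.
  move=> u v; rewrite /a; case: ex_minnP => i ui _; case: ex_minnP => j vj _ ij.
  move: vj; rewrite -ij => vi.
  by have := tri u (ctr i) v; rewrite (dC (ctr i) v); lra.
have ma i : measurable [set u | a u = i].
  rewrite (_ : [set u | _] = [set u | dist (ctr i) u < eta / 2] `\`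
      \bigcup_(j in [set j | (j < i)%N]) [set u | dist (ctr j) u < eta / 2]).
    by apply: measurableD => //; apply: bigcup_measurable => j _.
  apply/seteqP; split => u /=.
    rewrite /a; case: ex_minnP => k uk min <-; rewrite dC; split => //.
    move=> [j/= jk]; rewrite dC => /min; by rewrite leqNgt jk.
  move=> [ui nu]; rewrite /a; case: ex_minnP => k uk min.
  apply/eqP; rewrite eqn_leq; apply/andP; split; first by apply: min; rewrite dC.
  rewrite leqNgt; apply/negP => ki; apply: nu; exists k => //=.
  by rewrite dC.
move=> _ U _; rewrite setTI (_ : a @^-1` U = \bigcup_(i in U) [set u | a u = i]).
  by apply: bigcup_measurable => i _.
by apply/seteqP; split => [u/= Uu|u [i Ui/= ->]] //; exists (a u).
Qed.

End cells.

(** * Laws of maps, couplings, and gluing along cells *)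

Definition has_law {R : realType} {d d'} {S : measurableType d}
    {Z : measurableType d'} (P : probability S R) (f : S -> Z)
    (p : probability Z R) : Prop :=
  measurable_fun setT f /\ forall A, measurable A -> P (f @^-1` A) = p A.

Section law.
Context {R : realType} {d d' : measure_display} {S : measurableType d}
  {Z : measurableType d'}.
Variables (P : probability S R) (f : S -> Z) (p : probability Z R).

Lemma has_law_integral g : has_law P f p -> (forall z, (0 <= g z)%E) ->
  measurable_fun setT g -> (\int[P]_s g (f s) = \int[p]_z g z)%E.
Proof.
move=> [mf Pf] g0 mg; rewrite -(integral_image_probability P mf)//.
by apply: eq_measure_integral => A mA _; exact: Pf.
Qed.

Lemma integral_has_law : measurable_fun setT f ->
  (forall g : Z -> \bar R, (forall z, (0 <= g z)%E) -> measurable_fun setT g ->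
    (\int[P]_s g (f s) = \int[p]_z g z)%E) -> has_law P f p.
Proof.
move=> mf H; split=> // A mA.
rewrite -(setIT (f @^-1` A)) -integral_indic//; last first.
  by rewrite -[X in measurable X]setTI; exact: mf.
rewrite -(setIT A) -integral_indic// setIT.
rewrite -(H (fun z => (\1_A z)%:E))//.
by apply/measurable_EFinP; exact: measurable_indic.
Qed.

Lemma has_law_ae (Q : Z -> Prop) : has_law P f p ->
  {ae p, forall z, Q z} -> {ae P, forall s, Q (f s)}.
Proof.
move=> [mf Pf] [N [mN N0 QN]]; exists (f @^-1` N); split.
- by rewrite -[X in measurable X]setTI; exact: mf.
- by rewrite Pf.
- by move=> s/= Qs; exact: QN.
Qed.

End law.

Lemma couplingsP {R : realType} {d} {Y : measurableType d}
  (mu nu : probability Y R) (pi : probability (Y * Y)%type R) :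
  couplings mu nu pi <-> has_law pi fst mu /\ has_law pi snd nu.
Proof.
split=> [h|[[_ h1] [_ h2]] A mA].
  split; split=> // A mA.
    have [<- _] := h _ mA; congr (pi _).
    by apply/seteqP; split=> [[? ?]|[? ?] []].
  have [_ <-] := h _ mA; congr (pi _).
  by apply/seteqP; split=> [[? ?]|[? ?] []].
rewrite -h1// -h2//; split; congr (pi _).
  by apply/seteqP; split=> [[? ?] []|[? ?]].
by apply/seteqP; split=> [[? ?] []|[? ?]].
Qed.

(** The level sets of [a] cut the domain into countably many pieces, with one [F i] on each. Every
    quantity that depends on a point through its cell label is shown measurable in this way. *)
Lemma measurable_fun_nat_param {R : realType} {d d'} {S : measurableType d}
  {Z : measurableType d'} (a : S -> nat) (F : nat -> S -> Z) :
  measurable_fun setT a -> (forall i, measurable_fun setT (F i)) ->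
  measurable_fun setT (fun s => F (a s) s).
Proof.
move=> ma mF _ U mU; rewrite setTI.
rewrite (_ : _ @^-1` U = \bigcup_i ((a @^-1` [set i]) `&` (F i @^-1` U))).
  apply: bigcup_measurable => i _; apply: measurableI.
    by rewrite -[X in measurable X]setTI; exact: ma.
  by rewrite -[X in measurable X]setTI; exact: mF.
by apply/seteqP; split => [s Us|s [i _] [/= -> //]]; exists (a s).
Qed.

Section cell_weight.
Context {R : realType} {d : measure_display} {X : measurableType d}.
Variables (p : probability X R) (a : X -> nat).
Hypothesis ma : measurable_fun setT a.

(* [cell_weight y] is the density with respect to [p] of the conditional law
   [p( . | cell of y)], and [0] when that cell is negligible. *)
Definition cell_weight (y y' : X) : R :=
  if a y == a y' then (fine (p (a @^-1` [set a y])))^-1 else 0.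

Lemma cell_weight_ge0 y y' : 0 <= cell_weight y y'.
Proof. by rewrite /cell_weight; case: ifP => // _; rewrite invr_ge0 fine_ge0. Qed.

Lemma cell_weightC y y' : cell_weight y y' = cell_weight y' y.
Proof. by rewrite /cell_weight eq_sym; case: eqP => // ->. Qed.

Let mcell i : measurable (a @^-1` [set i]).
Proof. by rewrite -[X in measurable X]setTI; exact: ma. Qed.

Lemma measurable_cell_weight d' (S : measurableType d') (f g : S -> X) :
  measurable_fun setT f -> measurable_fun setT g ->
  measurable_fun setT (fun s => cell_weight (f s) (g s)).
Proof.
move=> mf mg.
pose F i j : R := if i == j then (fine (p (a @^-1` [set i])))^-1 else 0.
pose G i s := F i (a (g s)).
have maf : measurable_fun setT (a \o f) by exact: measurableT_comp.
have mag : measurable_fun setT (a \o g) by exact: measurableT_comp.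
apply: (@measurable_fun_nat_param R _ _ _ _ (a \o f) G) => // i.
exact: (@measurable_fun_nat_param R _ _ _ _ (a \o g) (fun j _ => F i j)).
Qed.

Lemma integral_cell_weight y : (\int[p]_y' (cell_weight y y')%:E =
  (fine (p (a @^-1` [set a y])))^-1%:E * p (a @^-1` [set a y]))%E.
Proof.
rewrite -[X in (_ * p X)%E]setIT -integral_indic//.
have k0 : (0 <= (fine (p (a @^-1` [set a y])))^-1%:E :> \bar R)%E.
  by rewrite lee_fin invr_ge0 fine_ge0.
rewrite -(ge0_integralZl p measurableT _ _ k0)//; last first.
  by apply/measurable_EFinP; exact: measurable_indic.
apply: eq_integral => z _; rewrite /cell_weight indicE.
rewrite -EFinM.
have -> : (z \in a @^-1` [set a y]) = (a y == a z).
  by apply/idP/eqP => [/set_mem/= ->|e]; [|apply/mem_set].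
by case: eqP => _; rewrite ?mulr1 ?mulr0.
Qed.

Lemma integral_cell_weight_le1 y : (\int[p]_y' (cell_weight y y')%:E <= 1)%E.
Proof.
rewrite integral_cell_weight.
have : p (a @^-1` [set a y]) \is a fin_num by exact: fin_num_measure.
case: (p _) => // r _; rewrite -EFinM lee_fin/=.
by have [->|r0] := eqVneq r 0; rewrite ?mulr0// mulVf.
Qed.

(** Mass 1 fails only on cells of measure zero, and there are countably many cells. *)
Lemma integral_cell_weight_ae1 :
  {ae p, forall y, (\int[p]_y' (cell_weight y y')%:E = 1)%E}.
Proof.
have N i : p.-negligible [set y | a y = i /\ p (a @^-1` [set i]) = 0%E].
  have [p0|p0] := pselect (p (a @^-1` [set i]) = 0%E); last first.
    by exists set0; split => // y [].
  by exists (a @^-1` [set i]); split => // y [].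
have := negligible_bigcup N; apply: negligibleS => y/= Hy; exists (a y) => //.
split=> //; apply: contrapT => p0; apply: Hy.
rewrite integral_cell_weight.
have : p (a @^-1` [set a y]) \is a fin_num by exact: fin_num_measure.
move: p0; case: (p _) => // r r0 _; rewrite -EFinM mulVf//.
by apply/eqP => /= r0'; apply: r0; rewrite r0'.
Qed.

End cell_weight.

Section glue.
Context {R : realType} {d d1 d2 : measure_display} {X : measurableType d}
  {S1 : measurableType d1} {S2 : measurableType d2}.
Variables (p : probability X R) (a : X -> nat).
Hypothesis ma : measurable_fun setT a.
Variables (P1 : probability S1 R) (P2 : probability S2 R).
Variables (y1 : S1 -> X) (y2 : S2 -> X).
Hypotheses (h1 : has_law P1 y1 p) (h2 : has_law P2 y2 p).

Let w (z : S1 * S2) := cell_weight p a (y1 z.1) (y2 z.2).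

Let mw : measurable_fun setT w.
Proof.
apply: measurable_cell_weight => //; apply: measurableT_comp => //.
- by case: h1. - by case: h2.
Qed.

Let w1 s1 : (\int[P2]_s2 (w (s1, s2))%:E =
  \int[p]_y' (cell_weight p a (y1 s1) y')%:E)%E.
Proof.
rewrite -(has_law_integral h2)// => [z|]; first by rewrite lee_fin cell_weight_ge0.
by apply/measurable_EFinP; exact: measurable_cell_weight.
Qed.

Let w2 s2 : (\int[P1]_s1 (w (s1, s2))%:E =
  \int[p]_y' (cell_weight p a (y2 s2) y')%:E)%E.
Proof.
rewrite -(has_law_integral h1)// => [|z|].
- by apply: eq_integral => s1 _; rewrite cell_weightC.
- by rewrite lee_fin cell_weight_ge0.
- by apply/measurable_EFinP; exact: measurable_cell_weight.
Qed.

Let glue1 f : (forall s, (0 <= f s)%E) -> measurable_fun setT f ->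
  (\int[P1 \x P2]_z (f z.1 * (w z)%:E) = \int[P1]_s f s)%E.
Proof.
move=> f0 mf; rewrite fubini_tonelli1; last 2 first.
- apply: emeasurable_funM; first exact: measurableT_comp.
  exact/measurable_EFinP.
- by move=> z; rewrite mule_ge0 ?lee_fin ?cell_weight_ge0.
have mwe s1 : measurable_fun setT (fun s2 => (w (s1, s2))%:E).
  by apply/measurable_EFinP; apply: (measurableT_comp mw); exact: measurable_pair1.
have w0 s1 s2 : (0 <= (w (s1, s2))%:E)%E by rewrite lee_fin cell_weight_ge0.
rewrite /fubini_F/=.
under eq_integral do rewrite ge0_integralZl// w1.
apply: ge0_ae_eq_integral => //.
- apply: emeasurable_funM => //.
  have -> : (fun x => \int[p]_y' (cell_weight p a (y1 x) y')%:E)%E =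
    fubini_F P2 (EFin \o w) by apply/funext => x; rewrite -w1.
  by apply: measurable_fun_fubini_tonelli_F => [|z]; [exact/measurable_EFinP|rewrite /= lee_fin cell_weight_ge0].
- by move=> s _; rewrite mule_ge0// -w1 integral_ge0.
- have := has_law_ae h1 (integral_cell_weight_ae1 p ma).
  by apply: filterS => s /= -> _; rewrite mule1.
Qed.

Let glue2 f : (forall s, (0 <= f s)%E) -> measurable_fun setT f ->
  (\int[P1 \x P2]_z (f z.2 * (w z)%:E) = \int[P2]_s f s)%E.
Proof.
move=> f0 mf; rewrite fubini_tonelli2; last 2 first.
- apply: emeasurable_funM; first exact: measurableT_comp.
  exact/measurable_EFinP.
- by move=> z; rewrite mule_ge0 ?lee_fin ?cell_weight_ge0.
have mwe s2 : measurable_fun setT (fun s1 => (w (s1, s2))%:E).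
  by apply/measurable_EFinP; apply: (measurableT_comp mw); exact: measurable_pair2.
have w0 s1 s2 : (0 <= (w (s1, s2))%:E)%E by rewrite lee_fin cell_weight_ge0.
rewrite /fubini_G/=.
under eq_integral do rewrite ge0_integralZl// w2.
apply: ge0_ae_eq_integral => //.
- apply: emeasurable_funM => //.
  have -> : (fun x => \int[p]_y' (cell_weight p a (y2 x) y')%:E)%E =
    fubini_G P1 (EFin \o w) by apply/funext => x; rewrite -w2.
  by apply: measurable_fun_fubini_tonelli_G => [|z]; [exact/measurable_EFinP|rewrite /= lee_fin cell_weight_ge0].
- by move=> s _; rewrite mule_ge0// -w2 integral_ge0.
- have := has_law_ae h2 (integral_cell_weight_ae1 p ma).
  by apply: filterS => s /= -> _; rewrite mule1.
Qed.

(** [Q] has density [w] relative to [P1 \x P2]: the two systems are drawn independently given a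
    common cell of [y1] and [y2]. Agreement of [y1] and [y2] is thus relaxed to lying in one cell;
    the third clause expresses it by integrals, since [w] vanishes on pairs in different cells. *)
Lemma cell_gluing : exists Q : probability (S1 * S2)%type R,
  [/\ has_law Q fst P1, has_law Q snd P2 &
  forall f g : S1 * S2 -> \bar R,
    (forall z, (0 <= f z)%E) -> measurable_fun setT f ->
    (forall z, (0 <= g z)%E) -> measurable_fun setT g ->
    (forall z, a (y1 z.1) = a (y2 z.2) -> (f z <= g z)%E) ->
    (\int[Q]_z f z <= \int[Q]_z g z)%E].
Proof.
have wd : is_density (P1 \x P2)%E w.
  split=> //; first by move=> z; exact: cell_weight_ge0.
  have <- : (\int[P1]_s (cst 1 s) = 1 :> \bar R)%E.
    by rewrite integral_cst// mul1e; exact: probability_setT.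
  rewrite -(glue1 _ (measurable_cst _))//.
  by apply: eq_integral => z _; rewrite mul1e.
exists (density wd); split.
- apply: integral_has_law => // g g0 mg.
  by rewrite integral_density//= ?glue1//; exact: measurableT_comp.
- apply: integral_has_law => // g g0 mg.
  by rewrite integral_density//= ?glue2//; exact: measurableT_comp.
move=> f g f0 mf g0 mg fg; rewrite !integral_density//.
apply: ge0_le_integral => //.
- by move=> z _; rewrite mule_ge0 ?lee_fin ?cell_weight_ge0.
- by apply: emeasurable_funM => //; exact/measurable_EFinP.
- by apply: emeasurable_funM => //; exact/measurable_EFinP.
- move=> z _; rewrite /w /cell_weight; case: eqP => [/fg fgz|_].
    by rewrite lee_wpmul2r// lee_fin invr_ge0 fine_ge0.
  by rewrite !mule0.
Qed.

End glue.

(** * Powers of sums and the triangle inequality for transport costs *)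

Section powers.
Context {R : realType}.
Variable s : R.

Definition split_pow (c1 c2 : R) : Prop := forall a b, 0 <= a -> 0 <= b ->
  (a + b) `^ s <= c1 * a `^ s + c2 * b `^ s.

(** [a + b] is the combination, with weights [t] and [1 - t], of [a / t] and [b / (1 - t)], to which
    convexity of the power is applied. *)
Lemma split_pow_convex (t : R) : 1 <= s -> 0 < t < 1 ->
  split_pow (t `^ (1 - s)) ((1 - t) `^ (1 - s)).
Proof.
move=> s1 /andP[t0 t1] a b a0 b0.
have t'0 : 0 < 1 - t by rewrite subr_gt0.
have := @convex_powR R s s1 (Itv01 (ltW t0) (ltW t1)) (t^-1 * a) ((1 - t)^-1 * b).
rewrite !inE/= !in_itv/= !andbT !mulr_ge0 ?invr_ge0 ?(ltW t0) ?(ltW t'0)//.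
move=> /(_ isT isT).
rewrite convRE [X in X `^ _ <= _ -> _]convRE/= /unstable.onem.
rewrite mulVKf ?gt_eqF// mulVKf ?gt_eqF//.
have ti0 : 0 <= t^-1 by rewrite invr_ge0 ltW.
have ti1 : 0 <= (1 - t)^-1 by rewrite invr_ge0 ltW.
rewrite !powRM// !mulrA.
have E (x : R) : 0 < x -> x * x^-1 `^ s = x `^ (1 - s).
  move=> x0; rewrite -powR_inv1 ?ltW// -powRrM mulN1r powRD; last first.
    by rewrite (gt_eqF x0) implybT.
  by rewrite powRr1// ltW.
by rewrite !E.
Qed.

(** At the weight [t = 1 / (1 + tau)] the left constant is [1 + tau] to the power [s - 1], at most
    [1 + tau] because [s <= 2]. *)
Lemma split_pow_near (tau : R) : 1 <= s <= 2 -> 0 < tau ->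
  exists2 K, 0 <= K & split_pow (1 + tau) K.
Proof.
move=> /andP[s1 s2] tau0.
have tau1 : 1 <= 1 + tau by rewrite lerDl ltW.
have tau1' : 0 < 1 + tau by rewrite (lt_le_trans ltr01).
pose t := (1 + tau)^-1.
have t0 : 0 < t by rewrite invr_gt0.
have t1 : t < 1 by rewrite invf_lt1// ltrDl.
exists ((1 - t) `^ (1 - s)); first exact: powR_ge0.
have t01 : 0 < t < 1 by rewrite t0 t1.
move=> a b a0 b0; apply: (le_trans (split_pow_convex s1 t01 a0 b0)).
rewrite lerD2r ler_wpM2r ?powR_ge0//.
rewrite /t -powR_inv1 ?(ltW tau1')// -powRrM mulN1r opprB.
rewrite -[leRHS]powRr1 ?(ltW tau1')//.
by apply: ler_powR => //; rewrite lerBlDr.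
Qed.

(** Converts an error [eta] in a distance, such as the diameter of a cell, into a relative and an
    additive error [tau] in its power. *)
Lemma powR_perturb (tau : R) : 1 <= s <= 2 -> 0 < tau ->
  exists2 eta, 0 < eta & forall x y, 0 <= x -> 0 <= y -> y <= x + eta ->
    y `^ s <= (1 + tau) * x `^ s + tau.
Proof.
move=> s12 tau0; have [K K0 HK] := split_pow_near s12 tau0.
have /andP[s1 _] := s12.
have s0 : 0 <= s by rewrite (le_trans ler01).
have K1 : 0 < K + 1 by rewrite ltr_wpDl.
(* [eta <= 1] gives that [eta] to the power [s] is at most [eta], and the quotient gives
   [K * eta <= tau]. *)
pose eta := Num.min 1 (tau / (K + 1)).
have eta0 : 0 < eta by rewrite lt_min ltr01 divr_gt0.
exists eta => // x y x0 y0 yx.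
apply: (@le_trans _ _ ((x + eta) `^ s)).
  by apply: ge0_ler_powR => //; rewrite nnegrE// addr_ge0// ltW.
apply: (le_trans (HK _ _ x0 (ltW eta0))); rewrite lerD2l.
apply: (@le_trans _ _ (K * eta)).
  rewrite ler_wpM2l//; apply: ge1r_powR => //.
  by rewrite eta0 ge_min lexx.
apply: (@le_trans _ _ (K * (tau / (K + 1)))).
  by rewrite ler_wpM2l// ge_min lexx orbT.
rewrite mulrCA -[leRHS]mulr1 ler_wpM2l ?ltW//.
by rewrite ltr_pdivrMr// mul1r ltrDl.
Qed.

End powers.

Section transport_cost.
Context {R : realType} {d : measure_display} {X : measurableType d}.
Variables (dist : X -> X -> R) (s : R).
Hypotheses (cell : cellular dist) (s12 : 1 <= s <= 2).

Definition transport_cost (pi : probability (X * X)%type R) : \bar R :=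
  (\int[pi]_z ((dist z.1 z.2) `^ s)%:E)%E.

Lemma measurable_dist_pow d' (S : measurableType d') (f g : S -> X) :
  measurable_fun setT f -> measurable_fun setT g ->
  measurable_fun setT (fun z => ((dist (f z) (g z)) `^ s)%:E).
Proof.
move=> mf mg; apply/measurable_EFinP.
apply: (measurableT_comp (measurable_powR _)).
have [_ mdist _] := cell.
exact: (measurableT_comp mdist (measurable_fun_pair mf mg)).
Qed.

(** The two couplings are glued along their marginal [p] and the outer coordinates are kept. The two
    middle points only share a cell, and [powR_perturb] pays for their distance out of [e]. *)
Lemma coupling_triangle (q p p' : probability X R) pi1 pi2 (i1 i2 c1 c2 e : R) :
  couplings q p pi1 -> couplings p p' pi2 ->
  (transport_cost pi1 <= i1%:E)%E -> (transport_cost pi2 <= i2%:E)%E ->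
  0 <= c1 -> 0 <= c2 -> split_pow s c1 c2 -> 0 < e ->
  exists2 pi, couplings q p' pi &
    (transport_cost pi <= (c2 * i1 + c1 * i2 + e)%:E)%E.
Proof.
move=> /couplingsP[q1 p1] /couplingsP[p2 q2] I1 I2 c10 c20 split_c e0.
have [_ mdist mcell] := cell.
have [d0 _ dC tri] : is_metric dist by case: cell.
have i10 : 0 <= i1.
  by rewrite -lee_fin (le_trans _ I1)// integral_ge0// => z _; rewrite lee_fin powR_ge0.
have i20 : 0 <= i2.
  by rewrite -lee_fin (le_trans _ I2)// integral_ge0// => z _; rewrite lee_fin powR_ge0.
pose m := c2 * i1 + c1 * i2.
have m0 : 0 <= m by rewrite addr_ge0// mulr_ge0.
have m1 : 0 < m + 1 by rewrite ltr_wpDl.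
(* The relative error [tau * m] and the additive error [tau] add up to [e]. *)
pose tau := e / (m + 1).
have tau0 : 0 < tau by rewrite divr_gt0.
have [eta eta0 Heta] := powR_perturb s12 tau0.
have [a [ma Ha]] := mcell _ eta0.
have [Q [Q1 Q2 HQ]] := cell_gluing ma p1 p2.
have mf : measurable_fun setT (fun z : (X * X) * (X * X) => (z.1.1, z.2.2)).
  apply: measurable_fun_pair.
    exact: (measurableT_comp measurable_fst measurable_fst).
  exact: (measurableT_comp measurable_snd measurable_snd).
have m12 d1 d2 d3 d4 (T1 : measurableType d1) (T2 : measurableType d2)
    (T3 : measurableType d3) (T4 : measurableType d4) :
    [/\ measurable_fun setT (fun z : (T1 * T2) * (T3 * T4) => z.1.1),
        measurable_fun setT (fun z : (T1 * T2) * (T3 * T4) => z.1.2),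
        measurable_fun setT (fun z : (T1 * T2) * (T3 * T4) => z.2.1) &
        measurable_fun setT (fun z : (T1 * T2) * (T3 * T4) => z.2.2)].
  split.
  - exact: (measurableT_comp measurable_fst measurable_fst).
  - exact: (measurableT_comp measurable_snd measurable_fst).
  - exact: (measurableT_comp measurable_fst measurable_snd).
  - exact: (measurableT_comp measurable_snd measurable_snd).
have [m11 m12' m21 m22] := m12 _ _ _ _ X X X X.
exists (image_probability Q mf).
  apply/couplingsP; split; apply: integral_has_law => // g g0 mg.
    rewrite integral_image_probability//=; last exact: measurableT_comp.
    rewrite (has_law_integral Q1 (g := fun z => g z.1))//; last exact: measurableT_comp.
    exact: has_law_integral.
  rewrite integral_image_probability//=; last exact: measurableT_comp.
  rewrite (has_law_integral Q2 (g := fun z => g z.2))//; last exact: measurableT_comp.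
  exact: has_law_integral.
have pw0 x y : (0 <= ((dist x y) `^ s)%:E)%E by rewrite lee_fin powR_ge0.
rewrite /transport_cost integral_image_probability//=; last first.
  exact: measurable_dist_pow.
pose F (z : (X * X) * (X * X)) := (((1 + tau) * c2)%:E * ((dist z.1.1 z.1.2) `^ s)%:E)%E.
pose G (z : (X * X) * (X * X)) := (((1 + tau) * c1)%:E * ((dist z.2.1 z.2.2) `^ s)%:E)%E.
have tau1 : 0 <= 1 + tau by rewrite addr_ge0// ltW.
have k1 : 0 <= (1 + tau) * c1 by rewrite mulr_ge0.
have k2 : 0 <= (1 + tau) * c2 by rewrite mulr_ge0.
have F0 z : (0 <= F z)%E by rewrite mule_ge0.
have G0 z : (0 <= G z)%E by rewrite mule_ge0.
have mF : measurable_fun setT F.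
  by apply: measurable_funeM; exact: measurable_dist_pow.
have mG : measurable_fun setT G.
  by apply: measurable_funeM; exact: measurable_dist_pow.
apply: (@le_trans _ _ (\int[Q]_z (F z + G z + tau%:E))%E).
  apply: HQ => //.
  - exact: measurable_dist_pow.
  - by move=> z; rewrite adde_ge0// ?adde_ge0// lee_fin ltW.
  - by apply: emeasurable_funD => //; exact: emeasurable_funD.
  move=> [[x y] [y' z]]/= /Ha yy'.
  rewrite /F /G/= -!EFinM -!EFinD lee_fin.
  apply: (le_trans (Heta (dist x y + dist y' z) _ _ _ _)) => //.
  - by rewrite addr_ge0.
  - have := tri x y z; have := tri y y' z; lra.
  - rewrite lerD2r -!mulrA -mulrDr ler_wpM2l// addrC [leRHS]addrC.
    exact: split_c.
have FG0 z : (0 <= F z + G z)%E by rewrite adde_ge0.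
have mFG : measurable_fun setT (fun z => F z + G z)%E by exact: emeasurable_funD.
have tau0E : (0 <= tau%:E)%E by rewrite lee_fin ltW.
rewrite ge0_integralD//.
rewrite ge0_integralD//.
rewrite integral_probability_cst.
have mpw := measurable_dist_pow (@measurable_fst _ _ X X) (@measurable_snd _ _ X X).
rewrite (has_law_integral Q1 (g := fun z => ((1 + tau) * c2)%:E * (dist z.1 z.2 `^ s)%:E)%E)//; last 2 first.
- by move=> z; rewrite mule_ge0.
- exact: measurable_funeM.
rewrite (has_law_integral Q2 (g := fun z => ((1 + tau) * c1)%:E * (dist z.1 z.2 `^ s)%:E)%E)//; last 2 first.
- by move=> z; rewrite mule_ge0.
- exact: measurable_funeM.
rewrite !ge0_integralZl//.
apply: (@le_trans _ _ (((1 + tau) * c2)%:E * i1%:E + ((1 + tau) * c1)%:E * i2%:E + tau%:E)%E).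
  by rewrite leeD2r// leeD// lee_wpmul2l.
rewrite -!EFinM -!EFinD lee_fin.
have : tau * (m + 1) = e by rewrite /tau divfK// gt_eqF.
rewrite /m; nra.
Qed.

End transport_cost.

(** * Couplings with cellwise constant density, and their approximation by finite tables *)

Section completion.
Context {R : realType} {d : measure_display} {X : measurableType d}.
Variables (q p : probability X R) (a : X -> nat) (h : nat -> nat -> R).
Hypotheses (ma : measurable_fun setT a) (h0 : forall i j, 0 <= h i j).

Let hh (z : X * X) := h (a z.1) (a z.2).

Lemma measurable_cell_fun d' (S : measurableType d') (f g : S -> X) :
  measurable_fun setT f -> measurable_fun setT g ->
  measurable_fun setT (fun s => h (a (f s)) (a (g s))).
Proof.
move=> mf mg.
have maf : measurable_fun setT (a \o f) by exact: measurableT_comp.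
have mag : measurable_fun setT (a \o g) by exact: measurableT_comp.
apply: (@measurable_fun_nat_param R _ _ _ _ (a \o f) (fun i s => h i (a (g s)))) => // i.
exact: (@measurable_fun_nat_param R _ _ _ _ (a \o g) (fun j _ => h i j)).
Qed.

Definition row_mass (i : nat) : \bar R := (\int[p]_v (h i (a v))%:E)%E.
Definition col_mass (j : nat) : \bar R := (\int[q]_u (h (a u) j)%:E)%E.
Definition total_mass : \bar R := (\int[(q \x p)%E]_z (hh z)%:E)%E.

(** The strict inequality keeps the normalising factor of [completion] positive. Rows and columns
    are constrained at the labels attained by [a]. *)
Definition feasible : Prop :=
  [/\ forall u, (row_mass (a u) <= 1)%E, forall v, (col_mass (a v) <= 1)%E &
      (total_mass < 1)%E].

(* The subcoupling with density [h] is completed into a coupling by adding the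
   normalised product of the two residual marginals. *)
Definition completion (z : X * X) : R :=
  hh z + (1 - fine (row_mass (a z.1))) * (1 - fine (col_mass (a z.2)))
         / (1 - fine total_mass).

Let mhh : measurable_fun setT (fun z => (hh z)%:E).
Proof. by apply/measurable_EFinP; exact: measurable_cell_fun. Qed.

Let hh0 z : (0 <= (hh z)%:E)%E. Proof. by rewrite lee_fin; exact: h0. Qed.

Let row_ge0 i : (0 <= row_mass i)%E.
Proof. by apply: integral_ge0 => v _; rewrite lee_fin. Qed.

Let col_ge0 i : (0 <= col_mass i)%E.
Proof. by apply: integral_ge0 => v _; rewrite lee_fin. Qed.

Let tot_ge0 : (0 <= total_mass)%E.
Proof. exact: integral_ge0. Qed.

Hypothesis feas : feasible.

Let fin1 (x : \bar R) : (0 <= x)%E -> (x <= 1)%E -> x \is a fin_num.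
Proof.
by move=> x0 x1; rewrite ge0_fin_numE// (le_lt_trans x1)// ltry.
Qed.

Let rowE u : ((fine (row_mass (a u)))%:E = row_mass (a u))%E.
Proof. by have [r _ _] := feas; rewrite fineK//; apply: fin1. Qed.

Let colE u : ((fine (col_mass (a u)))%:E = col_mass (a u))%E.
Proof. by have [_ r _] := feas; rewrite fineK//; apply: fin1. Qed.

Let totE : ((fine total_mass)%:E = total_mass)%E.
Proof. by have [_ _ /ltW r] := feas; rewrite fineK//; apply: fin1. Qed.

Let f u := 1 - fine (row_mass (a u)).
Let g v := 1 - fine (col_mass (a v)).
Let Z := 1 - fine total_mass.

Let f0 u : 0 <= f u.
Proof. by have [r _ _] := feas; rewrite subr_ge0 -lee_fin rowE. Qed.

Let g0 u : 0 <= g u.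
Proof. by have [_ r _] := feas; rewrite subr_ge0 -lee_fin colE. Qed.

Let Z0 : 0 < Z.
Proof. by have [_ _ r] := feas; rewrite subr_gt0 -lte_fin totE. Qed.

Let mf : measurable_fun setT (fun u => (f u)%:E).
Proof.
apply/measurable_EFinP.
exact: (@measurable_fun_nat_param R _ _ _ _ a (fun i _ => 1 - fine (row_mass i))).
Qed.

Let mg : measurable_fun setT (fun u => (g u)%:E).
Proof.
apply/measurable_EFinP.
exact: (@measurable_fun_nat_param R _ _ _ _ a (fun i _ => 1 - fine (col_mass i))).
Qed.

Let int_row : (\int[q]_u row_mass (a u) = total_mass)%E.
Proof. by rewrite /total_mass fubini_tonelli1. Qed.

Let int_col : (\int[p]_u col_mass (a u) = total_mass)%E.
Proof. by rewrite /total_mass fubini_tonelli2. Qed.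

Let fe0 u : (0 <= (f u)%:E)%E. Proof. by rewrite lee_fin. Qed.
Let ge0 u : (0 <= (g u)%:E)%E. Proof. by rewrite lee_fin. Qed.

Let int_f : (\int[q]_u (f u)%:E = Z%:E)%E.
Proof.
have mr : measurable_fun setT (fun u => row_mass (a u)).
  exact: (@measurable_fun_nat_param R _ _ _ _ a (fun i _ => row_mass i)).
have : (\int[q]_u ((f u)%:E + row_mass (a u)) = 1)%E.
  rewrite -[RHS](integral_probability_cst q).
  by apply: eq_integral => u _; rewrite -rowE -EFinD subrK.
rewrite ge0_integralD// int_row -totE => H.
by rewrite /Z EFinB -H addeK.
Qed.

Let int_g : (\int[p]_u (g u)%:E = Z%:E)%E.
Proof.
have mr : measurable_fun setT (fun u => col_mass (a u)).
  exact: (@measurable_fun_nat_param R _ _ _ _ a (fun i _ => col_mass i)).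
have : (\int[p]_u ((g u)%:E + col_mass (a u)) = 1)%E.
  rewrite -[RHS](integral_probability_cst p).
  by apply: eq_integral => u _; rewrite -colE -EFinD subrK.
rewrite ge0_integralD// int_col -totE => H.
by rewrite /Z EFinB -H addeK.
Qed.

Let res (z : X * X) : \bar R := ((f z.1)%:E * (g z.2)%:E * (Z^-1)%:E)%E.

Let Zi0 : (0 <= (Z^-1)%:E :> \bar R)%E.
Proof. by rewrite lee_fin invr_ge0 ltW. Qed.

Let res0 z : (0 <= res z)%E.
Proof. by rewrite !mule_ge0. Qed.

Let mres : measurable_fun setT res.
Proof.
apply: emeasurable_funM => //; apply: emeasurable_funM.
  exact: (measurableT_comp mf measurable_fst).
exact: (measurableT_comp mg measurable_snd).
Qed.

Let completionE z : ((completion z)%:E = (hh z)%:E + res z)%E.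
Proof. by rewrite /completion EFinD !EFinM. Qed.

Lemma completion_ge0 z : 0 <= completion z.
Proof. by rewrite -lee_fin completionE adde_ge0. Qed.

Lemma measurable_completion : measurable_fun setT completion.
Proof.
apply/measurable_EFinP.
rewrite (_ : EFin \o _ = (fun z => (hh z)%:E + res z)%E); last first.
  by apply/funext => z; rewrite -completionE.
exact: emeasurable_funD.
Qed.

(** The residual is a product whose factors [f] and [g] both have integral [Z], so integrating out
    one coordinate cancels [Z^-1]. A sum of functions of one coordinate each is what the triangle
    inequality makes of the cost. *)
Lemma integral_residual (phi psi : X -> \bar R) :
  (forall u, (0 <= phi u)%E) -> measurable_fun setT phi ->
  (forall u, (0 <= psi u)%E) -> measurable_fun setT psi ->
  (\int[(q \x p)%E]_z ((phi z.1 + psi z.2) * res z) =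
   \int[q]_u (phi u * (f u)%:E) + \int[p]_v (psi v * (g v)%:E))%E.
Proof.
move=> phi0 mphi psi0 mpsi.
have mphi1 : measurable_fun setT (fun z : X * X => phi z.1) by exact: measurableT_comp.
have mpsi2 : measurable_fun setT (fun z : X * X => psi z.2) by exact: measurableT_comp.
have m1 : measurable_fun setT (fun z : X * X => phi z.1 * res z)%E.
  exact: emeasurable_funM.
have m2 : measurable_fun setT (fun z : X * X => psi z.2 * res z)%E.
  exact: emeasurable_funM.
have p1 z : (0 <= phi z.1 * res z)%E by rewrite mule_ge0.
have p2 z : (0 <= psi z.2 * res z)%E by rewrite mule_ge0.
under eq_integral do rewrite ge0_muleDl//.
rewrite ge0_integralD//.
have ZZ : (Z%:E * (Z^-1)%:E = 1)%E by rewrite -EFinM divff// gt_eqF.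
congr (_ + _)%E.
  rewrite fubini_tonelli1// /fubini_F/=.
  apply: eq_integral => u _.
  under eq_integral => v _.
    rewrite (_ : _ * _ = (phi u * (f u)%:E * (Z^-1)%:E) * (g v)%:E)%E; last first.
      by rewrite /res/= -!muleA; congr (_ * (_ * _))%E; rewrite muleC.
    over.
  rewrite ge0_integralZl// ?mule_ge0// int_g.
  by rewrite -[LHS]muleA [X in (_ * X)%E]muleC ZZ mule1.
rewrite fubini_tonelli2// /fubini_G/=.
apply: eq_integral => v _.
under eq_integral => u _.
  rewrite (_ : _ * _ = (psi v * (g v)%:E * (Z^-1)%:E) * (f u)%:E)%E; last first.
    by rewrite /res/= (muleC (f u)%:E) -!muleA; congr (_ * (_ * _))%E; rewrite muleC.
  over.
rewrite ge0_integralZl// ?mule_ge0// int_f.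
by rewrite -[LHS]muleA [X in (_ * X)%E]muleC ZZ mule1.
Qed.

Lemma integral_completion (phi : X * X -> \bar R) :
  (forall z, (0 <= phi z)%E) -> measurable_fun setT phi ->
  (\int[(q \x p)%E]_z (phi z * (completion z)%:E) =
   \int[(q \x p)%E]_z (phi z * (hh z)%:E) + \int[(q \x p)%E]_z (phi z * res z))%E.
Proof.
move=> phi0 mphi.
under eq_integral do rewrite completionE ge0_muleDr//.
rewrite ge0_integralD//.
- by move=> z _; rewrite mule_ge0.
- exact: emeasurable_funM.
- by move=> z _; rewrite mule_ge0.
- exact: emeasurable_funM.
Qed.

Lemma completion_marginal1 (phi : X -> \bar R) :
  (forall z, (0 <= phi z)%E) -> measurable_fun setT phi ->
  (\int[(q \x p)%E]_z (phi z.1 * (completion z)%:E) = \int[q]_u phi u)%E.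
Proof.
move=> phi0 mphi.
have mphi1 : measurable_fun setT (fun z : X * X => phi z.1) by exact: measurableT_comp.
rewrite (@integral_completion (fun z => phi z.1))//.
under [X in (_ + X)%E]eq_integral do rewrite -[X in (X * _)%E]adde0.
rewrite (@integral_residual phi (fun=> 0%E))//.
under [X in (_ + (_ + X))%E]eq_integral do rewrite mul0e.
rewrite integral0 adde0 fubini_tonelli1//; last 2 first.
- exact: emeasurable_funM.
- by move=> z; rewrite mule_ge0.
rewrite /fubini_F/=.
have mhu u : measurable_fun setT (fun v => (hh (u, v))%:E).
  by apply: (measurableT_comp mhh); exact: measurable_pair1.
have rowI u : (\int[p]_v (hh (u, v))%:E = row_mass (a u))%E by [].
under eq_integral do rewrite ge0_integralZl// rowI.
have mr : measurable_fun setT (fun u => row_mass (a u)).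
  exact: (@measurable_fun_nat_param R _ _ _ _ a (fun i _ => row_mass i)).
rewrite -ge0_integralD//.
- apply: eq_integral => u _; rewrite -ge0_muleDr//.
  rewrite -rowE -EFinD.
  by rewrite /f addrC subrK mule1.
- by move=> u _; rewrite mule_ge0.
- exact: emeasurable_funM.
- by move=> u _; rewrite mule_ge0.
- exact: emeasurable_funM.
Qed.

Lemma completion_marginal2 (phi : X -> \bar R) :
  (forall z, (0 <= phi z)%E) -> measurable_fun setT phi ->
  (\int[(q \x p)%E]_z (phi z.2 * (completion z)%:E) = \int[p]_v phi v)%E.
Proof.
move=> phi0 mphi.
have mphi1 : measurable_fun setT (fun z : X * X => phi z.2) by exact: measurableT_comp.
rewrite (@integral_completion (fun z => phi z.2))//.
under [X in (_ + X)%E]eq_integral do rewrite -[X in (X * _)%E]add0e.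
rewrite (@integral_residual (fun=> 0%E) phi)//.
under [X in (_ + (X + _))%E]eq_integral do rewrite mul0e.
rewrite integral0 add0e fubini_tonelli2//; last 2 first.
- exact: emeasurable_funM.
- by move=> z; rewrite mule_ge0.
rewrite /fubini_G/=.
have mhu u : measurable_fun setT (fun v => (hh (v, u))%:E).
  by apply: (measurableT_comp mhh); exact: measurable_pair2.
have colI u : (\int[q]_v (hh (v, u))%:E = col_mass (a u))%E by [].
under eq_integral do rewrite ge0_integralZl// colI.
have mr : measurable_fun setT (fun u => col_mass (a u)).
  exact: (@measurable_fun_nat_param R _ _ _ _ a (fun i _ => col_mass i)).
rewrite -ge0_integralD//.
- apply: eq_integral => u _; rewrite -ge0_muleDr//.
  rewrite -colE -EFinD.
  by rewrite /g addrC subrK mule1.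
- by move=> u _; rewrite mule_ge0.
- exact: emeasurable_funM.
- by move=> u _; rewrite mule_ge0.
- exact: emeasurable_funM.
Qed.

Lemma completion_density : is_density (q \x p)%E completion.
Proof.
split; [exact: completion_ge0|exact: measurable_completion|].
rewrite -[RHS](integral_probability_cst q).
rewrite -(completion_marginal1 _ (measurable_cst _))//.
by apply: eq_integral => z _; rewrite mul1e.
Qed.

End completion.

Import numFieldNormedType.Exports.

Section residual_vanishes.
Context {R : realType} {d : measure_display} {X : measurableType d}.
Variables (q p : probability X R) (a : X -> nat).
Hypothesis ma : measurable_fun setT a.
Variables (h_ : nat -> nat -> nat -> R) (D : nat -> nat -> R).
Hypothesis h_ge0 : forall N i j, 0 <= h_ N i j.
Hypothesis h_le : forall N i j, h_ N i j <= D i j.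
Hypothesis h_cvg : forall i j, h_ N i j @[N --> \oo] --> D i j.
Hypothesis D_le1 : forall u, (row_mass p a D (a u) <= 1)%E.
Hypothesis D_ae1 : {ae q, forall u, row_mass p a D (a u) = 1%E}.

Let mcell (k : nat -> R) : measurable_fun setT (fun v => (k (a v))%:E).
Proof.
apply/measurable_EFinP.
exact: (@measurable_fun_nat_param R _ _ _ _ a (fun j _ => k j)).
Qed.

Lemma row_mass_cvg u : row_mass p a (h_ N) (a u) @[N --> \oo] --> row_mass p a D (a u).
Proof.
have DN j i : 0 <= D j i by rewrite (le_trans (h_ge0 0 j i)).
have iD : p.-integrable setT (fun v => (D (a u) (a v))%:E).
  apply/integrableP; split; first exact: mcell.
  under eq_integral do rewrite gee0_abs ?lee_fin//.
  by rewrite (le_lt_trans (D_le1 u))// ltry.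
have hD : {ae p, forall v, setT v -> (h_ N (a u) (a v))%:E @[N --> \oo] --> (D (a u) (a v))%:E}.
  by apply: aeW => v _; apply: cvg_EFin; [exact: nearW|exact: h_cvg].
have hb : {ae p, forall v N, setT v -> (`|(h_ N (a u) (a v))%:E| <= (D (a u) (a v))%:E)%E}.
  by apply: aeW => v N _; rewrite gee0_abs ?lee_fin.
by have [_ _] := dominated_convergence measurableT (fun N => mcell _) (mcell _) hD iD hb.
Qed.

(** The row masses converge to those of [D], which are almost everywhere 1, and [phi] dominates.
    Applied to powers of distances to a base point, this makes the cost carried by the residual
    negligible. *)
Lemma residual_vanishes (phi : X -> \bar R) :
  (forall u, (0 <= phi u)%E) -> measurable_fun setT phi ->
  (\int[q]_u phi u < +oo)%E ->
  (\int[q]_u (phi u * (1 - fine (row_mass p a (h_ N) (a u)))%:E))%E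
    @[N --> \oo] --> 0%E.
Proof.
move=> phi0 mphi iphi.
have row0 N u : (0 <= row_mass p a (h_ N) (a u))%E.
  by apply: integral_ge0 => v _; rewrite lee_fin.
have row1 N u : (row_mass p a (h_ N) (a u) <= 1)%E.
  apply: (le_trans _ (D_le1 u)); apply: ge0_le_integral => //.
  - by move=> v _; rewrite lee_fin.
  - by move=> v _; rewrite lee_fin.
have fin N u : row_mass p a (h_ N) (a u) \is a fin_num.
  by rewrite ge0_fin_numE// (le_lt_trans (row1 N u))// ltry.
have f0 N u : 0 <= 1 - fine (row_mass p a (h_ N) (a u)).
  by rewrite subr_ge0 -lee_fin fineK.
have f1 N u : 1 - fine (row_mass p a (h_ N) (a u)) <= 1.
  by rewrite gerBl fine_ge0.
have iphi' : q.-integrable setT phi.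
  apply/integrableP; split => //.
  by under eq_integral do rewrite gee0_abs//.
rewrite -[X in _ --> X](integral0 q setT).
pose F N u := (phi u * (1 - fine (row_mass p a (h_ N) (a u)))%:E)%E.
have mF N : measurable_fun setT (F N).
  apply: emeasurable_funM => //.
  by have := mcell (fun i => 1 - fine (row_mass p a (h_ N) i)).
have hD : {ae q, forall u, setT u -> F N u @[N --> \oo] --> 0%E}.
  have ae_fin := integrable_ae measurableT iphi'.
  apply: filterS2 ae_fin D_ae1 => u /(_ I) finphi D1 _.
  rewrite -[X in _ --> X](mule0 (phi u)).
  apply: cvgeZl => //; rewrite (_ : 0%E = (1 - 1)%:E); last by rewrite subrr.
  apply: cvg_EFin; first exact: nearW.
  apply: cvgB; first exact: cvg_cst.
  apply: (@fine_cvg _ _ _ _ (fun N => row_mass p a (h_ N) (a u))).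
  by rewrite -D1; exact: row_mass_cvg.
have hb : {ae q, forall u N, setT u -> (`|F N u| <= phi u)%E}.
  apply: aeW => u N _; rewrite gee0_abs; last by rewrite mule_ge0// lee_fin.
  by rewrite -[leRHS]mule1 lee_wpmul2l// lee_fin.
by have [_ _] := dominated_convergence measurableT mF (measurable_cst _) hD iphi' hb.
Qed.

End residual_vanishes.

Section approximation.
Context {R : realType} {d : measure_display} {X : measurableType d}.

(** A finite table of numerators over the common denominator [c.1.+1], extended by zero. Codes form
    a countable type, so they can be enumerated by integers. *)
Definition cell_code (c : nat * seq (seq nat)) (i j : nat) : R :=
  (nth 0%N (nth [::] c.2 i) j)%:R / (c.1.+1)%:R.

Lemma cell_code_ge0 c i j : 0 <= cell_code c i j.
Proof. by rewrite /cell_code divr_ge0. Qed.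

(* The factor [1 - 1/(N+2)] makes the total mass of the approximation
   strictly smaller than 1. *)
Definition code_approx (D : nat -> nat -> R) (N : nat) : nat * seq (seq nat) :=
  (N, mkseq (fun i => mkseq (fun j =>
    Num.truncn (N.+1%:R * ((1 - N.+2%:R^-1) * D i j))) N) N).

Lemma cell_code_approxE D N i j : cell_code (code_approx D N) i j =
  if (i < N)%N && (j < N)%N then
    (Num.truncn (N.+1%:R * ((1 - N.+2%:R^-1) * D i j)))%:R / N.+1%:R else 0.
Proof.
rewrite /cell_code/=; have [iN|iN] := ltnP i N; last first.
  by rewrite (nth_default [::]) ?size_mkseq// nth_nil mul0r.
rewrite nth_mkseq//; have [jN|jN] := ltnP j N.
  by rewrite nth_mkseq.
by rewrite nth_default ?size_mkseq// mul0r.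
Qed.

Let lam_ge0 N : 0 <= 1 - N.+2%:R^-1 :> R.
Proof. by rewrite subr_ge0 invf_le1// ler1n. Qed.

Lemma code_approx_le (D : nat -> nat -> R) N i j : (forall i j, 0 <= D i j) ->
  cell_code (code_approx D N) i j <= (1 - N.+2%:R^-1) * D i j.
Proof.
move=> D0; have l0 : 0 <= (1 - N.+2%:R^-1) * D i j by rewrite mulr_ge0.
rewrite cell_code_approxE; case: ifP => // _.
rewrite ler_pdivrMr// [leRHS]mulrC.
have t0 : 0 <= N.+1%:R * ((1 - N.+2%:R^-1) * D i j) by rewrite mulr_ge0.
by have /andP[] := truncn_itv t0.
Qed.

Lemma code_approx_le_id (D : nat -> nat -> R) N i j : (forall i j, 0 <= D i j) ->
  cell_code (code_approx D N) i j <= D i j.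
Proof.
move=> D0; apply: (le_trans (code_approx_le N i j D0)).
by rewrite -[leRHS]mul1r ler_wpM2r// gerBl.
Qed.

Lemma code_approx_cvg (D : nat -> nat -> R) i j : (forall i j, 0 <= D i j) ->
  cell_code (code_approx D N) i j @[N --> \oo] --> D i j.
Proof.
move=> D0.
(* Truncation loses at most [1 / (N + 1)] and the factor below 1 loses [D i j / (N + 2)]. *)
apply: (@squeeze_cvgr _ _ _ _ (fun N => D i j - (D i j + 1) * harmonic N) (cst (D i j))).
- near=> N; rewrite code_approx_le_id// andbT cell_code_approxE.
  have iN : (i < N)%N by near: N; exact: nbhs_infty_gt.
  have jN : (j < N)%N by near: N; exact: nbhs_infty_gt.
  rewrite iN jN/= ler_pdivlMr//.
  set t := N.+1%:R * _.
  have t0 : 0 <= t by rewrite mulr_ge0// mulr_ge0.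
  have /andP[_ tt] := truncn_itv t0.
  have {tt} : t - 1 <= (Num.truncn t)%:R.
    by rewrite lerBlDr (le_trans (ltW tt))// -natr1.
  apply: le_trans; rewrite /t /harmonic/=.
  have NN : N.+1%:R^-1 * N.+1%:R = 1 :> R by rewrite mulVf.
  have -> : (D i j - (D i j + 1) / N.+1%:R) * N.+1%:R =
    N.+1%:R * D i j - D i j - 1 by rewrite mulrBl -mulrA NN; ring.
  rewrite lerD2r mulrA mulrBr mulr1 mulrBl lerD2l lerN2 ler_piMl//.
  by rewrite ler_pdivrMr// mul1r ler_nat.
- rewrite -[X in _ --> X]subr0; apply: cvgB; first exact: cvg_cst.
  rewrite -[X in _ --> X](mulr0 (D i j + 1)); apply: cvgM; first exact: cvg_cst.
  exact: cvg_harmonic.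
- exact: cvg_cst.
Unshelve. all: by end_near. Qed.

End approximation.

Section cell_matrix.
Context {R : realType} {d : measure_display} {X : measurableType d}.
Variable a : X -> nat.
Hypothesis ma : measurable_fun setT a.

(** The density relative to [q \x p] of the coarsened coupling, which gives each product of cells
    the same mass as [pi] and is proportional to the product measure there. Negligible cells get 0,
    the value of a division by 0. *)
Definition cell_matrix (q p : probability X R) (pi : probability (X * X)%type R)
    (i j : nat) : R :=
  fine (pi ((a @^-1` [set i]) `*` (a @^-1` [set j]))) /
  (fine (q (a @^-1` [set i])) * fine (p (a @^-1` [set j]))).

Lemma cell_matrix_ge0 q p pi i j : 0 <= cell_matrix q p pi i j.
Proof. by rewrite /cell_matrix divr_ge0// ?mulr_ge0// fine_ge0. Qed.

Let mcell i : measurable (a @^-1` [set i]).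
Proof. by rewrite -[X in measurable X]setTI; exact: ma. Qed.

(** Written as an average of cell weights over [pi], the matrix can be handled by exchanging
    integrals. *)
Lemma cell_matrixE q p pi u v : ((cell_matrix q p pi (a u) (a v))%:E =
  \int[pi]_w (cell_weight q a u w.1 * cell_weight p a v w.2)%:E)%E.
Proof.
pose U := (a @^-1` [set a u]) `*` (a @^-1` [set a v]).
have mU : measurable U by exact: measurableX.
pose k := ((fine (q (a @^-1` [set a u])))^-1 * (fine (p (a @^-1` [set a v])))^-1).
have k0 : (0 <= k%:E :> \bar R)%E.
  by rewrite lee_fin mulr_ge0// invr_ge0 fine_ge0.
transitivity (\int[pi]_w (k%:E * (\1_U w)%:E))%E; last first.
  apply: eq_integral => w _; rewrite /cell_weight indicE -EFinM.
  have -> : (w \in U) = (a u == a w.1) && (a v == a w.2).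
    apply/idP/andP => [/set_mem[/= -> ->]//|[/eqP au /eqP av]].
    by apply/mem_set; split => /=.
  by case: eqP => _; case: eqP => _; rewrite /= ?mulr1 ?mulr0 ?mul0r.
rewrite ge0_integralZl//; last first.
  by apply/measurable_EFinP; exact: measurable_indic.
rewrite integral_indic// setIT /cell_matrix -/U.
have piU : pi U \is a fin_num by exact: fin_num_measure.
transitivity (k%:E * (fine (pi U))%:E)%E; last by congr (_ * _)%E; exact: fineK.
by rewrite -EFinM invfM mulrC.
Qed.

Let mcw q d' (S : measurableType d') (f g : S -> X) : measurable_fun setT f ->
  measurable_fun setT g ->
  measurable_fun setT (fun s => (cell_weight q a (f s) (g s) : R)%:E).
Proof. by move=> mf mg; apply/measurable_EFinP; exact: measurable_cell_weight. Qed.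

Let cw0 (q : probability X R) u v : (0 <= (cell_weight q a u v)%:E)%E.
Proof. by rewrite lee_fin cell_weight_ge0. Qed.

Section row.
Variables (q p : probability X R) (pi : probability (X * X)%type R).
Hypotheses (q1 : has_law pi fst q) (p2 : has_law pi snd p).

(** Integrating out [v] removes the second weight: it has mass 1 for almost every second coordinate,
    whose law under [pi] is [p]. *)
Lemma row_cell_matrix u : (row_mass p a (cell_matrix q p pi) (a u) =
  \int[q]_u' (cell_weight q a u u')%:E)%E.
Proof.
rewrite /row_mass.
under eq_integral do rewrite cell_matrixE.
rewrite (@fubini_tonelli _ _ _ _ _ p pi
  (fun t => (cell_weight q a u t.2.1 * cell_weight p a t.1 t.2.2)%:E))/=; last 2 first.
- under eq_fun do rewrite EFinM.
  by apply: emeasurable_funM; apply: mcw => //; exact: measurableT_comp.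
- by move=> t; rewrite EFinM mule_ge0.
have step w : (\int[p]_v (cell_weight q a u w.1 * cell_weight p a v w.2)%:E =
   (cell_weight q a u w.1)%:E * \int[p]_v (cell_weight p a w.2 v)%:E)%E.
  under eq_integral do rewrite EFinM [cell_weight p _ _ _]cell_weightC.
  by rewrite ge0_integralZl//; exact: mcw.
under eq_integral do rewrite step.
rewrite -(has_law_integral q1 (g := fun u' => (cell_weight q a u u')%:E))//; last exact: mcw.
apply: ge0_ae_eq_integral => //.
- apply: emeasurable_funM; first exact: mcw.
  apply: (@measurable_kernel_integral _ _ _ _ _ (fun=> p)
    (fun _ _ => measurable_cst _) (fun t => (cell_weight p a t.1.2 t.2)%:E)) => //.
  by apply: mcw => //; exact: measurableT_comp.
- exact: mcw.
- by move=> w _; rewrite mule_ge0// integral_ge0.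
- have := has_law_ae p2 (integral_cell_weight_ae1 p ma).
  by apply: filterS => w /= -> _; rewrite mule1.
Qed.

Lemma row_cell_matrix_le1 u : (row_mass p a (cell_matrix q p pi) (a u) <= 1)%E.
Proof. by rewrite row_cell_matrix; exact: integral_cell_weight_le1. Qed.

Lemma row_cell_matrix_ae1 :
  {ae q, forall u, row_mass p a (cell_matrix q p pi) (a u) = 1%E}.
Proof.
apply: filterS (integral_cell_weight_ae1 q ma) => u <-.
exact: row_cell_matrix.
Qed.

(** Draw [w] from [pi] and resample each coordinate inside its cell: the result [z] follows the
    coarsened coupling. The bound [phi z <= psi w] holds along the way, and the resampling density
    [W] has mass at most 1. *)
Lemma integral_cell_matrix_le (phi psi : X * X -> \bar R) :
  (forall z, (0 <= phi z)%E) -> measurable_fun setT phi ->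
  (forall z, (0 <= psi z)%E) -> measurable_fun setT psi ->
  (forall z w, a z.1 = a w.1 -> a z.2 = a w.2 -> (phi z <= psi w)%E) ->
  (\int[(q \x p)%E]_z (phi z * (cell_matrix q p pi (a z.1) (a z.2))%:E) <=
   \int[pi]_w psi w)%E.
Proof.
move=> phi0 mphi psi0 mpsi phipsi.
pose W (z w : X * X) := ((cell_weight q a z.1 w.1 * cell_weight p a z.2 w.2)%:E : \bar R).
have W0 z w : (0 <= W z w)%E by rewrite /W EFinM mule_ge0.
have mW d' (S : measurableType d') (f g : S -> X * X) : measurable_fun setT f ->
    measurable_fun setT g -> measurable_fun setT (fun s => W (f s) (g s)).
  move=> mf mg; under eq_fun do rewrite /W EFinM.
  by apply: emeasurable_funM; apply: mcw => //; exact: measurableT_comp.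
have mpW : measurable_fun setT (fun t : (X * X) * (X * X) => phi t.1 * W t.1 t.2)%E.
  apply: emeasurable_funM; first exact: (measurableT_comp mphi measurable_fst).
  exact: (mW _ _ fst snd measurable_fst measurable_snd).
have pW0 t : (0 <= phi t.1 * W t.1 t.2)%E by rewrite mule_ge0.
have -> : (\int[(q \x p)%E]_z (phi z * (cell_matrix q p pi (a z.1) (a z.2))%:E) =
    \int[(q \x p)%E]_z \int[pi]_w (phi z * W z w))%E.
  apply: eq_integral => z _; rewrite cell_matrixE; apply/esym.
  apply: ge0_integralZl => //.
  exact: (mW _ _ (cst z) id (measurable_cst _) (@measurable_id _ _ _)).
have -> : (\int[(q \x p)%E]_z \int[pi]_w (phi z * W z w) =
    \int[pi]_w \int[(q \x p)%E]_z (phi z * W z w))%E.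
  exact: (@fubini_tonelli _ _ _ _ _ ((q \x p)%E : probability _ R) pi _ mpW pW0).
have W1 w : (\int[(q \x p)%E]_z W z w <= 1)%E.
  rewrite fubini_tonelli1//; last exact: (mW _ _ id (cst w) (@measurable_id _ _ _) (measurable_cst _)).
  rewrite /fubini_F/=.
  have step x : (\int[p]_y W (x, y) w =
      (cell_weight q a x w.1)%:E * \int[p]_y (cell_weight p a w.2 y)%:E)%E.
    under eq_integral do rewrite /W/= EFinM [cell_weight p _ _ _]cell_weightC.
    by rewrite ge0_integralZl//; exact: mcw.
  under eq_integral do rewrite step muleC.
  rewrite ge0_integralZl//; last 2 first.
  - exact: mcw.
  - by rewrite integral_ge0.
  rewrite -[leRHS]mule1; apply: lee_pmul.
  - by rewrite integral_ge0.
  - by rewrite integral_ge0.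
  - exact: integral_cell_weight_le1.
  - under eq_integral do rewrite cell_weightC.
    exact: integral_cell_weight_le1.
apply: ge0_le_integral => //.
- by move=> w _; apply: integral_ge0 => z _; rewrite mule_ge0.
- apply: (@measurable_kernel_integral _ _ _ _ _ (fun=> (q \x p)%E)
    (fun _ _ => measurable_cst _) (fun t => phi t.2 * W t.2 t.1)%E) => //.
  + by move=> t; rewrite mule_ge0.
  + apply: emeasurable_funM; first exact: (measurableT_comp mphi measurable_snd).
    exact: (mW _ _ snd fst measurable_snd measurable_fst).
move=> w _; rewrite -[leRHS]mule1.
apply: (@le_trans _ _ (psi w * \int[(q \x p)%E]_z W z w)%E); last first.
  by rewrite lee_wpmul2l.
rewrite -ge0_integralZl//; last exact: (mW _ _ id (cst w) (@measurable_id _ _ _) (measurable_cst _)).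
apply: ge0_le_integral => //.
- by move=> z _; rewrite mule_ge0.
- by apply: emeasurable_funM => //; exact: (mW _ _ id (cst w) (@measurable_id _ _ _) (measurable_cst _)).
- by apply: emeasurable_funM => //; exact: (mW _ _ id (cst w) (@measurable_id _ _ _) (measurable_cst _)).
move=> z _; rewrite /W /cell_weight.
case: eqP => [e1|_]; last by rewrite mul0r !mule0.
case: eqP => [e2|_]; last by rewrite mulr0 !mule0.
by rewrite lee_wpmul2r// ?lee_fin ?mulr_ge0 ?invr_ge0 ?fine_ge0// phipsi.
Qed.

End row.
End cell_matrix.

Section code_approximation.
Context {R : realType} {d : measure_display} {X : measurableType d}.
Variables (dist : X -> X -> R) (s : R) (a : X -> nat) (tau eta : R).
Hypotheses (cell : cellular dist) (s12 : 1 <= s <= 2) (tau0 : 0 < tau).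
Hypothesis Heta : forall x y, 0 <= x -> 0 <= y -> y <= x + eta ->
  y `^ s <= (1 + tau) * x `^ s + tau.
Hypothesis ma : measurable_fun setT a.
Hypothesis Ha : forall u v, a u = a v -> dist u v <= eta / 2.

Lemma cell_matrix_swap (q p : probability X R) (pi : probability (X * X)%type R) i j :
  cell_matrix a q p pi i j =
  cell_matrix a p q (image_probability pi (@measurable_swap _ _ X X)) j i.
Proof.
have E : pi ((a @^-1` [set i]) `*` (a @^-1` [set j])) =
    image_probability pi (@measurable_swap _ _ X X)
      ((a @^-1` [set j]) `*` (a @^-1` [set i])).
  rewrite image_probabilityE; congr (pi _).
  by apply/seteqP; split => [[u v] []|[u v] []].
by rewrite /cell_matrix E mulrC [X in _ / X]mulrC mulrC.
Qed.

Let s1 : 1 <= s. Proof. by case/andP: s12. Qed.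

(** Coarsening [pi] costs the factor [1 + tau] and the term [tau]. Rounding the coarsened density
    from below leaves a residual whose cost tends to 0 by the moment assumptions, and [e] absorbs
    it. *)
Lemma coupling_code_approx (q p : probability X R) pi x0 (i1 e : R) :
  couplings q p pi -> (transport_cost dist s pi <= i1%:E)%E ->
  (\int[q]_u ((dist u x0) `^ s)%:E < +oo)%E ->
  (\int[p]_v ((dist x0 v) `^ s)%:E < +oo)%E -> 0 < e ->
  exists2 c, feasible q p a (cell_code c) &
    (\int[(q \x p)%E]_z (((dist z.1 z.2) `^ s)%:E *
       (completion q p a (cell_code c) z)%:E) <= ((1 + tau) * i1 + tau + e)%:E)%E.
Proof.
move=> /couplingsP[q1 p2] I1 mq mp e0.
have [_ mdist _] := cell; have [d0 _ dC tri] : is_metric dist by case: cell.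
pose D := cell_matrix a q p pi.
have D0 i j : 0 <= D i j by exact: cell_matrix_ge0.
pose pi' := image_probability pi (@measurable_swap _ _ X X).
have p1' : has_law pi' fst p.
  apply: integral_has_law => // g g0 mg.
  rewrite integral_image_probability//; last exact: measurableT_comp.
  exact: (has_law_integral p2 g0 mg).
have q2' : has_law pi' snd q.
  apply: integral_has_law => // g g0 mg.
  rewrite integral_image_probability//; last exact: measurableT_comp.
  exact: (has_law_integral q1 g0 mg).
have DT : (fun i j => D j i) = cell_matrix a p q pi'.
  by apply/funext => i; apply/funext => j; exact: cell_matrix_swap.
have Drow u : (row_mass p a D (a u) <= 1)%E by exact: row_cell_matrix_le1.
have Drow1 : {ae q, forall u, row_mass p a D (a u) = 1%E} by exact: row_cell_matrix_ae1.
have Dcol u : (row_mass q a (fun i j => D j i) (a u) <= 1)%E.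
  by rewrite DT; exact: row_cell_matrix_le1.
have Dcol1 : {ae p, forall u, row_mass q a (fun i j => D j i) (a u) = 1%E}.
  by rewrite DT; exact: row_cell_matrix_ae1.
pose h N := cell_code (R := R) (code_approx D N).
have h0 N i j : 0 <= h N i j by exact: cell_code_ge0.
have hD N i j : h N i j <= D i j by exact: code_approx_le_id.
have hcvg i j : h N i j @[N --> \oo] --> D i j by exact: code_approx_cvg.
have mD : measurable_fun setT (fun z : X * X => (D (a z.1) (a z.2))%:E).
  by apply/measurable_EFinP; exact: measurable_cell_fun.
have mh N : measurable_fun setT (fun z : X * X => (h N (a z.1) (a z.2))%:E).
  by apply/measurable_EFinP; exact: measurable_cell_fun.
have mcell (k : nat -> R) : measurable_fun setT (fun v => (k (a v))%:E).
  apply/measurable_EFinP.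
  exact: (@measurable_fun_nat_param R _ _ _ _ a (fun j _ => k j)).
have feas N : feasible q p a (h N).
  split.
  - move=> u; apply: (le_trans _ (Drow u)); apply: ge0_le_integral => //.
    + by move=> v _; rewrite lee_fin.
    + by move=> v _; rewrite lee_fin.
  - move=> u; apply: (le_trans _ (Dcol u)); apply: ge0_le_integral => //.
    + by move=> v _; rewrite lee_fin.
    + exact: (mcell ((h N)^~ (a u))).
    + exact: (mcell (D^~ (a u))).
    + by move=> v _; rewrite lee_fin.
  - pose lam : R := 1 - N.+2%:R^-1.
    apply: (@le_lt_trans _ _ lam%:E); last by rewrite lte_fin gtrBl invr_gt0.
    have lam0 : (0 <= lam%:E)%E by rewrite lee_fin subr_ge0 invf_le1// ler1n.
    apply: (@le_trans _ _ (\int[(q \x p)%E]_z (lam%:E * (D (a z.1) (a z.2))%:E))%E).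
      apply: ge0_le_integral => //.
      + by move=> z _; rewrite lee_fin.
      + exact: measurable_funeM.
      + by move=> z _; rewrite -EFinM lee_fin code_approx_le.
    have D0' z : (0 <= (D (a z.1) (a z.2))%:E)%E by rewrite lee_fin.
    rewrite ge0_integralZl// -[leRHS]mule1 lee_wpmul2l//.
    rewrite -[leRHS](integral_probability_cst pi).
    apply: (@le_trans _ _ (\int[(q \x p)%E]_z (1 * (D (a z.1) (a z.2))%:E))%E).
      by under [leRHS]eq_integral do rewrite mul1e.
    by apply: (@integral_cell_matrix_le _ _ _ _ ma q p pi (fun=> 1%E) (fun=> 1%E)).
(* The convexity inequality at weight 1/2. Splitting the distance at [x0] bounds the residual cost
   by [phi] of the first coordinate plus [psi] of the second. *)
pose C : R := 2^-1 `^ (1 - s).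
have C0 : (0 <= C%:E)%E by rewrite lee_fin powR_ge0.
have split_C : split_pow s C C.
  have := @split_pow_convex R s 2^-1 s1.
  rewrite (_ : 1 - 2^-1 = 2^-1 :> R); last by field.
  by apply; lra.
pose phi u := (C%:E * ((dist u x0) `^ s)%:E)%E.
pose psi v := (C%:E * ((dist x0 v) `^ s)%:E)%E.
have pw0 x y : (0 <= ((dist x y) `^ s)%:E)%E by rewrite lee_fin powR_ge0.
have phi0 u : (0 <= phi u)%E by rewrite mule_ge0.
have psi0 u : (0 <= psi u)%E by rewrite mule_ge0.
have md1 : measurable_fun setT (fun u => ((dist u x0) `^ s)%:E).
  exact: (measurable_dist_pow s cell (@measurable_id _ _ _) (measurable_cst x0)).
have md2 : measurable_fun setT (fun u => ((dist x0 u) `^ s)%:E).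
  exact: (measurable_dist_pow s cell (measurable_cst x0) (@measurable_id _ _ _)).
have md : measurable_fun setT (fun z : X * X => ((dist z.1 z.2) `^ s)%:E).
  exact: measurable_dist_pow.
have mphi : measurable_fun setT phi by exact: measurable_funeM.
have mpsi : measurable_fun setT psi by exact: measurable_funeM.
have iphi : (\int[q]_u phi u < +oo)%E.
  by rewrite ge0_integralZl// lte_mul_pinfty.
have ipsi : (\int[p]_u psi u < +oo)%E.
  by rewrite ge0_integralZl// lte_mul_pinfty.
have cphi := residual_vanishes ma h0 hD hcvg Drow Drow1 phi0 mphi iphi.
have cpsi := residual_vanishes ma (h_ := fun N i j => h N j i) (fun N i j => h0 N j i)
  (fun N i j => hD N j i) (fun i j => hcvg j i) Dcol Dcol1 psi0 mpsi ipsi.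
have e2 : (0 < (e / 2)%:E)%E by rewrite lte_fin divr_gt0.
have [N _ HN] := cphi _ (open_ereal_lt' e2).
have [N' _ HN'] := cpsi _ (open_ereal_lt' e2).
pose K := maxn N N'.
have {HN}HN := HN K (leq_maxl _ _); have {HN'}HN' := HN' K (leq_maxr _ _).
exists (code_approx D K); first exact: feas.
rewrite (integral_completion ma (h0 K) (feas K))//.
rewrite EFinD; apply: leeD.
  apply: (@le_trans _ _ (\int[(q \x p)%E]_z (((dist z.1 z.2) `^ s)%:E * (D (a z.1) (a z.2))%:E))%E).
    apply: ge0_le_integral => //.
    - by move=> z _; rewrite mule_ge0// lee_fin.
    - exact: emeasurable_funM.
    - exact: emeasurable_funM.
    - by move=> z _; rewrite lee_wpmul2l// lee_fin.
  pose G (z : X * X) := ((1 + tau)%:E * ((dist z.1 z.2) `^ s)%:E + tau%:E)%E.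
  have tau1 : (0 <= (1 + tau)%:E)%E by rewrite lee_fin addr_ge0// ltW.
  have mG1 : measurable_fun setT (fun z : X * X => (1 + tau)%:E * ((dist z.1 z.2) `^ s)%:E)%E.
    exact: measurable_funeM.
  have mG : measurable_fun setT G by exact: emeasurable_funD.
  have tau0E : (0 <= tau%:E)%E by rewrite lee_fin ltW.
  have G0 z : (0 <= G z)%E by rewrite adde_ge0// mule_ge0.
  have G10 (z : X * X) : (0 <= (1 + tau)%:E * ((dist z.1 z.2) `^ s)%:E)%E.
    by rewrite mule_ge0.
  apply: (@le_trans _ _ (\int[pi]_z G z)%E).
    (* Resampling moves each endpoint by at most [eta / 2], hence changes the distance by at most
       [eta]. *)
    apply: (integral_cell_matrix_le ma q p pi) => // [[u v] [u' v']]/= /Ha uu' /Ha vv'.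
    rewrite /G/= -EFinM -EFinD lee_fin; apply: Heta => //.
    have := tri u u' v; have := tri u' v' v; rewrite (dC v' v); lra.
  rewrite ge0_integralD// integral_probability_cst ge0_integralZl//.
  by rewrite [leRHS]EFinD leeD2r// EFinM lee_wpmul2l.
apply: (@le_trans _ _ (\int[(q \x p)%E]_z ((phi z.1 + psi z.2) *
  ((1 - fine (row_mass p a (h K) (a z.1)))%:E * (1 - fine (col_mass q a (h K) (a z.2)))%:E *
   ((1 - fine (total_mass q p a (h K)))^-1)%:E)))%E).
  have [f1 f2 f3] := feas K.
  have fin1 (x : \bar R) : (0 <= x)%E -> (x <= 1)%E -> 0 <= 1 - fine x.
    move=> x0' x1; rewrite subr_ge0 -lee_fin fineK//.
    by rewrite ge0_fin_numE// (le_lt_trans x1)// ltry.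
  have r0 z : (0 <= (1 - fine (row_mass p a (h K) (a z.1)))%:E * (1 - fine (col_mass q a (h K) (a z.2)))%:E *
   ((1 - fine (total_mass q p a (h K)))^-1)%:E)%E.
    rewrite !mule_ge0// lee_fin ?invr_ge0; apply: fin1 => //.
    - by apply: integral_ge0 => v _; rewrite lee_fin.
    - by apply: integral_ge0 => v _; rewrite lee_fin.
    - by apply: integral_ge0 => v _; rewrite lee_fin.
    - exact: ltW.
  have mr : measurable_fun setT (fun z : X * X => (1 - fine (row_mass p a (h K) (a z.1)))%:E * (1 - fine (col_mass q a (h K) (a z.2)))%:E *
   ((1 - fine (total_mass q p a (h K)))^-1)%:E)%E.
    apply: emeasurable_funM => //; apply: emeasurable_funM.
      exact: (measurableT_comp (mcell (fun i => 1 - fine (row_mass p a (h K) i))) measurable_fst).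
    exact: (measurableT_comp (mcell (fun i => 1 - fine (col_mass q a (h K) i))) measurable_snd).
  apply: ge0_le_integral => //.
  - by move=> z _; rewrite mule_ge0.
  - exact: emeasurable_funM.
  - apply: emeasurable_funM => //; apply: emeasurable_funD.
      exact: (measurableT_comp mphi measurable_fst).
    exact: (measurableT_comp mpsi measurable_snd).
  - move=> z _; apply: lee_wpmul2r => //.
    rewrite /phi /psi -!EFinM -EFinD lee_fin.
    apply: (le_trans _ (split_C _ _ (d0 _ _) (d0 _ _))).
    by apply: ge0_ler_powR; rewrite ?nnegrE ?addr_ge0// (le_trans ler01).
rewrite (integral_residual ma (h0 K) (feas K) phi0 mphi psi0 mpsi).
rewrite [leRHS](_ : _ = (e / 2)%:E + (e / 2)%:E)%E; last first.
  by rewrite -EFinD; congr (_%:E); field.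
by apply: leeD; exact: ltW.
Qed.

End code_approximation.

(** * Measurable selection of nearly optimal couplings *)

Section parametrized_integrals.
Context {R : realType} {dS d : measure_display} {S : measurableType dS}
  {X : measurableType d}.
Variables (q p : S -> probability X R).
Hypotheses (hq : is_kernel q) (hp : is_kernel p).

Lemma measurable_product_integral (phi : S * (X * X) -> \bar R) :
  (forall t, (0 <= phi t)%E) -> measurable_fun setT phi ->
  measurable_fun setT (fun s => \int[(q s \x p s)%E]_z phi (s, z))%E.
Proof.
move=> phi0 mphi.
have mphis s : measurable_fun setT (fun z => phi (s, z)).
  by apply: (measurableT_comp mphi); exact: measurable_pair1.
under eq_fun do rewrite fubini_tonelli1// /fubini_F/=.
have hp1 : is_kernel (fun t : S * X => p t.1).
  by move=> U mU; exact: (measurableT_comp (hp mU) measurable_fst).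
apply: (@measurable_kernel_integral _ _ _ _ _ q hq
  (fun t => \int[p t.1]_y phi (t.1, (t.2, y)))%E).
  by move=> t; exact: integral_ge0.
apply: (@measurable_kernel_integral _ _ _ _ _ (fun t : S * X => p t.1) hp1
  (fun t => phi (t.1.1, (t.1.2, t.2)))) => //.
apply: (measurableT_comp mphi); apply: measurable_fun_pair => /=.
  exact: (measurableT_comp measurable_fst measurable_fst).
apply: measurable_fun_pair => //.
exact: (measurableT_comp measurable_snd measurable_fst).
Qed.

End parametrized_integrals.

Section first_index.
Context {R : realType} {dS d : measure_display} {S : measurableType dS}
  {Z : measurableType d}.

(** Taking the first index [i] with [V i s] keeps the choice measurable, since each level set is
    [V i] minus the earlier ones. *)
Lemma kernel_selection (k : nat -> S -> probability Z R) (V : nat -> set S) :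
  (forall m, is_kernel (k m)) -> (forall m, measurable (V m)) ->
  exists m : S -> nat, is_kernel (fun s => k (m s) s) /\
    forall s, (exists i, V i s) -> V (m s) s.
Proof.
move=> hk mV.
pose W s := exists i, (fun i => `[< V i s >]) i.
have WV s : (exists i, V i s) -> W s by move=> [i Vi]; exists i; apply/asboolP.
pose m s := if pselect (W s) is left e then ex_minn e else 0%N.
have Vm s : (exists i, V i s) -> V (m s) s.
  move=> /WV e; rewrite /m; case: pselect => // e'.
  by case: ex_minnP => i /asboolP.
exists m; split => //.
have mm : measurable_fun setT m.
  have mi i : measurable [set s | m s = i].
    (* The index 0 is also the default at the parameters lying in no [V j], which adds a piece to
       its level set. *)
    rewrite (_ : [set s | _] =
      (V i `\` \bigcup_(j in [set j | (j < i)%N]) V j) `|`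
      (if i is 0%N then ~` \bigcup_j V j else set0)).
      apply: measurableU.
        by apply: measurableD => //; apply: bigcup_measurable.
      by case: i => //; apply: measurableC; exact: bigcupT_measurable.
    apply/seteqP; split => s /=.
      rewrite /m; case: pselect => [e|ne].
        case: ex_minnP => j /asboolP Vj jmin <-; left; split => //.
        move=> [l /= lj Vl]; have := jmin l; rewrite leqNgt lj.
        by move=> /(_ (asboolT Vl)).
      move=> <-; right => -[j _ Vj]; apply: ne; apply: WV.
      by exists j.
    move=> [[Vi nV]|].
      rewrite /m; case: pselect => [e|]; last by case; apply: WV; exists i.
      case: ex_minnP => j /asboolP Vj jmin.
      apply/eqP; rewrite eqn_leq jmin ?asboolT//= leqNgt; apply/negP => ji.
      by apply: nV; exists j.
    case: i => // nV; rewrite /m; case: pselect => // e.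
    by case: ex_minnP => j /asboolP Vj _; case: nV; exists j.
  move=> _ U _; rewrite setTI (_ : m @^-1` U = \bigcup_(i in U) [set s | m s = i]).
    by apply: bigcup_measurable.
  by apply/seteqP; split => [u/= Uu|u [i Ui/= ->]] //; exists (m u).
move=> U mU; apply: (@measurable_fun_nat_param R _ _ _ _ m (fun i s => k i s U)) => // i.
exact: hk.
Qed.

End first_index.

Section coupling_selection.
Context {R : realType} {dS d : measure_display} {S : measurableType dS}
  {X : measurableType d}.
Variables (q p : S -> probability X R).
Hypotheses (hq : is_kernel q) (hp : is_kernel p).
Variables (a : X -> nat) (ma : measurable_fun setT a).

Section completed.
Variables (h : nat -> nat -> R) (h0 : forall i j, 0 <= h i j).

Let feas s := feasible (q s) (p s) a h.

Let mrow i : measurable_fun setT (fun s => row_mass (p s) a h i).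
Proof.
apply: (@measurable_kernel_integral _ _ _ _ _ p hp (fun t => (h i (a t.2))%:E)).
  by move=> t; rewrite lee_fin.
apply/measurable_EFinP.
have mat : measurable_fun setT (fun t : S * X => a t.2) by exact: measurableT_comp.
exact: (@measurable_fun_nat_param R _ _ _ _ _ (fun j _ => h i j) mat).
Qed.

Let mcol i : measurable_fun setT (fun s => col_mass (q s) a h i).
Proof.
apply: (@measurable_kernel_integral _ _ _ _ _ q hq (fun t => (h (a t.2) i)%:E)).
  by move=> t; rewrite lee_fin.
apply/measurable_EFinP.
have mat : measurable_fun setT (fun t : S * X => a t.2) by exact: measurableT_comp.
exact: (@measurable_fun_nat_param R _ _ _ _ _ (fun j _ => h j i) mat).
Qed.

Let mtot : measurable_fun setT (fun s => total_mass (q s) (p s) a h).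
Proof.
apply: (measurable_product_integral hq hp
  (phi := fun t => (h (a t.2.1) (a t.2.2))%:E)).
  by move=> t; rewrite lee_fin.
apply/measurable_EFinP; apply: (@measurable_cell_fun _ _ _ a h ma _ _ (fun t : S * (X * X) => t.2.1) (fun t => t.2.2)) => //.
  exact: (measurableT_comp measurable_fst measurable_snd).
exact: (measurableT_comp measurable_snd measurable_snd).
Qed.

Let mfeas : measurable [set s | feas s].
Proof.
have mle (f : nat -> S -> \bar R) : (forall i, measurable_fun setT (f i)) ->
    measurable [set s | forall u, (f (a u) s <= 1)%E].
  move=> mf.
  (* A condition on all points [u] becomes one on the countably many attained labels, hence a
     countable intersection. *)
  rewrite (_ : [set s | _] = \bigcap_i [set s | (exists u, a u = i) -> (f i s <= 1)%E]).
    apply: bigcapT_measurable => i; have [e|ne] := pselect (exists u, a u = i).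
      have := emeasurable_fun_infty_c measurableT (mf i) 1%E.
      rewrite setTI (_ : [set x | _] = [set s | (exists u, a u = i) -> (f i s <= 1)%E])//.
      by apply/seteqP; split => s //= /(_ e).
    by rewrite (_ : [set s | _] = setT)//; apply/seteqP; split => // s _ /= /ne.
  apply/seteqP; split => s /= H; first by move=> i _ [u <-].
  by move=> u; apply: (H (a u) I); exists u.
rewrite (_ : [set s | _] = [set s | forall u, (row_mass (p s) a h (a u) <= 1)%E] `&`
  [set s | forall u, (col_mass (q s) a h (a u) <= 1)%E] `&`
  [set s | (total_mass (q s) (p s) a h < 1)%E]).
  apply: measurableI; first apply: measurableI.
  - exact: (mle (fun i s => row_mass (p s) a h i)).
  - exact: (mle (fun i s => col_mass (q s) a h i)).
  - by have := emeasurable_fun_infty_o measurableT mtot 1%E; rewrite setTI.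
by apply/seteqP; split => [s [r1 r2 r3]|s [[r1 r2] r3]]; split.
Qed.

(** At the parameters where [h] is infeasible the density 1 gives the product coupling, so the
    kernel consists of couplings everywhere. *)
Definition completed_density s (z : X * X) : R :=
  if `[< feasible (q s) (p s) a h >] then completion (q s) (p s) a h z else 1.

Lemma completed_densityP s : is_density (q s \x p s)%E (completed_density s).
Proof.
rewrite /completed_density; case: asboolP => [f|_].
  exact: (completion_density ma h0 f).
split => //; exact: (@integral_probability_cst _ _ _ (q s \x p s)%E 1%E).
Qed.

Lemma measurable_completed_density : measurable_fun setT
  (fun t : S * (X * X) => completed_density t.1 t.2).
Proof.
apply: measurable_fun_ifT => //.
  apply: (measurable_fun_bool true); rewrite setTI.
  rewrite (_ : _ @^-1` _ = fst @^-1` [set s | feas s]).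
    by rewrite -[X in measurable X]setTI; exact: measurable_fst.
  by apply/seteqP; split => t /= /asboolP.
have ma1 : measurable_fun setT (fun t : S * (X * X) => a t.2.1).
  exact: (measurableT_comp ma (measurableT_comp measurable_fst measurable_snd)).
have ma2 : measurable_fun setT (fun t : S * (X * X) => a t.2.2).
  exact: (measurableT_comp ma (measurableT_comp measurable_snd measurable_snd)).
have mfine (f : S -> \bar R) : measurable_fun setT f ->
    measurable_fun setT (fun t : S * (X * X) => 1 - fine (f t.1)).
  move=> mf; apply: measurable_funB => //.
  exact: (measurableT_comp (measurableT_comp (fine_measurable measurableT) mf) measurable_fst).
apply: measurable_funD.
  apply: (@measurable_cell_fun _ _ _ a h ma _ _ (fun t : S * (X * X) => t.2.1) (fun t => t.2.2)) => //.
    exact: (measurableT_comp measurable_fst measurable_snd).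
  exact: (measurableT_comp measurable_snd measurable_snd).
apply: measurable_funM; first apply: measurable_funM.
- apply: (@measurable_fun_nat_param R _ _ _ _ _
    (fun i (t : S * (X * X)) => 1 - fine (row_mass (p t.1) a h i)) ma1) => i.
  exact: (mfine (fun s => row_mass (p s) a h i)).
- apply: (@measurable_fun_nat_param R _ _ _ _ _
    (fun i (t : S * (X * X)) => 1 - fine (col_mass (q t.1) a h i)) ma2) => i.
  exact: (mfine (fun s => col_mass (q s) a h i)).
- apply: (measurableT_comp (@measurable_invr R)) => //.
  exact: (mfine (fun s => total_mass (q s) (p s) a h)).
Qed.

Definition completed_coupling s : probability (X * X)%type R :=
  density (completed_densityP s).

Lemma completed_couplingE s phi : (forall z, (0 <= phi z)%E) -> measurable_fun setT phi ->
  (\int[completed_coupling s]_z phi z =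
   \int[(q s \x p s)%E]_z (phi z * (completed_density s z)%:E))%E.
Proof. by move=> phi0 mphi; exact: integral_density. Qed.

Lemma completed_coupling_kernel_integral (phi : X * X -> \bar R) :
  (forall z, (0 <= phi z)%E) -> measurable_fun setT phi ->
  measurable_fun setT (fun s => \int[completed_coupling s]_z phi z)%E.
Proof.
move=> phi0 mphi; under eq_fun do rewrite completed_couplingE//.
apply: (measurable_product_integral hq hp
  (phi := fun t => (phi t.2 * (completed_density t.1 t.2)%:E)%E)).
  move=> t; rewrite mule_ge0// lee_fin.
  by have [-> //] := completed_densityP t.1.
apply: emeasurable_funM; first exact: (measurableT_comp mphi measurable_snd).
by apply/measurable_EFinP; exact: measurable_completed_density.
Qed.

Lemma completed_coupling_kernel : is_kernel completed_coupling.
Proof.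
move=> U mU.
rewrite (_ : (fun s => _) = (fun s => \int[completed_coupling s]_z (\1_U z)%:E))%E.
  apply: completed_coupling_kernel_integral; first by move=> z; rewrite lee_fin.
  by apply/measurable_EFinP; exact: measurable_indic.
by apply/funext => s; rewrite integral_indic// setIT.
Qed.

Lemma completed_coupling_couplings s : couplings (q s) (p s) (completed_coupling s).
Proof.
apply/couplingsP; split; apply: integral_has_law => // g g0 mg.
  rewrite completed_couplingE//; last exact: measurableT_comp.
  rewrite /completed_density; case: asboolP => [f|_].
    exact: completion_marginal1.
  under eq_integral do rewrite mule1.
  rewrite fubini_tonelli1//; last exact: measurableT_comp.
  by rewrite /fubini_F/=; under eq_integral do rewrite integral_probability_cst.
rewrite completed_couplingE//; last exact: measurableT_comp.
rewrite /completed_density; case: asboolP => [f|_].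
  exact: completion_marginal2.
under eq_integral do rewrite mule1.
rewrite fubini_tonelli2//; last exact: measurableT_comp.
by rewrite /fubini_G/=; under eq_integral do rewrite integral_probability_cst.
Qed.

End completed.

Variables (dist : X -> X -> R) (s : R) (tau eta : R).
Hypotheses (cell : cellular dist) (s12 : 1 <= s <= 2) (tau0 : 0 < tau).
Hypothesis Heta : forall x y, 0 <= x -> 0 <= y -> y <= x + eta ->
  y `^ s <= (1 + tau) * x `^ s + tau.
Hypothesis Ha : forall u v, a u = a v -> dist u v <= eta / 2.

(** With the bound [c] given as a measurable function, adequacy of a code is a measurable condition
    on the parameter. Nothing is promised where [c] is infinite. One additive [tau] pays for the
    cells, the other for the residual. *)
Lemma coupling_selection_cells (c : S -> \bar R) : measurable_fun setT c ->
  exists k : S -> probability (X * X)%type R,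
  [/\ is_kernel k, forall t, couplings (q t) (p t) (k t) &
    forall t i pi, c t = i%:E -> couplings (q t) (p t) pi ->
      (transport_cost dist s pi <= i%:E)%E ->
      finite_moment dist s (q t) -> finite_moment dist s (p t) ->
      (transport_cost dist s (k t) <= ((1 + tau) * i + tau + tau)%:E)%E].
Proof.
move=> mc.
(* An integer that encodes no table is read as the empty table. *)
pose code m := odflt (0%N, [::]) (unpickle m) : nat * seq (seq nat).
pose hm m := cell_code (R := R) (code m).
have hm0 m i j : 0 <= hm m i j by exact: cell_code_ge0.
pose km m := completed_coupling (hm0 m).
pose V m := [set t | (transport_cost dist s (km m t) <=
  (1 + tau)%:E * c t + (tau + tau)%:E)%E].
have mpw : measurable_fun setT (fun z : X * X => ((dist z.1 z.2) `^ s)%:E).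
  exact: measurable_dist_pow.
have pw0 (z : X * X) : (0 <= ((dist z.1 z.2) `^ s)%:E)%E by rewrite lee_fin powR_ge0.
have mV m : measurable (V m).
  rewrite -[V m]setTI; apply: measurable_lee => //.
    exact: completed_coupling_kernel_integral.
  by apply: emeasurable_funD => //; exact: measurable_funeM.
have [m [hk HV]] := kernel_selection (fun m => completed_coupling_kernel (hm0 m)) mV.
exists (fun t => km (m t) t); split => //.
  by move=> t; exact: completed_coupling_couplings.
move=> t i pi ct cpi Ipi [y mq] [y' mp].
have [_ _ dC tri] : is_metric dist by case: cell.
(* [coupling_code_approx] measures both moments from one base point, whereas the two moment
   hypotheses may come with different ones. *)
have rebase (P : probability X R) (x x' : X) :
    (\int[P]_y ((dist x y) `^ s)%:E < +oo)%E -> (\int[P]_y ((dist x' y) `^ s)%:E < +oo)%E.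
  move=> HP.
  have /andP[s1 _] := s12.
  have [K K0 HK] := split_pow_near s12 (@ltr01 R).
  have m1 o : measurable_fun setT (fun y => ((dist o y) `^ s)%:E).
    exact: (measurable_dist_pow s cell (measurable_cst o) (@measurable_id _ _ _)).
  have p0 o z : (0 <= ((dist o z) `^ s)%:E)%E by rewrite lee_fin powR_ge0.
  have d0 o z : 0 <= dist o z by case: cell => -[].
  apply: (@le_lt_trans _ _ (\int[P]_y ((1 + 1)%:E * ((dist x y) `^ s)%:E + (K * (dist x' x) `^ s)%:E))%E).
    apply: ge0_le_integral => //.
    - by apply: emeasurable_funD => //; exact: measurable_funeM.
    - move=> z _; rewrite -EFinM -EFinD lee_fin.
      apply: (le_trans _ (HK _ _ (d0 _ _) (d0 _ _))).
      apply: ge0_ler_powR; rewrite ?nnegrE ?addr_ge0//.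
        by rewrite (le_trans ler01).
      by rewrite addrC tri.
  have F0 z : (0 <= (1 + 1)%:E * ((dist x z) `^ s)%:E)%E by rewrite mule_ge0.
  have mF : measurable_fun setT (fun z => (1 + 1)%:E * ((dist x z) `^ s)%:E)%E.
    exact: measurable_funeM.
  have G0 : (0 <= (K * (dist x' x) `^ s)%:E)%E by rewrite lee_fin mulr_ge0// powR_ge0.
  rewrite ge0_integralD//.
  rewrite integral_probability_cst ge0_integralZl//.
  by apply: lte_add_pinfty; [rewrite lte_mul_pinfty|exact: ltry].
have mq' : (\int[q t]_u ((dist u y') `^ s)%:E < +oo)%E.
  by under eq_integral do rewrite dC; exact: (rebase _ y).
have [w fw Hw] := coupling_code_approx cell s12 tau0 Heta ma Ha cpi Ipi mq' mp tau0.
have -> : ((1 + tau) * i + tau + tau)%:E = ((1 + tau)%:E * c t + (tau + tau)%:E)%E.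
  by rewrite ct -EFinM -EFinD addrA.
apply: HV; exists (pickle w).
rewrite /V/= /transport_cost completed_couplingE//.
rewrite /completed_density /hm /code pickleK/=.
case: asboolP => // _.
by rewrite ct -EFinM -EFinD addrA.
Qed.

End coupling_selection.

(* Countably many codes yield kernels of couplings that are almost optimal at
   some code for every parameter, so choosing the first adequate code is
   measurable and no general measurable selection theorem is needed. *)
Lemma coupling_selection {R : realType} {dS d : measure_display}
  {S : measurableType dS} {X : measurableType d} (q p : S -> probability X R)
  (dist : X -> X -> R) (s tau : R) (c : S -> \bar R) :
  is_kernel q -> is_kernel p -> cellular dist -> 1 <= s <= 2 -> 0 < tau ->
  measurable_fun setT c ->
  exists k : S -> probability (X * X)%type R,
  [/\ is_kernel k, forall t, couplings (q t) (p t) (k t) &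
    forall t i pi, c t = i%:E -> couplings (q t) (p t) pi ->
      (transport_cost dist s pi <= i%:E)%E ->
      finite_moment dist s (q t) -> finite_moment dist s (p t) ->
      (transport_cost dist s (k t) <= ((1 + tau) * i + tau + tau)%:E)%E].
Proof.
move=> hq hp cell s12 tau0 mc.
have [eta eta0 Heta] := powR_perturb s12 tau0.
have eta2 : 0 < eta / 2 by rewrite divr_gt0.
have [_ _ mcell] := cell; have [a [ma Ha]] := mcell _ eta2.
exact: (coupling_selection_cells hq hp ma cell s12 tau0 Heta Ha mc).
Qed.

(** * Entropy through densities, and its chain rule *)

Section entropy_function.
Context {R : realType}.

(* Against a probability density this has the same integral as [x * ln x], but
   it is nonnegative, so that Tonelli applies without integrability conditions. *)
Definition ent_fun (x : R) : R := x * ln x - x + 1.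

Lemma ent_fun_ge0 x : 0 <= x -> 0 <= ent_fun x.
Proof.
rewrite le_eqVlt => /orP[/eqP <-|x0].
  by rewrite /ent_fun mul0r subr0 add0r.
have xi0 : 0 < x^-1 by rewrite invr_gt0.
have : ln (1 + (x^-1 - 1)) <= x^-1 - 1 by apply: le_ln1Dx; rewrite ltrBrDl subrr.
rewrite addrC subrK lnV ?posrE// => h.
have : x * (- ln x) <= x * (x^-1 - 1) by rewrite ler_wpM2l// ltW.
rewrite mulrBr mulfV ?gt_eqF// /ent_fun; lra.
Qed.

Lemma measurable_ent_fun : measurable_fun setT ent_fun.
Proof.
apply: measurable_funD => //; apply: measurable_funB => //.
by apply: measurable_funM => //; exact: measurable_ln.
Qed.

(** The chain rule at the level of densities. Terms are placed so that both sides are sums of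
    nonnegative quantities, which can be integrated term by term even when the entropy is
    infinite. *)
Lemma ent_funM x y : 0 < x -> 0 <= y ->
  ent_fun (x * y) + y + x = x * ent_fun y + y * ent_fun x + x * y + 1.
Proof.
move=> x0; rewrite le_eqVlt => /orP[/eqP <-|y0].
  by rewrite /ent_fun !mulr0 !mul0r; ring.
by rewrite /ent_fun lnM ?posrE//; ring.
Qed.

End entropy_function.

Section entropy_density.
Context {R : realType} {d : measure_display} {Y : measurableType d}.
Variables (nu mu : probability Y R) (f : Y -> R).
Hypothesis hf : is_density mu f.
Hypothesis nuE : forall A, measurable A -> nu A = density hf A.

Lemma integral_wrt_density g : (forall y, (0 <= g y)%E) -> measurable_fun setT g ->
  (\int[nu]_y g y = \int[mu]_y (g y * (f y)%:E))%E.
Proof.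
move=> g0 mg; rewrite -(integral_density hf)//.
by apply: eq_measure_integral => A mA _; exact: nuE.
Qed.

(** The integral defining [Ent] is a difference [P - N] of integrals of positive and negative parts.
    As [x * ln x >= x - 1], the negative part satisfies [N <= 1], so it can be cancelled even if [P]
    is infinite. *)
Lemma Ent_density : Ent nu mu = (\int[mu]_y (ent_fun (f y))%:E)%E.
Proof.
have [f0 mf f1] := hf.
have dom : charge_of_finite_measure nu `<< mu.
  apply/null_content_dominatesP => A mA muA.
  have -> : charge_of_finite_measure nu A = density hf A by exact: nuE.
  rewrite /density; apply: null_set_integral => //.
  by apply/measurable_EFinP; exact: measurable_funTS.
rewrite /Ent; case: pselect => // {}dom.
set r := Radon_Nikodym _ _.
have ir : mu.-integrable setT r by exact: Radon_Nikodym_integrable.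
have mfE : measurable_fun setT (fun y => (f y)%:E) by exact/measurable_EFinP.
have ifE : mu.-integrable setT (fun y => (f y)%:E).
  apply/integrableP; split => //.
  by under eq_integral do rewrite gee0_abs ?lee_fin//; rewrite f1 ltry.
have rf : ae_eq mu setT r (fun y => (f y)%:E).
  apply: integral_ae_eq => // E _ mE.
  by rewrite -Radon_Nikodym_integral//; exact: nuE.
have dom' : nu `<< mu by exact: dom.
have rf' : ae_eq nu setT r (fun y => (f y)%:E) by exact: null_dominates_ae_eq rf.
have mr : measurable_fun setT r by exact: measurable_int ir.
pose l y := ((ln (f y))%:E : \bar R).
have ml : measurable_fun setT l.
  by apply/measurable_EFinP; apply: measurableT_comp => //; exact: measurable_ln.
transitivity (\int[nu]_y l y)%E.
  apply: ae_eq_integral => //.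
    apply/measurable_EFinP; apply: (measurableT_comp (@measurable_ln R)).
    exact: (measurableT_comp (fine_measurable measurableT)).
  by apply: filterS rf' => y /= /(_ I) ry _; rewrite ry.
have mlp : measurable_fun setT (l^\+)%E by exact: measurable_funepos.
have mln : measurable_fun setT (l^\-)%E by exact: measurable_funeneg.
rewrite integralE (integral_wrt_density _ mlp)// (integral_wrt_density _ mln)//.
set P := (X in (X - _)%E); set N := (X in (_ - X)%E).
set Phi := (RHS).
have N0 y : (0 <= l^\- y * (f y)%:E)%E by rewrite mule_ge0// lee_fin.
have P0 y : (0 <= l^\+ y * (f y)%:E)%E by rewrite mule_ge0// lee_fin.
have E0 y : (0 <= (ent_fun (f y))%:E)%E by rewrite lee_fin ent_fun_ge0.
have mE : measurable_fun setT (fun y => (ent_fun (f y))%:E).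
  by apply/measurable_EFinP; exact: (measurableT_comp measurable_ent_fun).
have mN : measurable_fun setT (fun y => l^\- y * (f y)%:E)%E by exact: emeasurable_funM.
have mP : measurable_fun setT (fun y => l^\+ y * (f y)%:E)%E by exact: emeasurable_funM.
have lpE y : (l^\+ y * (f y)%:E)%E = (Num.max (ln (f y)) 0 * f y)%:E.
  by rewrite funeposE /l -EFin_max.
have lnE y : (l^\- y * (f y)%:E)%E = (Num.max (- ln (f y)) 0 * f y)%:E.
  by rewrite funenegE /l -EFinN -EFin_max.
have N1 : (N <= 1)%E.
  rewrite -(integral_probability_cst mu 1%E); apply: ge0_le_integral => //.
  move=> y _; rewrite lnE lee_fin.
  have := ent_fun_ge0 (f0 y); rewrite /ent_fun => hy; have fy := f0 y.
  by case: (leP (- ln (f y)) 0) => _; nra.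
have Nfin : N \is a fin_num.
  rewrite ge0_fin_numE ?integral_ge0//.
  by rewrite (le_lt_trans N1)// ltry.
(* Pointwise, [ent_fun f] plus the negative part of [f * ln f] plus [f] equals the positive part
   plus 1; both [f] and the constant 1 have integral 1. *)
have key : (Phi + N + 1 = P + 1)%E.
  have c1 : (\int[mu]_y (1 : \bar R) = 1)%E by exact: integral_probability_cst.
  rewrite -[in LHS]f1 -[in RHS]c1.
  have EN0 y : (0 <= (ent_fun (f y))%:E + l^\- y * (f y)%:E)%E by rewrite adde_ge0.
  have mEN : measurable_fun setT (fun y => (ent_fun (f y))%:E + l^\- y * (f y)%:E)%E.
    exact: emeasurable_funD.
  have fe0 y : (0 <= (f y)%:E)%E by rewrite lee_fin.
  rewrite /Phi /N /P -!ge0_integralD//.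
  apply: eq_integral => y _; rewrite lpE lnE -!EFinD; congr (_%:E).
  rewrite /ent_fun.
  have /orP[v0|v0] := le_total 0 (ln (f y)).
    have -> : Num.max (- ln (f y)) 0 = 0 by apply/max_idPr; rewrite oppr_le0.
    have -> : Num.max (ln (f y)) 0 = ln (f y) by exact/max_idPl.
    by ring.
  have -> : Num.max (- ln (f y)) 0 = - ln (f y) by apply/max_idPl; rewrite oppr_ge0.
  have -> : Num.max (ln (f y)) 0 = 0 by exact/max_idPr.
  by ring.
have {}key : (Phi + N = P)%E.
  by rewrite -[LHS](addeK _ (x := 1%E))// key addeK.
by rewrite -key addeK.
Qed.

End entropy_density.

Section kernel_density.
Context {R : realType} {dT d : measure_display} {T : measurableType dT}
  {X : measurableType d}.
Variables (p : T -> probability X R) (f : T * X -> R).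
Hypotheses (hp : is_kernel p) (mf : measurable_fun setT f).
Hypothesis hf : forall t, is_density (p t) (fun u => f (t, u)).

Lemma kernel_density : is_kernel (fun t => density (hf t)).
Proof.
move=> U mU.
rewrite (_ : (fun t => _) = (fun t => \int[p t]_u ((\1_U u)%:E * (f (t, u))%:E)))%E.
  apply: (measurable_kernel_integral hp
    (phi := fun t => ((\1_U t.2)%:E * (f t)%:E)%E)) => [t|].
    by rewrite mule_ge0// lee_fin; have [f0 _ _] := hf t.1; case: t f0.
  apply: emeasurable_funM; last exact/measurable_EFinP.
  apply/measurable_EFinP.
  by apply: (measurableT_comp (measurable_indic mU)).
apply/funext => t; rewrite -integral_density//; last first.
  by apply/measurable_EFinP; exact: measurable_indic.
by rewrite integral_indic// setIT.
Qed.

End kernel_density.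

Section entropy_disintegration.
Context {R : realType} {dT d d2 : measure_display} {T : measurableType dT}
  {X : measurableType d} {T2 : measurableType d2}.
Variables (j : T * X -> T2) (pr : T2 -> T).
Hypotheses (mj : measurable_fun setT j) (mpr : measurable_fun setT pr).
Hypothesis prj : forall t u, pr (j (t, u)) = t.
Variables (mu1 : probability T R) (p : T -> probability X R)
  (mu2 nu2 : probability T2 R) (F2 : T2 -> R).
Hypothesis hp : is_kernel p.
Hypothesis mu2E : forall g : T2 -> \bar R, (forall y, (0 <= g y)%E) ->
  measurable_fun setT g -> (\int[mu2]_y g y = \int[mu1]_t \int[p t]_u g (j (t, u)))%E.
Hypotheses (F20 : forall y, 0 <= F2 y) (mF2 : measurable_fun setT F2).
Hypothesis nu2E : forall g : T2 -> \bar R, (forall y, (0 <= g y)%E) ->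
  measurable_fun setT g -> (\int[nu2]_y g y = \int[mu2]_y (g y * (F2 y)%:E))%E.

Let nu1 := image_probability nu2 mpr.
Let F1 t := (\int[p t]_u (F2 (j (t, u)))%:E)%E.
Let f1 t := fine (F1 t).
Let good t := (0 < F1 t < +oo)%E.
(** The conditional density of the last coordinate. Off [good] it is 1, so the conditional law is
    the reference kernel [p t] there; [nu1] does not charge these [t]. *)
Let f (tu : T * X) := if good tu.1 then F2 (j tu) / f1 tu.1 else 1.

Let mF2j : measurable_fun setT (fun tu => (F2 (j tu))%:E).
Proof. by apply/measurable_EFinP; exact: measurableT_comp. Qed.

Let F2e0 y : (0 <= (F2 y)%:E)%E. Proof. by rewrite lee_fin. Qed.

Let mF1 : measurable_fun setT F1.
Proof. exact: (measurable_kernel_integral hp (phi := fun tu => (F2 (j tu))%:E)). Qed.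

Let mf1 : measurable_fun setT f1.
Proof. exact: (measurableT_comp (fine_measurable measurableT)). Qed.

Let F10 t : (0 <= F1 t)%E. Proof. exact: integral_ge0. Qed.

Let f10 t : 0 <= f1 t. Proof. exact: fine_ge0. Qed.

Let mjt t : measurable_fun setT (fun u => j (t, u)).
Proof. by apply: (measurableT_comp mj); exact: measurable_pair1. Qed.

Let mf : measurable_fun setT f.
Proof.
apply: measurable_fun_ifT => //; last first.
  apply: measurable_funM; first exact: measurableT_comp.
  apply: (measurableT_comp (@measurable_invr R)).
  exact: (measurableT_comp mf1 measurable_fst).
apply: (measurable_fun_bool true); rewrite setTI.
rewrite (_ : _ @^-1` _ = fst @^-1` (F1 @^-1` `]0%E, +oo%E[)).
  rewrite -[X in measurable X]setTI; apply: measurable_fst => //.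
  by rewrite -[X in measurable X]setTI; apply: mF1 => //; exact: emeasurable_itv.
by apply/seteqP; split => tu /=; rewrite in_itv/=.
Qed.

Let f0 tu : 0 <= f tu.
Proof. by rewrite /f; case: ifP => // _; rewrite divr_ge0. Qed.

Let f1E t : good t -> (f1 t)%:E = F1 t.
Proof. by move=> /andP[F1t F1y]; rewrite fineK// ge0_fin_numE. Qed.

Let f1_gt0 t : good t -> 0 < f1 t.
Proof. by move=> g; rewrite -lte_fin f1E//; case/andP: g. Qed.

Let mft t : measurable_fun setT (fun u => f (t, u)).
Proof. by apply: (measurableT_comp mf); exact: measurable_pair1. Qed.

Let F2f t u : good t -> F2 (j (t, u)) = f1 t * f (t, u).
Proof.
move=> gt; rewrite /f/= gt mulrCA mulfV ?mulr1// gt_eqF//.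
exact: f1_gt0.
Qed.

Let hf t : is_density (p t) (fun u => f (t, u)).
Proof.
split => //; have [gt|ngt] := boolP (good t); last first.
  rewrite /f/= (negbTE ngt); exact: integral_probability_cst.
have fi0 : (0 <= (f1 t)^-1%:E :> \bar R)%E by rewrite lee_fin invr_ge0.
transitivity ((f1 t)^-1%:E * F1 t)%E; last first.
  by rewrite -f1E// -EFinM mulVf// gt_eqF// f1_gt0.
rewrite /F1 -ge0_integralZl//; last exact: (measurableT_comp mF2j (measurable_pair1 t)).
by apply: eq_integral => u _; rewrite /f/= gt -EFinM mulrC.
Qed.

Let intF1 (g : T -> \bar R) : (forall t, (0 <= g t)%E) -> measurable_fun setT g ->
  (\int[nu1]_t g t = \int[mu1]_t (g t * F1 t))%E.
Proof.
move=> g0 mg; rewrite integral_image_probability// nu2E//; last first.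
  exact: measurableT_comp.
rewrite mu2E//; last 2 first.
- by move=> y; rewrite mule_ge0.
- by apply: emeasurable_funM; [exact: measurableT_comp|exact/measurable_EFinP].
apply: eq_integral => t _.
under eq_integral do rewrite prj.
by rewrite ge0_integralZl//; exact: (measurableT_comp mF2j (measurable_pair1 t)).
Qed.

Let F1_fin : {ae mu1, forall t, (F1 t < +oo)%E}.
Proof.
have i1 : (\int[mu1]_t F1 t = 1)%E.
  rewrite -(integral_probability_cst nu1 1%E) intF1//.
  by under [in RHS]eq_integral do rewrite mul1e.
have : mu1.-integrable setT F1.
  apply/integrableP; split => //.
  by under eq_integral do rewrite gee0_abs//; rewrite i1 ltry.
move=> /(integrable_ae measurableT); apply: filterS => t /(_ I).
by rewrite ge0_fin_numE.
Qed.

Let F2_ae0 t : F1 t = 0%E -> {ae p t, forall u, F2 (j (t, u)) = 0}.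
Proof.
move=> Ft0.
have mt : measurable_fun setT (fun u => (F2 (j (t, u)))%:E).
  exact: (measurableT_comp mF2j (measurable_pair1 t)).
have /(ae_eq_integral_abs _ measurableT mt) : (\int[p t]_u `|(F2 (j (t, u)))%:E| = 0)%E.
  by under eq_integral do rewrite gee0_abs//.
by apply: filterS => u /(_ I) [].
Qed.

Let split_int (g : T2 -> \bar R) t : (forall y, (0 <= g y)%E) ->
  measurable_fun setT g -> (F1 t < +oo)%E ->
  (\int[p t]_u (g (j (t, u)) * (F2 (j (t, u)))%:E) =
   (f1 t)%:E * \int[p t]_u (g (j (t, u)) * (f (t, u))%:E))%E.
Proof.
move=> g0 mg Fty.
have mgt : measurable_fun setT (fun u => g (j (t, u))) by exact: measurableT_comp.
have mF2t : measurable_fun setT (fun u => (F2 (j (t, u)))%:E).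
  exact: (measurableT_comp mF2j (measurable_pair1 t)).
have [gt|ngt] := boolP (good t).
  rewrite -ge0_integralZl//; last 3 first.
  - by apply: emeasurable_funM => //; exact/measurable_EFinP.
  - by move=> u _; rewrite mule_ge0// lee_fin.
  - by rewrite lee_fin.
  by apply: eq_integral => u _; rewrite F2f// EFinM muleCA.
have Ft0 : F1 t = 0%E.
  apply/eqP; rewrite eq_le F10 andbT leNgt; apply: contra ngt => h.
  by rewrite /good h.
rewrite /f1 Ft0/= mul0e -[RHS](integral0 (p t) setT).
apply: ge0_ae_eq_integral => //.
- exact: emeasurable_funM.
- by move=> u _; rewrite mule_ge0.
- by apply: filterS (F2_ae0 Ft0) => u -> _; rewrite mule0.
Qed.

Let int_good t : good t -> (\int[p t]_u (ent_fun (F2 (j (t, u))))%:E =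
   (f1 t)%:E * \int[p t]_u (ent_fun (f (t, u)))%:E + (ent_fun (f1 t))%:E)%E.
Proof.
move=> gt.
have mE (h : X -> R) : measurable_fun setT h ->
    measurable_fun setT (fun u => (ent_fun (h u))%:E).
  by move=> mh; apply/measurable_EFinP; exact: (measurableT_comp measurable_ent_fun).
have mF2t : measurable_fun setT (fun u => F2 (j (t, u))) by exact: measurableT_comp.
have mfe : measurable_fun setT (fun u => (f (t, u))%:E) by exact/measurable_EFinP.
have mf1e : measurable_fun setT (fun u => (f1 t * f (t, u))%:E).
  by apply/measurable_EFinP; exact: measurable_funM.
have e0 x : 0 <= x -> (0 <= (ent_fun x)%:E)%E by move=> x0; rewrite lee_fin ent_fun_ge0.
have fe0 u : (0 <= (f (t, u))%:E)%E by rewrite lee_fin.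
have f1e0 : (0 <= (f1 t)%:E)%E by rewrite lee_fin.
have [_ _ int_f] := hf t.
set Phi2 := (LHS); set Phi := (\int[p t]_u (ent_fun (f (t, u)))%:E)%E.
(* [ent_funM] at [f1 t] and [f (t, u)], integrated in [u], where [f] has integral 1. The finite
   terms 1 and [f1 t] are cancelled afterwards. *)
have key : (Phi2 + 1 + (f1 t)%:E = (f1 t)%:E * Phi + (ent_fun (f1 t))%:E + (f1 t)%:E + 1)%E.
  transitivity (\int[p t]_u ((ent_fun (F2 (j (t, u))))%:E + (f (t, u))%:E + (f1 t)%:E))%E.
    rewrite ge0_integralD//; last 2 first.
    - by move=> u _; rewrite adde_ge0// e0.
    - by apply: emeasurable_funD => //; exact: mE.
    rewrite ge0_integralD//; last 2 first.
    - by move=> u _; rewrite e0.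
    - exact: mE.
    by rewrite int_f integral_probability_cst.
  transitivity (\int[p t]_u ((f1 t)%:E * (ent_fun (f (t, u)))%:E +
      (ent_fun (f1 t))%:E * (f (t, u))%:E + (f1 t)%:E * (f (t, u))%:E + 1%:E))%E.
    apply: eq_integral => u _; rewrite F2f// -!EFinM -!EFinD; congr (_%:E).
    rewrite ent_funM//; last exact: f1_gt0.
    by rewrite [f (t, u) * _]mulrC.
  have m1 : measurable_fun setT (fun u => (f1 t)%:E * (ent_fun (f (t, u)))%:E)%E.
    by apply: measurable_funeM; exact: mE.
  have m2 : measurable_fun setT (fun u => (ent_fun (f1 t))%:E * (f (t, u))%:E)%E.
    exact: measurable_funeM.
  have m3 : measurable_fun setT (fun u => (f1 t)%:E * (f (t, u))%:E)%E.
    exact: measurable_funeM.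
  have p1 u : (0 <= (f1 t)%:E * (ent_fun (f (t, u)))%:E)%E by rewrite mule_ge0// e0.
  have p2 u : (0 <= (ent_fun (f1 t))%:E * (f (t, u))%:E)%E by rewrite mule_ge0// e0.
  have p3 u : (0 <= (f1 t)%:E * (f (t, u))%:E)%E by rewrite mule_ge0.
  have m12 : measurable_fun setT (fun u => (f1 t)%:E * (ent_fun (f (t, u)))%:E +
      (ent_fun (f1 t))%:E * (f (t, u))%:E)%E by exact: emeasurable_funD.
  have m123 : measurable_fun setT (fun u => (f1 t)%:E * (ent_fun (f (t, u)))%:E +
      (ent_fun (f1 t))%:E * (f (t, u))%:E + (f1 t)%:E * (f (t, u))%:E)%E.
    exact: emeasurable_funD.
  have p12 u : (0 <= (f1 t)%:E * (ent_fun (f (t, u)))%:E +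
      (ent_fun (f1 t))%:E * (f (t, u))%:E)%E by rewrite adde_ge0.
  have p123 u : (0 <= (f1 t)%:E * (ent_fun (f (t, u)))%:E +
      (ent_fun (f1 t))%:E * (f (t, u))%:E + (f1 t)%:E * (f (t, u))%:E)%E.
    by rewrite adde_ge0.
  have me : measurable_fun setT (fun u => (ent_fun (f (t, u)))%:E) by exact: mE.
  have pe u : (0 <= (ent_fun (f (t, u)))%:E)%E by rewrite e0.
  have ef1 : (0 <= (ent_fun (f1 t))%:E)%E by rewrite e0.
  rewrite ge0_integralD// ge0_integralD// ge0_integralD// !ge0_integralZl//.
  by rewrite int_f integral_probability_cst !mule1.
have {}key : (Phi2 + 1 = (f1 t)%:E * Phi + (ent_fun (f1 t))%:E + 1)%E.
  rewrite -[LHS](addeK _ (x := (f1 t)%:E))// key -[RHS](addeK _ (x := (f1 t)%:E))//.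
  by congr (_ - _)%E; rewrite addeAC.
by rewrite -[LHS](addeK _ (x := 1%E))// key addeK.
Qed.

Let int_all t : (F1 t < +oo)%E -> (\int[p t]_u (ent_fun (F2 (j (t, u))))%:E =
   (f1 t)%:E * \int[p t]_u (ent_fun (f (t, u)))%:E + (ent_fun (f1 t))%:E)%E.
Proof.
move=> Fty; have [gt|ngt] := boolP (good t); first exact: int_good.
have Ft0 : F1 t = 0%E.
  apply/eqP; rewrite eq_le F10 andbT leNgt; apply: contra ngt => h.
  by rewrite /good h.
(* On such a fibre [F2] vanishes almost everywhere, and both sides equal [ent_fun 0 = 1]. *)
rewrite /f1 Ft0/= mul0e add0e -[RHS](integral_probability_cst (p t)).
apply: ge0_ae_eq_integral => //.
- apply/measurable_EFinP; apply: (measurableT_comp measurable_ent_fun).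
  exact: measurableT_comp.
- by move=> u _; rewrite lee_fin ent_fun_ge0.
- by move=> u _; rewrite lee_fin ent_fun_ge0.
- by apply: filterS (F2_ae0 Ft0) => u -> _.
Qed.

(** Dividing [F2] by its fibre integral disintegrates [nu2] through densities alone. The maps [j]
    and [pr] will be appending a last coordinate to a tuple and deleting it. *)
Lemma entropy_disintegration : exists (F : T -> R) (g : T * X -> R)
    (hg : forall t, is_density (p t) (fun u => g (t, u))),
  [/\ (forall t, 0 <= F t), measurable_fun setT F, measurable_fun setT g &
  [/\ forall h : T -> \bar R, (forall t, (0 <= h t)%E) -> measurable_fun setT h ->
    (\int[image_probability nu2 mpr]_t h t = \int[mu1]_t (h t * (F t)%:E))%E,
  forall h : T2 -> \bar R, (forall y, (0 <= h y)%E) -> measurable_fun setT h ->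
    (\int[nu2]_y h y = \int[image_probability nu2 mpr]_t
        \int[density (hg t)]_u h (j (t, u)))%E &
  (\int[mu2]_y (ent_fun (F2 y))%:E = \int[mu1]_t (ent_fun (F t))%:E +
    \int[image_probability nu2 mpr]_t \int[p t]_u (ent_fun (g (t, u)))%:E)%E]].
Proof.
exists f1, f, hf.
have nu1E (h : T -> \bar R) : (forall t, (0 <= h t)%E) -> measurable_fun setT h ->
    (\int[nu1]_t h t = \int[mu1]_t (h t * (f1 t)%:E))%E.
  move=> h0 mh; rewrite intF1//; apply: ge0_ae_eq_integral => //.
  - exact: emeasurable_funM.
  - by apply: emeasurable_funM => //; exact/measurable_EFinP.
  - by move=> t _; rewrite mule_ge0.
  - by move=> t _; rewrite mule_ge0// lee_fin.
  - by apply: filterS F1_fin => t Ft _; rewrite fineK// ge0_fin_numE.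
split => //; split => //.
  move=> h h0 mh.
  have mhj : measurable_fun setT (fun tu => h (j tu)) by exact: measurableT_comp.
  have mhf : measurable_fun setT (fun tu => h (j tu) * (f tu)%:E)%E.
    by apply: emeasurable_funM => //; exact/measurable_EFinP.
  have phf tu : (0 <= h (j tu) * (f tu)%:E)%E by rewrite mule_ge0// lee_fin.
  have mi : measurable_fun setT (fun t => \int[p t]_u (h (j (t, u)) * (f (t, u))%:E))%E.
    exact: (measurable_kernel_integral hp (phi := fun tu => (h (j tu) * (f tu)%:E)%E)).
  have pi0 t : (0 <= \int[p t]_u (h (j (t, u)) * (f (t, u))%:E))%E by exact: integral_ge0.
  rewrite nu2E// mu2E//; last 2 first.
  - by move=> y; rewrite mule_ge0.
  - by apply: emeasurable_funM => //; exact/measurable_EFinP.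
  transitivity (\int[nu1]_t \int[p t]_u (h (j (t, u)) * (f (t, u))%:E))%E; last first.
    apply: eq_integral => t _; rewrite integral_density//.
    exact: (measurableT_comp mhj (measurable_pair1 t)).
  rewrite nu1E//; apply: ge0_ae_eq_integral => //.
  - apply: (measurable_kernel_integral hp (phi := fun tu => (h (j tu) * (F2 (j tu))%:E)%E)).
      by move=> tu; rewrite mule_ge0.
    by apply: emeasurable_funM => //; exact/measurable_EFinP.
  - by apply: emeasurable_funM => //; exact/measurable_EFinP.
  - by move=> t _; apply: integral_ge0 => u _; rewrite mule_ge0.
  - by move=> t _; rewrite mule_ge0// lee_fin.
  - by apply: filterS F1_fin => t Ft _; rewrite muleC split_int.
have mef : measurable_fun setT (fun tu => (ent_fun (f tu))%:E).
  by apply/measurable_EFinP; exact: (measurableT_comp measurable_ent_fun).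
have e0 x : 0 <= x -> (0 <= (ent_fun x)%:E)%E by move=> x0; rewrite lee_fin ent_fun_ge0.
have mi : measurable_fun setT (fun t => \int[p t]_u (ent_fun (f (t, u)))%:E)%E.
  apply: (measurable_kernel_integral hp (phi := fun tu => (ent_fun (f tu))%:E)) => //.
  by move=> tu; exact: e0.
have i0 t : (0 <= \int[p t]_u (ent_fun (f (t, u)))%:E)%E.
  by apply: integral_ge0 => u _; exact: e0.
have mf1e : measurable_fun setT (fun t => (f1 t)%:E) by exact/measurable_EFinP.
have f1e0 t : (0 <= (f1 t)%:E)%E by rewrite lee_fin.
have mef1 : measurable_fun setT (fun t => (ent_fun (f1 t))%:E).
  by apply/measurable_EFinP; exact: (measurableT_comp measurable_ent_fun).
have mmi : measurable_fun setT (fun t => (f1 t)%:E * \int[p t]_u (ent_fun (f (t, u)))%:E)%E.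
  exact: emeasurable_funM.
have mi0 t : (0 <= (f1 t)%:E * \int[p t]_u (ent_fun (f (t, u)))%:E)%E by rewrite mule_ge0.
rewrite mu2E//; last 2 first.
- by move=> y; exact: e0.
- by apply/measurable_EFinP; exact: (measurableT_comp measurable_ent_fun).
rewrite -/nu1 nu1E// addeC.
under [X in (X + _)%E]eq_integral do rewrite muleC.
rewrite -ge0_integralD//; last by move=> t _; exact: e0.
apply: ge0_ae_eq_integral => //.
- apply: (measurable_kernel_integral hp (phi := fun tu => (ent_fun (F2 (j tu)))%:E)).
    by move=> tu; exact: e0.
  apply/measurable_EFinP; apply: (measurableT_comp measurable_ent_fun).
  exact: measurableT_comp.
- exact: emeasurable_funD.
- by move=> t _; apply: integral_ge0 => u _; exact: e0.
- by move=> t _; rewrite adde_ge0// e0.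
- by apply: filterS F1_fin => t Ft _; rewrite int_all.
Qed.

End entropy_disintegration.

(** * Near-minimisers of the Wasserstein distance, and Jensen's inequality *)

Section wasserstein.
Context {R : realType} {d : measure_display} {X : measurableType d}.
Variables (dist : X -> X -> R) (s : R).
Hypothesis s12 : 1 <= s <= 2.

Let s_gt0 : 0 < s. Proof. by case/andP: s12 => s1 _; rewrite (lt_le_trans ltr01). Qed.

Lemma transport_cost_ge0 (pi : probability (X * X)%type R) :
  (0 <= transport_cost dist s pi)%E.
Proof. by apply: integral_ge0 => z _; rewrite lee_fin powR_ge0. Qed.

Lemma Wasserstein_ge0 (mu nu : probability X R) : (0 <= Wasserstein dist s mu nu)%E.
Proof. by apply: le_ereal_inf_tmp => _ [pi _ <-]; exact: poweR_ge0. Qed.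

Lemma Wasserstein_le_cost (mu nu : probability X R) pi (w : R) : 0 <= w ->
  couplings mu nu pi -> (transport_cost dist s pi <= (w `^ s)%:E)%E ->
  (Wasserstein dist s mu nu <= w%:E)%E.
Proof.
move=> w0 cpi H.
apply: (@le_trans _ _ (poweR (transport_cost dist s pi) s^-1)).
  by apply: ereal_inf_lbound; exists pi.
have -> : w%:E = poweR (w `^ s)%:E s^-1.
  by rewrite poweR_EFin -powRrM mulfV ?gt_eqF// powRr1.
apply: gt0_ler_poweR => //; rewrite ?invr_ge0 ?(ltW s_gt0)//.
- by rewrite in_itv/= transport_cost_ge0 leey.
- by rewrite in_itv/= lee_fin powR_ge0 leey.
Qed.

(** A near-minimiser stands in for an optimal coupling; its error is additive on the scale of the
    power [s], on which all costs are compared. *)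
Lemma Wasserstein_coupling (mu nu : probability X R) (w e : R) : 0 <= w ->
  (Wasserstein dist s mu nu <= w%:E)%E -> 0 < e ->
  exists2 pi, couplings mu nu pi & (transport_cost dist s pi <= (w `^ s + e)%:E)%E.
Proof.
move=> w0 Hw e0.
have we0 : 0 <= w `^ s + e by rewrite addr_ge0 ?powR_ge0// ltW.
have : (Wasserstein dist s mu nu < ((w `^ s + e) `^ s^-1)%:E)%E.
  apply: (le_lt_trans Hw); rewrite lte_fin.
  have {1}-> : w = (w `^ s) `^ s^-1 by rewrite -powRrM mulfV ?gt_eqF// powRr1.
  by apply: gt0_ltr_powR; rewrite ?invr_gt0 ?nnegrE ?powR_ge0// ltrDl.
move=> /ereal_inf_lt [_ [pi cpi <-]] Hpi; exists pi => //.
rewrite leNgt; apply/negP => H.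
move: Hpi; rewrite ltNge => /negP; apply.
rewrite -poweR_EFin; apply: gt0_ler_poweR; rewrite ?invr_ge0 ?(ltW s_gt0)//.
- by rewrite in_itv/= lee_fin we0 leey.
- by rewrite in_itv/= transport_cost_ge0 leey.
- exact: ltW.
Qed.

Lemma Wasserstein_pow_coupling (mu nu : probability X R) (b e : R) : 0 <= b ->
  (poweR (Wasserstein dist s mu nu) s <= b%:E)%E -> 0 < e ->
  exists2 pi, couplings mu nu pi & (transport_cost dist s pi <= (b + e)%:E)%E.
Proof.
move=> b0 Hb e0.
have -> : b = (b `^ s^-1) `^ s by rewrite -powRrM mulVf ?gt_eqF// powRr1.
apply: Wasserstein_coupling => //; first exact: powR_ge0.
rewrite -poweR_EFin -[leLHS]poweRe1 ?Wasserstein_ge0//.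
rewrite -(mulfV (lt0r_neq0 s_gt0)) poweRrM.
apply: gt0_ler_poweR; rewrite ?invr_ge0 ?(ltW s_gt0)//.
- by rewrite in_itv/= poweR_ge0 leey.
- by rewrite in_itv/= lee_fin b0 leey.
Qed.

Hypothesis cell : cellular dist.

Lemma finite_moment_coupling (q p : probability X R) pi :
  couplings q p pi -> (transport_cost dist s pi < +oo)%E ->
  finite_moment dist s q -> finite_moment dist s p.
Proof.
move=> /couplingsP[q1 p2] Hpi [y mq]; exists y.
have [_ _ dC tri] : is_metric dist by case: cell.
have dist0 u v : 0 <= dist u v by case: cell => -[].
have [K K0 HK] := split_pow_near s12 (@ltr01 R).
have pw0 u v : (0 <= ((dist u v) `^ s)%:E)%E by rewrite lee_fin powR_ge0.
have m1 : measurable_fun setT (fun v => ((dist y v) `^ s)%:E).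
  exact: (measurable_dist_pow s cell (measurable_cst y) (@measurable_id _ _ _)).
have mz : measurable_fun setT (fun z : X * X => ((dist z.1 z.2) `^ s)%:E).
  exact: measurable_dist_pow.
have m1z : measurable_fun setT (fun z : X * X => ((dist y z.1) `^ s)%:E).
  exact: (measurable_dist_pow s cell (measurable_cst y)).
have m2z : measurable_fun setT (fun z : X * X => ((dist y z.2) `^ s)%:E).
  exact: (measurable_dist_pow s cell (measurable_cst y)).
rewrite -(has_law_integral p2 (g := fun v => ((dist y v) `^ s)%:E))//.
pose F (z : X * X) := ((1 + 1)%:E * ((dist y z.1) `^ s)%:E)%E : \bar R.
pose G (z : X * X) := (K%:E * ((dist z.1 z.2) `^ s)%:E)%E : \bar R.
have F0 (z : X * X) : (0 <= F z)%E by rewrite mule_ge0.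
have G0 z : (0 <= G z)%E by rewrite mule_ge0.
have mF : measurable_fun setT F by exact: measurable_funeM.
have mG : measurable_fun setT G by exact: measurable_funeM.
apply: (@le_lt_trans _ _ (\int[pi]_z (F z + G z))%E).
  apply: ge0_le_integral => //.
  - exact: emeasurable_funD.
  - move=> [u v] _ /=; rewrite /F /G/= -!EFinM -EFinD lee_fin.
    apply: (le_trans _ (HK _ _ (dist0 _ _) (dist0 _ _))).
    by apply: ge0_ler_powR; rewrite ?nnegrE ?addr_ge0// ltW.
rewrite ge0_integralD// !ge0_integralZl//.
rewrite (has_law_integral q1 (g := fun v => ((dist y v) `^ s)%:E))//.
by apply: lte_add_pinfty; exact: lte_mul_pinfty.
Qed.

End wasserstein.

Section jensen.
Context {R : realType}.

(** The tangent at [m] lies above the concave power. After scaling by [m] this is Young's inequality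
    against the constant 1, with exponents [1 / th] and [1 / (1 - th)]. *)
Lemma powR_tangent (th m y : R) : 0 < th <= 1 -> 0 < m -> 0 <= y ->
  y `^ th <= (1 - th) * m `^ th + th * (m `^ th / m) * y.
Proof.
move=> /andP[th0 th1] m0 y0.
have key (r : R) : 0 <= r -> r `^ th <= (1 - th) + th * r.
  move=> r0; have [->|thn1] := eqVneq th 1; first by rewrite powRr1// subrr add0r mul1r.
  have th1' : 0 < 1 - th by rewrite subr_gt0 lt_neqAle thn1.
  have := @conjugate_powR R (r `^ th) 1 th^-1 (1 - th)^-1.
  rewrite powR_ge0 ler01 !invr_gt0 th0 th1' !invrK addrC subrK.
  move=> /(_ isT isT isT isT erefl).
  rewrite mulr1 -powRrM mulfV ?gt_eqF// powRr1// powR1 mul1r.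
  by rewrite [r * th]mulrC addrC.
have -> : y = m * (y / m) by field; rewrite gt_eqF.
rewrite powRM ?divr_ge0 ?(ltW m0)//.
have := key (y / m); rewrite divr_ge0 ?(ltW m0)// => /(_ isT) h.
apply: (le_trans (ler_wpM2l (powR_ge0 m th) h)).
rewrite le_eqVlt; apply/orP; left; apply/eqP.
by field; rewrite gt_eqF.
Qed.

Context {d : measure_display} {T : measurableType d}.

(** Jensen's inequality, by integrating the tangent at [m]; it suffices that [m] is a positive upper
    bound of the mean. *)
Lemma integral_poweR_le (P : probability T R) (Y : T -> \bar R) (th m : R) :
  0 < th <= 1 -> 0 < m -> (forall t, (0 <= Y t)%E) -> measurable_fun setT Y ->
  (\int[P]_t Y t <= m%:E)%E -> (\int[P]_t (poweR (Y t) th) <= (m `^ th)%:E)%E.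
Proof.
move=> th01 m0 Y0 mY iY; have /andP[th0 th1] := th01.
have mth : 0 < m `^ th by rewrite powR_gt0.
pose b := th * (m `^ th / m); have b0 : 0 < b by rewrite mulr_gt0// divr_gt0.
have a0 : 0 <= (1 - th) * m `^ th by rewrite mulr_ge0 ?subr_ge0// ltW.
have b0E : (0 <= b%:E)%E by rewrite lee_fin ltW.
have mbY : measurable_fun setT (fun t => b%:E * Y t)%E by exact: measurable_funeM.
have bY0 t : (0 <= b%:E * Y t)%E by rewrite mule_ge0.
apply: (@le_trans _ _ (\int[P]_t (((1 - th) * m `^ th)%:E + b%:E * Y t))%E).
  apply: ge0_le_integral => //.
  - by move=> t _; exact: poweR_ge0.
  - by apply: (measurableT_comp (measurable_poweR _)).
  - exact: emeasurable_funD.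
  - move=> t _; have := Y0 t; case: (Y t) => [y| |] //.
      by rewrite lee_fin => y0; rewrite poweR_EFin -EFinM -EFinD lee_fin powR_tangent.
    by move=> _; rewrite mulry gtr0_sg// mul1e addey// leey.
rewrite ge0_integralD// integral_probability_cst ge0_integralZl//.
apply: (@le_trans _ _ (((1 - th) * m `^ th)%:E + b%:E * m%:E)%E).
  by rewrite leeD2l// lee_wpmul2l.
rewrite -EFinM -EFinD lee_fin /b le_eqVlt; apply/orP; left; apply/eqP.
by field; rewrite gt_eqF.
Qed.

End jensen.

(** * Coupling tuples one coordinate at a time *)

Section tuples.
Context {d : measure_display} {X : measurableType d}.

Definition tuple_snoc k (tu : k.-tuple X * X) : k.+1.-tuple X :=
  [tuple of rcons tu.1 tu.2].

Lemma tnth_snoc_widen k (tu : k.-tuple X * X) (i : 'I_k) :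
  tnth (tuple_snoc tu) (widen_ord (leqnSn k) i) = tnth tu.1 i.
Proof.
rewrite (tnth_nth tu.2)/= nth_rcons size_tuple ltn_ord.
by rewrite (tnth_nth tu.2).
Qed.

Lemma tnth_snoc_max k (tu : k.-tuple X * X) : tnth (tuple_snoc tu) ord_max = tu.2.
Proof. by rewrite (tnth_nth tu.2)/= nth_rcons size_tuple ltnn eqxx. Qed.

Lemma measurable_tuple_snoc k : measurable_fun setT (@tuple_snoc k).
Proof.
apply/measurable_fun_tnthP => i.
have [j ij|ik] := @unliftP _ ord_max i; last first.
  rewrite (_ : _ \o _ = snd)//; apply/funext => tu /=.
  by rewrite ik tnth_snoc_max.
have -> : i = widen_ord (leqnSn k) j.
  by rewrite ij; apply/val_inj; rewrite /= /bump leqNgt ltn_ord.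
rewrite (_ : _ \o _ = (fun tu : k.-tuple X * X => tnth tu.1 j)).
  exact: (measurableT_comp (measurable_tnth j) measurable_fst).
by apply/funext => tu /=; rewrite tnth_snoc_widen.
Qed.

Lemma measurable_tprefix m k (h : (m <= k)%N) : measurable_fun setT (@tprefix d X m k h).
Proof.
apply/measurable_fun_tnthP => i.
rewrite (_ : _ \o _ = (@tnth k X)^~ (widen_ord h i)); first exact: measurable_tnth.
by apply/funext => x /=; rewrite tnth_mktuple.
Qed.

Lemma tprefix_snoc k (tu : k.-tuple X * X) : tprefix (leqnSn k) (tuple_snoc tu) = tu.1.
Proof.
by apply: eq_from_tnth => i; rewrite tnth_mktuple tnth_snoc_widen.
Qed.

End tuples.

Section step_coupling.
Context {R : realType} {d : measure_display} {X : measurableType d}.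
Variables (dist : X -> X -> R) (s alpha c1 c2 : R).
Hypotheses (cell : cellular dist) (s12 : 1 <= s <= 2) (alpha0 : 0 < alpha).
Hypotheses (c10 : 0 <= c1) (c20 : 0 <= c2) (c12 : split_pow s c1 c2).

Lemma entropy_coupling (q p p' : probability X R) (a b e : R) :
  transport_ineq dist s alpha p -> finite_moment dist s q ->
  Ent q p = a%:E -> 0 <= a ->
  (poweR (Wasserstein dist s p p') s <= b%:E)%E -> 0 <= b -> 0 < e ->
  exists2 pi, couplings q p' pi &
    (transport_cost dist s pi <= (c2 * (2 / alpha * a) `^ (s / 2) + c1 * b + e)%:E)%E.
Proof.
move=> Tp mq Ea a0 Wb b0 e0.
have := Tp q mq; rewrite Ea => /(_ isT)/= Wqp.
have c3 : 0 < c1 + c2 + 1 by rewrite ltr_wpDl// addr_ge0.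
(* Three errors [e'] occur: those of the two near-minimisers, weighted by [c2] and [c1], and that of
   the gluing. *)
pose e' := e / (c1 + c2 + 1).
have e'0 : 0 < e' by rewrite divr_gt0.
have [pi1 cp1 I1] := Wasserstein_coupling s12 (sqrtr_ge0 _) Wqp e'0.
have [pi2 cp2 I2] := Wasserstein_pow_coupling s12 b0 Wb e'0.
have [pi cp I] := coupling_triangle cell s12 cp1 cp2 I1 I2 c10 c20 c12 e'0.
exists pi => //; apply: (le_trans I); rewrite lee_fin.
have aa : 0 <= 2 / alpha * a by rewrite mulr_ge0// divr_ge0// ltW.
rewrite -powR12_sqrt// -powRrM [2^-1 * s]mulrC -/(s / 2).
have : e' * (c1 + c2 + 1) = e by rewrite /e' divfK// gt_eqF.
lra.
Qed.

End step_coupling.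

Section induction.
Context {R : realType} {d : measure_display} {X : measurableType d}.
Variables (dist : X -> X -> R) (s alpha c1 c2 : R) (rho : nat -> R) (n : nat).
Hypotheses (cell : cellular dist) (s12 : 1 <= s <= 2) (alpha0 : 0 < alpha).
Hypotheses (c10 : 0 <= c1) (c20 : 0 <= c2) (c12 : split_pow s c1 c2).
Variables (p : forall k : nat, k.-tuple X -> probability X R)
  (mu : forall k : nat, probability (k.-tuple X) R).
Hypothesis p_kernel : forall k, (k < n)%N -> is_kernel (p (k:=k)).
Hypothesis muS : forall k, (k < n)%N -> forall g : k.+1.-tuple X -> \bar R,
  (forall y, (0 <= g y)%E) -> measurable_fun setT g ->
  (\int[mu k.+1]_y g y = \int[mu k]_t \int[p t]_u g (tuple_snoc (t, u)))%E.
Hypothesis rho_ge0 : forall l, (1 <= l <= n)%N -> 0 <= rho l.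
Hypothesis p_transport : forall k, (k < n)%N -> forall t : k.-tuple X,
  transport_ineq dist s alpha (p t).
Hypothesis p_lipschitz : forall k, (k < n)%N -> forall t t' : k.-tuple X,
  (poweR (Wasserstein dist s (p t) (p t')) s <=
   (\sum_(j < k) rho (k - j)%N * (dist (tnth t j) (tnth t' j)) `^ s)%:E)%E.

Let s_gt0 : 0 < s. Proof. by case/andP: s12 => s1 _; rewrite (lt_le_trans ltr01). Qed.

Let dist0 x y : 0 <= dist x y. Proof. by case: cell => -[]. Qed.

Definition coord_cost k (j : 'I_k) (pi : probability (k.-tuple X * k.-tuple X)%type R) :=
  (\int[pi]_z ((dist (tnth z.1 j) (tnth z.2 j)) `^ s)%:E)%E.

Let pw0 x y : (0 <= ((dist x y) `^ s)%:E)%E. Proof. by rewrite lee_fin powR_ge0. Qed.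

Let mcoord k (j : 'I_k) : measurable_fun setT (fun z : k.-tuple X * k.-tuple X =>
  ((dist (tnth z.1 j) (tnth z.2 j)) `^ s)%:E).
Proof.
apply: measurable_dist_pow => //.
  exact: (measurableT_comp (measurable_tnth j) measurable_fst).
exact: (measurableT_comp (measurable_tnth j) measurable_snd).
Qed.

Let snoc2 k (zw : (k.-tuple X * k.-tuple X) * (X * X)) :=
  (tuple_snoc (zw.1.1, zw.2.1), tuple_snoc (zw.1.2, zw.2.2)).

Let measurable_snoc2 k : measurable_fun setT (@snoc2 k).
Proof.
have m11 : measurable_fun setT (fun zw : (k.-tuple X * k.-tuple X) * (X * X) => zw.1.1).
  exact: (measurableT_comp measurable_fst measurable_fst).
have m12 : measurable_fun setT (fun zw : (k.-tuple X * k.-tuple X) * (X * X) => zw.1.2).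
  exact: (measurableT_comp measurable_snd measurable_fst).
have m21 : measurable_fun setT (fun zw : (k.-tuple X * k.-tuple X) * (X * X) => zw.2.1).
  exact: (measurableT_comp measurable_fst measurable_snd).
have m22 : measurable_fun setT (fun zw : (k.-tuple X * k.-tuple X) * (X * X) => zw.2.2).
  exact: (measurableT_comp measurable_snd measurable_snd).
apply: measurable_fun_pair.
  exact: (measurableT_comp (@measurable_tuple_snoc d X k) (measurable_fun_pair m11 m21)).
exact: (measurableT_comp (@measurable_tuple_snoc d X k) (measurable_fun_pair m12 m22)).
Qed.

(** Mix over [pi] the couplings [kap z] of the next coordinates, each appended to the pair of pasts
    [z]. The pasts are untouched, so the earlier costs do not change. *)
Lemma coupling_extension k (nu1 mu1 : probability (k.-tuple X) R)
    (q' p' : k.-tuple X -> probability X R)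
    (nu2 mu2 : probability (k.+1.-tuple X) R)
    (pi : probability (k.-tuple X * k.-tuple X)%type R)
    (kap : k.-tuple X * k.-tuple X -> probability (X * X)%type R) :
  is_kernel q' -> is_kernel p' -> is_kernel kap ->
  (forall z, couplings (q' z.1) (p' z.2) (kap z)) ->
  couplings nu1 mu1 pi ->
  (forall g : k.+1.-tuple X -> \bar R, (forall y, (0 <= g y)%E) -> measurable_fun setT g ->
    (\int[nu2]_y g y = \int[nu1]_t \int[q' t]_u g (tuple_snoc (t, u)))%E) ->
  (forall g : k.+1.-tuple X -> \bar R, (forall y, (0 <= g y)%E) -> measurable_fun setT g ->
    (\int[mu2]_y g y = \int[mu1]_t \int[p' t]_u g (tuple_snoc (t, u)))%E) ->
  exists2 pi2, couplings nu2 mu2 pi2 &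
    (forall j : 'I_k, coord_cost (widen_ord (leqnSn k) j) pi2 = coord_cost j pi) /\
    coord_cost ord_max pi2 = (\int[pi]_z transport_cost dist s (kap z))%E.
Proof.
move=> hq' hp' hk ck /couplingsP[pi1 pi2] nu2E mu2E.
have msz z : measurable_fun setT (fun w => @snoc2 k (z, w)).
  by apply: (measurableT_comp (measurable_snoc2 (k:=k))); exact: measurable_pair1.
pose K z := image_probability (kap z) (msz z).
have hK : is_kernel K.
  move=> U mU.
  rewrite (_ : (fun z => _) = (fun z => \int[kap z]_w (\1_U (snoc2 (z, w)))%:E))%E.
    apply: (measurable_kernel_integral hk (phi := fun zw => (\1_U (snoc2 zw))%:E)).
      by move=> zw; rewrite lee_fin.
    apply/measurable_EFinP.
    exact: (measurableT_comp (measurable_indic mU) (measurable_snoc2 (k:=k))).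
  apply/funext => z; rewrite /K image_probabilityE.
  transitivity (\int[kap z]_w (\1_((fun w => snoc2 (z, w)) @^-1` U) w)%:E)%E => //.
  rewrite integral_indic ?setIT//.
  by rewrite -[X in measurable X]setTI; exact: (msz z).
have intK (g : k.+1.-tuple X * k.+1.-tuple X -> \bar R) : (forall z, (0 <= g z)%E) ->
    measurable_fun setT g ->
    (\int[mixture hK pi]_z g z = \int[pi]_z \int[kap z]_w g (snoc2 (z, w)))%E.
  move=> g0 mg; rewrite integral_mixture//.
  by apply: eq_integral => z _; rewrite integral_image_probability.
have mks (r : k.-tuple X -> probability X R) (hr : is_kernel r)
    (g : k.+1.-tuple X -> \bar R) : (forall y, (0 <= g y)%E) -> measurable_fun setT g ->
    measurable_fun setT (fun t => \int[r t]_u g (tuple_snoc (t, u)))%E.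
  move=> g0 mg; apply: (measurable_kernel_integral hr (phi := fun tu => g (tuple_snoc tu))) => //.
  exact: (measurableT_comp mg (@measurable_tuple_snoc d X k)).
have mgt (g : k.+1.-tuple X -> \bar R) t : measurable_fun setT g ->
    measurable_fun setT (fun u => g (tuple_snoc (t, u))).
  move=> mg; apply: (measurableT_comp mg).
  by apply: (measurableT_comp (@measurable_tuple_snoc d X k)); exact: measurable_pair1.
exists (mixture hK pi).
  apply/couplingsP; split; apply: integral_has_law => // g g0 mg.
    rewrite intK//; last exact: measurableT_comp.
    rewrite nu2E// -(has_law_integral pi1 (g := fun t => \int[q' t]_u g (tuple_snoc (t, u)))%E)//.
    - apply: eq_integral => z _; have /couplingsP[k1 _] := ck z.
      by rewrite -(has_law_integral k1 (g := fun u => g (tuple_snoc (z.1, u))))//; exact: mgt.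
    - by move=> t; exact: integral_ge0.
    - exact: mks.
  rewrite intK//; last exact: measurableT_comp.
  rewrite mu2E// -(has_law_integral pi2 (g := fun t => \int[p' t]_u g (tuple_snoc (t, u)))%E)//.
  - apply: eq_integral => z _; have /couplingsP[_ k2] := ck z.
    by rewrite -(has_law_integral k2 (g := fun u => g (tuple_snoc (z.2, u))))//; exact: mgt.
  - by move=> t; exact: integral_ge0.
  - exact: mks.
split=> [j|].
  rewrite /coord_cost intK//; apply: eq_integral => z _.
  rewrite -[RHS](integral_probability_cst (kap z)); apply: eq_integral => w _.
  by rewrite /snoc2/= !tnth_snoc_widen.
rewrite /coord_cost (intK _ (fun z => pw0 _ _) (mcoord ord_max)).
apply: eq_integral => z _; rewrite /transport_cost.
by apply: eq_integral => w _; rewrite /snoc2/= !tnth_snoc_max.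
Qed.

(* [D j] bounds the transport cost in coordinate [j], and [E j] is the relative
   entropy created by the [j]-th transition, up to the slack [e]. *)
Lemma tuple_coupling k : (k <= n)%N ->
  forall (nu : probability (k.-tuple X) R) (F : k.-tuple X -> R) (Phi e : R),
  (forall y, 0 <= F y) -> measurable_fun setT F ->
  (forall g : k.-tuple X -> \bar R, (forall y, (0 <= g y)%E) -> measurable_fun setT g ->
    (\int[nu]_y g y = \int[mu k]_y (g y * (F y)%:E))%E) ->
  (\int[mu k]_y (ent_fun (F y))%:E <= Phi%:E)%E ->
  (forall j : 'I_k, exists x, (\int[nu]_y ((dist x (tnth y j)) `^ s)%:E < +oo)%E) ->
  0 < e ->
  exists (pi : probability (k.-tuple X * k.-tuple X)%type R) (D E : nat -> R),
  [/\ couplings nu (mu k) pi, forall j : 'I_k, (coord_cost j pi <= (D j)%:E)%E,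
   forall j, 0 <= E j, \sum_(j < k) E j <= Phi + k%:R * e &
   forall j, (j < k)%N -> D j = c2 * (2 / alpha * E j) `^ (s / 2) +
      c1 * \sum_(i < j) rho (j - i)%N * D i + e].
Proof.
elim: k => [|k IH] kn nu F Phi e F0 mF nuE HPhi mom e0.
  exists (nu \x mu 0%N)%E, (fun=> 0), (fun=> 0); split => //.
  - apply/couplingsP; split; apply: integral_has_law => // g g0 mg.
      rewrite fubini_tonelli1//; last exact: measurableT_comp.
      by rewrite /fubini_F/=; under eq_integral do rewrite integral_probability_cst.
    rewrite fubini_tonelli2//; last exact: measurableT_comp.
    by rewrite /fubini_G/=; under eq_integral do rewrite integral_probability_cst.
  - by case.
  - rewrite big_ord0 mul0r addr0 -lee_fin (le_trans _ HPhi)// integral_ge0// => y _.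
    by rewrite lee_fin ent_fun_ge0.
have mpr := @measurable_tprefix d X k k.+1 (leqnSn k).
have [F1 [g [hg [F10 mF1 mg [nu1E nu2E chain]]]]] :=
  entropy_disintegration (@measurable_tuple_snoc d X k) mpr
    (fun t u => @tprefix_snoc d X k (t, u)) (p_kernel kn) (muS kn) F0 mF nuE.
set nu1 := image_probability nu mpr in nu1E nu2E chain.
pose q t := density (hg t).
have hq : is_kernel q by exact: (kernel_density (p_kernel kn) mg hg).
pose ent t := (\int[p t]_u (ent_fun (g (t, u)))%:E)%E.
have g0 t u : 0 <= g (t, u) by have [g0 _ _] := hg t; exact: g0.
have ent0 t : (0 <= ent t)%E.
  by apply: integral_ge0 => u _; rewrite lee_fin ent_fun_ge0.
have ment : measurable_fun setT ent.
  apply: (measurable_kernel_integral (p_kernel kn) (phi := fun tu => (ent_fun (g tu))%:E)).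
    by move=> [t u]; rewrite lee_fin ent_fun_ge0.
  by apply/measurable_EFinP; exact: (measurableT_comp measurable_ent_fun).
have iF1_0 : (0 <= \int[mu k]_t (ent_fun (F1 t))%:E)%E.
  by apply: integral_ge0 => t _; rewrite lee_fin ent_fun_ge0.
have ient_0 : (0 <= \int[nu1]_t ent t)%E by exact: integral_ge0.
have chain' : (\int[mu k]_t (ent_fun (F1 t))%:E + \int[nu1]_t ent t <= Phi%:E)%E.
  by rewrite -chain.
have iF1_fin : (\int[mu k]_t (ent_fun (F1 t))%:E)%E \is a fin_num.
  by rewrite ge0_fin_numE// (le_lt_trans (le_trans (leeDl _ _) chain'))// ltry.
have ient_fin : (\int[nu1]_t ent t)%E \is a fin_num.
  by rewrite ge0_fin_numE// (le_lt_trans (le_trans (leeDr _ _) chain'))// ltry.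
pose Phi1 := fine (\int[mu k]_t (ent_fun (F1 t))%:E)%E.
pose E0 := fine (\int[nu1]_t ent t)%E.
have PhiE : Phi1 + E0 <= Phi by rewrite -lee_fin EFinD !fineK.
have E00 : 0 <= E0 by exact: fine_ge0.
have mnu1 (j : 'I_k) x : (\int[nu1]_t ((dist x (tnth t j)) `^ s)%:E =
    \int[nu]_y ((dist x (tnth y (widen_ord (leqnSn k) j))) `^ s)%:E)%E.
  rewrite integral_image_probability//; last first.
    by apply: (measurable_dist_pow s cell (measurable_cst x)); exact: measurable_tnth.
  by apply: eq_integral => y _; rewrite tnth_mktuple.
have mom1 (j : 'I_k) : exists x, (\int[nu1]_t ((dist x (tnth t j)) `^ s)%:E < +oo)%E.
  by have [x Hx] := mom (widen_ord (leqnSn k) j); exists x; rewrite mnu1.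
have HPhi1 : (\int[mu k]_t (ent_fun (F1 t))%:E <= Phi1%:E)%E by rewrite fineK.
have [pi [D [E [cpi HD E0' HE rec]]]] := IH (ltnW kn) nu1 F1 Phi1 e F10 mF1 nu1E HPhi1 mom1 e0.
(* The slack makes [Ek] positive even when [E0 = 0], as the tangent argument in [integral_poweR_le]
   requires; it accounts for the term [k%:R * e] in the entropy budget. *)
pose Ek := E0 + e.
have Ek0 : 0 < Ek by rewrite ltr_wpDl.
pose S := \sum_(i < k) rho (k - i)%N * D i.
have D0 (i : 'I_k) : 0 <= D i.
  by rewrite -lee_fin (le_trans _ (HD i))// integral_ge0.
have rho0 (i : 'I_k) : 0 <= rho (k - i)%N.
  apply: rho_ge0; rewrite subn_gt0 ltn_ord/=.
  by rewrite (leq_trans (leq_subr _ _))// ltnW.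
have S0 : 0 <= S by apply: sumr_ge0 => i _; rewrite mulr_ge0.
pose m := c2 * (2 / alpha * Ek) `^ (s / 2) + c1 * S.
have m0 : 0 <= m by rewrite addr_ge0// mulr_ge0// powR_ge0.
have m4 : 0 < m + 4 + e by rewrite addr_gt0// ltr_wpDl.
(* Chosen so that [(1 + tau) * (m + tau) + (tau + tau) <= m + e], which closes [last_cost]. *)
pose tau := e / (m + 4 + e).
have tau0 : 0 < tau by rewrite divr_gt0.
have tauE : tau * (m + 4 + e) = e by rewrite /tau divfK// gt_eqF.
have a2 : 0 < 2 / alpha by rewrite divr_gt0.
pose Y t := ((2 / alpha)%:E * ent t)%E.
have Y0 t : (0 <= Y t)%E by rewrite mule_ge0// lee_fin ltW.
have mY : measurable_fun setT Y by exact: measurable_funeM.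
pose L (z : k.-tuple X * k.-tuple X) :=
  \sum_(i < k) rho (k - i)%N * (dist (tnth z.1 i) (tnth z.2 i)) `^ s.
have L0 z : 0 <= L z by apply: sumr_ge0 => i _; rewrite mulr_ge0// powR_ge0.
(* The bound of [entropy_coupling] at the pasts [z], extended-real valued because [ent] may be
   infinite on a null set of pasts. *)
pose c (z : k.-tuple X * k.-tuple X) :=
  (c2%:E * poweR (Y z.1) (s / 2) + c1%:E * (L z)%:E + tau%:E)%E.
have mLE : measurable_fun setT (fun z => (L z)%:E).
  under eq_fun do rewrite /L -sumEFin.
  apply: emeasurable_sum => i; under eq_fun do rewrite EFinM.
  by apply: measurable_funeM; exact: mcoord.
have mYz : measurable_fun setT (fun z : k.-tuple X * k.-tuple X => poweR (Y z.1) (s / 2)).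
  apply: (measurableT_comp (measurable_poweR _)).
  exact: (measurableT_comp mY measurable_fst).
have mc1 : measurable_fun setT (fun z : k.-tuple X * k.-tuple X => c2%:E * poweR (Y z.1) (s / 2))%E.
  exact: measurable_funeM.
have mc2 : measurable_fun setT (fun z : k.-tuple X * k.-tuple X => c1%:E * (L z)%:E)%E.
  exact: measurable_funeM.
have mc12 : measurable_fun setT (fun z => c2%:E * poweR (Y z.1) (s / 2) + c1%:E * (L z)%:E)%E.
  exact: emeasurable_funD.
have mc : measurable_fun setT c by exact: emeasurable_funD.
have hq1 : is_kernel (fun z : k.-tuple X * k.-tuple X => q z.1).
  by move=> U mU; exact: (measurableT_comp (hq _ mU) measurable_fst).
have hp2 : is_kernel (fun z : k.-tuple X * k.-tuple X => p z.2).
  by move=> U mU; exact: (measurableT_comp (p_kernel kn mU) measurable_snd).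
have [kap [hk ck Hk]] := coupling_selection hq1 hp2 cell s12 tau0 mc.
have [pi2 cpi2 [Hwid Hmax]] :=
  coupling_extension hq (p_kernel kn) hk ck cpi nu2E (muS kn).
have tauE0 : (0 <= tau%:E :> \bar R)%E by rewrite lee_fin ltW.
have LE0 z : (0 <= (L z)%:E)%E by rewrite lee_fin.
have pc1 (z : k.-tuple X * k.-tuple X) : (0 <= c2%:E * poweR (Y z.1) (s / 2))%E.
  by rewrite mule_ge0// poweR_ge0.
have pc2 (z : k.-tuple X * k.-tuple X) : (0 <= c1%:E * (L z)%:E)%E by rewrite mule_ge0.
have pc12 z : (0 <= c2%:E * poweR (Y z.1) (s / 2) + c1%:E * (L z)%:E)%E by rewrite adde_ge0.
have c0 z : (0 <= c z)%E by rewrite adde_ge0.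
have [pi1 pi2'] := (couplingsP nu1 (mu k) pi).1 cpi.
(* Jensen with exponent [s / 2] treats the entropy term; the induction bounds [HD] treat the
   distances of the pasts. *)
have int_c : (\int[pi]_z c z <= (m + tau)%:E)%E.
  rewrite ge0_integralD// integral_probability_cst EFinD leeD2r//.
  rewrite ge0_integralD// /m EFinD; apply: leeD.
    rewrite ge0_integralZl//; last by move=> z _; exact: poweR_ge0.
    rewrite EFinM lee_wpmul2l//.
    rewrite (has_law_integral pi1 (g := fun t => poweR (Y t) (s / 2)))//; last 2 first.
    - by move=> t; exact: poweR_ge0.
    - exact: (measurableT_comp (measurable_poweR _)).
    apply: integral_poweR_le => //.
    - by have /andP[s1 s2] := s12; rewrite divr_gt0//= ler_pdivrMr// mul1r.
    - by rewrite mulr_gt0.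
    - rewrite ge0_integralZl//; last by rewrite lee_fin ltW.
      rewrite -(fineK ient_fin) -EFinM lee_fin ler_pM2l//.
      by rewrite lerDl ltW.
  rewrite ge0_integralZl// EFinM lee_wpmul2l//.
  under eq_integral do rewrite /L -sumEFin.
  rewrite ge0_integral_sum//; last 2 first.
  - move=> i; under eq_fun do rewrite EFinM.
    by apply: measurable_funeM; exact: mcoord.
  - by move=> i z _; rewrite lee_fin mulr_ge0// powR_ge0.
  rewrite /S -sumEFin; apply: lee_sum => i _.
  under eq_integral do rewrite EFinM.
  have rE : (0 <= (rho (k - i)%N)%:E :> \bar R)%E by rewrite lee_fin.
  rewrite (ge0_integralZl _ measurableT (mcoord i) (fun z _ => pw0 _ _) rE).
  by rewrite EFinM lee_wpmul2l//; exact: HD.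
have [xk Hxk] := mom ord_max.
have mxk : measurable_fun setT (fun u => ((dist xk u) `^ s)%:E).
  exact: (measurable_dist_pow s cell (measurable_cst xk) (@measurable_id _ _ _)).
pose Mq t := (\int[q t]_u ((dist xk u) `^ s)%:E)%E.
have mMq : measurable_fun setT Mq.
  apply: (measurable_kernel_integral hq (phi := fun tu => ((dist xk tu.2) `^ s)%:E)) => //.
  exact: (measurable_dist_pow s cell (measurable_cst xk) measurable_snd).
have Mq0 t : (0 <= Mq t)%E by exact: integral_ge0.
have ae_fin (h : k.-tuple X -> \bar R) : (forall t, (0 <= h t)%E) -> measurable_fun setT h ->
    (\int[nu1]_t h t < +oo)%E -> {ae pi, forall z, (h z.1 < +oo)%E}.
  move=> h0 mh ih; apply: (has_law_ae pi1 (Q := fun t => (h t < +oo)%E)).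
  have : nu1.-integrable setT h.
    by apply/integrableP; split => //; under eq_integral do rewrite gee0_abs//.
  move=> /(integrable_ae measurableT); apply: filterS => t /(_ I).
  by rewrite ge0_fin_numE.
(* The conditional laws of [nu] have finite moments only for almost every past, by integrating the
   moment of the last coordinate. *)
have aeMq : {ae pi, forall z, (Mq z.1 < +oo)%E}.
  apply: ae_fin => //.
  have mord : measurable_fun setT (fun y : k.+1.-tuple X => ((dist xk (tnth y ord_max)) `^ s)%:E).
    by apply: (measurable_dist_pow s cell (measurable_cst xk)); exact: measurable_tnth.
  move: Hxk; rewrite (nu2E _ (fun y => pw0 _ _) mord).
  apply: le_lt_trans; rewrite le_eqVlt; apply/orP; left; apply/eqP.
  apply: eq_integral => t _; apply: eq_integral => u _.
  by rewrite tnth_snoc_max.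
have aeent : {ae pi, forall z, (ent z.1 < +oo)%E}.
  by apply: ae_fin => //; rewrite -(fineK ient_fin) ltry.
have mtc : measurable_fun setT (fun z => transport_cost dist s (kap z)).
  apply: (measurable_kernel_integral hk (phi := fun zw => ((dist zw.2.1 zw.2.2) `^ s)%:E)) => //.
  apply: (measurable_dist_pow s cell).
    exact: (measurableT_comp measurable_fst measurable_snd).
  exact: (measurableT_comp measurable_snd measurable_snd).
have tau1E : (0 <= (1 + tau)%:E :> \bar R)%E by rewrite lee_fin addr_ge0// ltW.
have ttE : (0 <= (tau + tau)%:E :> \bar R)%E by rewrite lee_fin addr_ge0// ltW.
have mtc' : measurable_fun setT (fun z => (1 + tau)%:E * c z)%E by exact: measurable_funeM.
have ptc' z : (0 <= (1 + tau)%:E * c z)%E by rewrite mule_ge0.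
have last_cost : (coord_cost ord_max pi2 <= (m + e)%:E)%E.
  rewrite Hmax.
  apply: (@le_trans _ _ (\int[pi]_z ((1 + tau)%:E * c z + (tau + tau)%:E))%E).
    apply: ae_ge0_le_integral => //.
    - by move=> z _; exact: transport_cost_ge0.
    - by move=> z _; rewrite adde_ge0.
    - exact: emeasurable_funD.
    apply: filterS2 aeMq aeent => z Mz entz _.
    pose a := fine (ent z.1).
    have aE : ent z.1 = a%:E by rewrite fineK// ge0_fin_numE.
    have a0 : 0 <= a by exact: fine_ge0.
    have Eqp : Ent (q z.1) (p z.1) = a%:E by rewrite (Ent_density (hf := hg z.1)).
    have mq : finite_moment dist s (q z.1) by exists xk.
    have Tp : transport_ineq dist s alpha (p z.1) by exact: p_transport.
    have [pz cpz Iz] := entropy_coupling cell s12 alpha0 c10 c20 c12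
      Tp mq Eqp a0 (p_lipschitz kn z.1 z.2) (L0 z) tau0.
    have cE : c z = (c2 * (2 / alpha * a) `^ (s / 2) + c1 * L z + tau)%:E.
      have Ya : Y z.1 = (2 / alpha * a)%:E by rewrite /Y aE -EFinM.
      by rewrite /c Ya poweR_EFin -!EFinM -!EFinD.
    (* The moment passes from [q z.1] to [p z.2] through the coupling [pz], whose cost is finite. *)
    have mp : finite_moment dist s (p z.2).
      apply: (finite_moment_coupling s12 cell cpz _ mq).
      by rewrite (le_lt_trans Iz)// ltry.
    apply: (le_trans (Hk z _ pz cE cpz Iz mq mp)).
    by rewrite cE -EFinM -EFinD lee_fin addrA.
  rewrite ge0_integralD// integral_probability_cst ge0_integralZl//.
  apply: (@le_trans _ _ ((1 + tau)%:E * (m + tau)%:E + (tau + tau)%:E)%E).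
    by rewrite leeD2r// lee_wpmul2l.
  rewrite -EFinM -EFinD lee_fin.
  nra.
pose D' j := if (j < k)%N then D j else m + e.
pose E' j := if (j < k)%N then E j else Ek.
exists pi2, D', E'; split => //.
- move=> j; have [i ->|->] := @unliftP _ ord_max j; last first.
    by rewrite /D' /= ltnn.
  have -> : lift ord_max i = widen_ord (leqnSn k) i.
    by apply/val_inj; rewrite /= /bump leqNgt ltn_ord.
  by rewrite Hwid /D' /= ltn_ord; exact: HD.
- by move=> j; rewrite /E'; case: ifP => // _; exact: ltW.
- rewrite big_ord_recr/= /E' ltnn.
  under eq_bigr => i _ do rewrite ltn_ord.
  rewrite -natr1 mulrDl mul1r.
  move: HE PhiE; rewrite /Ek; lra.
- have sumD j : (j <= k)%N -> \sum_(i < j) rho (j - i)%N * D' i = \sum_(i < j) rho (j - i)%N * D i.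
    move=> jk; apply: eq_bigr => i _.
    by rewrite /D' (leq_trans (ltn_ord i) jk).
  move=> j; rewrite ltnS => jk; rewrite sumD//.
  move: jk; rewrite leq_eqVlt => /orP[/eqP ->|jk].
    by rewrite /D' /E' ltnn.
  by rewrite /D' /E' jk rec.
Qed.

End induction.

(** * Discrete Gronwall bounds *)

Section recursions.
Context {R : realType}.

Lemma geometric_bound (u b : nat -> R) (r beta : R) n : 0 <= r -> u 0%N = 0 ->
  (forall m, (m < n)%N -> u m.+1 <= r * u m + b m) ->
  (forall m, (m < n)%N -> b m <= beta) ->
  u n <= beta * \sum_(i < n) r ^+ i.
Proof.
move=> r0 u0; elim: n => [|n IH] rec bb; first by rewrite u0 big_ord0 mulr0.
have {}IH : u n <= beta * \sum_(i < n) r ^+ i.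
  by apply: IH => m mn; [apply: rec|apply: bb]; rewrite ltnW.
apply: (le_trans (rec n (ltnSn n))).
apply: (@le_trans _ _ (r * (beta * \sum_(i < n) r ^+ i) + beta)).
  by apply: lerD; [exact: ler_wpM2l|exact: bb].
rewrite big_ord_recl expr0 mulrDr mulr1 addrC lerD2l mulrCA.
rewrite le_eqVlt; apply/orP; left; apply/eqP; congr (_ * _).
by rewrite mulr_sumr; apply: eq_bigr => i _; rewrite exprS.
Qed.

Lemma geometric_sum_le (r : R) n : 1 < r ->
  \sum_(i < n) r ^+ i <= r ^+ n / (r - 1).
Proof.
move=> r1; have r10 : 0 < r - 1 by rewrite subr_gt0.
by rewrite ler_pdivlMr// mulrC -subrX1 gerBl.
Qed.

Lemma sum_exprM_le (c r : R) n : 1 <= c -> 0 <= r ->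
  \sum_(i < n) (c * r) ^+ i <= c ^+ n.-1 * \sum_(i < n) r ^+ i.
Proof.
move=> c1 r0; rewrite mulr_sumr; apply: ler_sum => i _.
rewrite exprMn ler_wpM2r ?exprn_ge0//.
by apply: ler_weXn2l => //; rewrite -ltnS (leq_trans (ltn_ord i))// leqSpred.
Qed.

(** Regrouping by the earlier index shows the total coefficient of each [D i]: the lags from 1 to
    [m - i]. *)
Lemma sum_convolution (rho D : nat -> R) m :
  \sum_(j < m.+1) \sum_(i < j) rho (j - i)%N * D i =
  \sum_(i < m) D i * \sum_(1 <= l < (m - i).+1) rho l.
Proof.
elim: m => [|m IH]; first by rewrite big_ord_recr/= !big_ord0 addr0.
rewrite big_ord_recr/= IH [in RHS]big_ord_recr/= subSnn big_nat1.
rewrite [X in _ + X]big_ord_recr/= subSnn addrA [rho 1%N * _]mulrC; congr (_ + _).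
rewrite -big_split; apply: eq_bigr => i _ /=.
rewrite subSn ?(ltnW (ltn_ord i))// [in RHS]big_nat_recr//= mulrDr.
by rewrite [rho _ * _]mulrC.
Qed.

(** Jensen's inequality for a finite mean, by summing the tangents at [Y / n]. It is the origin of
    the factor n^(1 - s/2). *)
Lemma sum_powR_le (y : nat -> R) (th Y : R) n : (0 < n)%N -> 0 < th <= 1 -> 0 < Y ->
  (forall j, 0 <= y j) -> \sum_(j < n) y j <= Y ->
  \sum_(j < n) (y j) `^ th <= n%:R `^ (1 - th) * Y `^ th.
Proof.
move=> n0 th01 Y0 y0 yY; have /andP[th0 th1] := th01.
have nR : 0 < n%:R :> R by rewrite ltr0n.
pose m := Y / n%:R; have m0 : 0 < m by rewrite divr_gt0.
apply: (@le_trans _ _ (\sum_(j < n) ((1 - th) * m `^ th + th * (m `^ th / m) * y j))).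
  by apply: ler_sum => j _; exact: powR_tangent.
rewrite big_split/= sumr_const card_ord -mulr_sumr.
apply: (@le_trans _ _ ((1 - th) * m `^ th *+ n + th * (m `^ th / m) * Y)).
  by rewrite lerD2l ler_wpM2l// mulr_ge0 ?(ltW th0)// divr_ge0 ?powR_ge0// ltW.
have -> : Y `^ th = n%:R `^ th * m `^ th.
  by rewrite -powRM ?(ltW m0)// /m mulrC divfK// gt_eqF.
rewrite [leRHS]mulrA -powRD; last by rewrite subrK oner_eq0.
rewrite subrK powRr1// -mulr_natr.
rewrite le_eqVlt; apply/orP; left; apply/eqP.
have YE : Y = m * n%:R by rewrite /m divfK// gt_eqF.
by rewrite YE; field; rewrite gt_eqF.
Qed.

Variables (rho D E : nat -> R) (c1 c2 a th Phi e : R) (n : nat).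
Hypotheses (c10 : 0 <= c1) (c20 : 0 <= c2) (e0 : 0 <= e) (a0 : 0 < a).
Hypotheses (th01 : 0 < th <= 1) (Phi0 : 0 < Phi).
Hypothesis D0 : forall j, (j < n)%N -> 0 <= D j.
Hypothesis E0 : forall j, 0 <= E j.
Hypothesis EPhi : \sum_(j < n) E j <= Phi.
Hypothesis rec : forall j, (j < n)%N ->
  D j = c2 * (a * E j) `^ th + c1 * \sum_(i < j) rho (j - i)%N * D i + e.

Let S m := \sum_(j < m) D j.
Let H := (a * Phi) `^ th.

Let h_ge0 j : 0 <= (a * E j) `^ th. Proof. exact: powR_ge0. Qed.

Let aE0 j : 0 <= a * E j. Proof. by rewrite mulr_ge0// ltW. Qed.

(** If each coefficient is at most [M], the history term is at most [c1 * M] times the partial sum,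
    which therefore grows by the factor [1 + c1 * M]. Each single source is bounded through
    [E j <= Phi]. *)
Lemma recursion_bounded (M : R) : 0 <= M ->
  (forall l, (1 <= l <= n)%N -> rho l <= M) ->
  \sum_(j < n) D j <= (c2 * H + e) * \sum_(i < n) (1 + c1 * M) ^+ i.
Proof.
move=> M0 rhoM.
apply: (@geometric_bound S (fun j => c2 * (a * E j) `^ th + e)) => //.
- by rewrite addr_ge0// mulr_ge0.
- by rewrite /S big_ord0.
- move=> m mn; rewrite /S big_ord_recr/= rec// -/(S m).
  have hS : c1 * \sum_(i < m) rho (m - i)%N * D i <= c1 * M * S m.
    rewrite -mulrA ler_wpM2l// mulr_sumr; apply: ler_sum => i _.
    rewrite ler_wpM2r//; first by apply: D0; rewrite (ltn_trans (ltn_ord i)).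
    apply: rhoM; rewrite subn_gt0 ltn_ord/=.
    by rewrite (leq_trans (leq_subr _ _))// ltnW.
  by rewrite mulrDl mul1r; lra.
- move=> m mn; rewrite lerD2r ler_wpM2l//.
  have /andP[th0 _] := th01.
  apply: ge0_ler_powR; rewrite ?nnegrE ?(ltW th0)// ?mulr_ge0 ?(ltW a0) ?(ltW Phi0)//.
  rewrite ler_wpM2l ?(ltW a0)//; apply: le_trans EPhi.
  rewrite (bigD1 (Ordinal mn))//= lerDl sumr_ge0//.
Qed.

Hypothesis n0 : (0 < n)%N.

Let beta := c2 * (n%:R `^ (1 - th) * H) + n%:R * e.

Let source_le m : (m <= n)%N -> \sum_(j < m) (c2 * (a * E j) `^ th + e) <= beta.
Proof.
move=> mn; apply: (@le_trans _ _ (\sum_(j < n) (c2 * (a * E j) `^ th + e))).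
  rewrite -(subnKC mn) big_split_ord/= lerDl sumr_ge0// => i _.
  by rewrite addr_ge0// mulr_ge0.
rewrite big_split/= -mulr_sumr sumr_const card_ord -[e *+ n]mulr_natl lerD2r ler_wpM2l//.
apply: (@sum_powR_le (fun j => a * E j)) => //; first by rewrite mulr_gt0.
by rewrite -mulr_sumr ler_wpM2l// ltW.
Qed.

Hypothesis rho_ge0 : forall l, (1 <= l <= n)%N -> 0 <= rho l.
Variable Rb : R.
Hypothesis Rb0 : 0 <= Rb.
Hypothesis rhoR : \sum_(1 <= l < n.+1) rho l <= Rb.

(** Summing the recursion before estimating lets each [D i] collect coefficients of total at most
    [Rb]. Lags are at least 1, so only [S m] appears on the right. *)
Let S_step m : (m < n)%N -> S m.+1 <= c1 * Rb * S m +
  \sum_(j < m.+1) (c2 * (a * E j) `^ th + e).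
Proof.
move=> mn; rewrite /S.
have -> : \sum_(j < m.+1) D j = \sum_(j < m.+1) (c2 * (a * E j) `^ th + e) +
    c1 * \sum_(j < m.+1) \sum_(i < j) rho (j - i)%N * D i.
  rewrite mulr_sumr -big_split/=; apply: eq_bigr => j _.
  by rewrite rec ?(leq_trans (ltn_ord j))// addrAC.
rewrite addrC lerD2r sum_convolution -mulrA ler_wpM2l// mulr_sumr.
apply: ler_sum => i _; rewrite mulrC ler_wpM2r//.
  by apply: D0; rewrite (ltn_trans (ltn_ord i)).
apply: le_trans rhoR.
have le1 : ((m - i).+1 <= n.+1)%N by rewrite ltnS (leq_trans (leq_subr _ _))// ltnW.
rewrite [leRHS](big_cat_nat _ le1)//= lerDl big_nat_cond sumr_ge0// => l /andP[/andP[l1 l2] _].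
by apply: rho_ge0; rewrite (leq_trans _ l1).
Qed.

Lemma recursion_summable : \sum_(j < n) D j <=
  beta * \sum_(i < n) (c1 * Rb) ^+ i.
Proof.
apply: (@geometric_bound S (fun m => \sum_(j < m.+1) (c2 * (a * E j) `^ th + e))) => //.
- by rewrite mulr_ge0.
- by rewrite /S big_ord0.
- by move=> m mn; exact: source_le.
Qed.

(** The partial sums are nondecreasing, so the history term is absorbed into the left side instead
    of being iterated. *)
Lemma recursion_contracting : c1 * Rb < 1 ->
  \sum_(j < n) D j <= beta / (1 - c1 * Rb).
Proof.
move=> cR1; rewrite ler_pdivlMr ?subr_gt0// mulrBr mulr1 lerBlDr.
case: n n0 D0 source_le S_step => // m _ D0' sl st.
apply: (le_trans (st m (ltnSn m))); rewrite addrC; apply: lerD; first exact: sl.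
rewrite mulrC ler_wpM2r ?mulr_ge0//.
by rewrite /S big_ord_recr/= lerDl D0'.
Qed.

End recursions.

(** * The convexity constants and the geometric sums *)

Section constants.
Context {R : realType}.
Variables (s : R) (n : nat).
Hypotheses (s12 : 1 <= s <= 2) (n0 : (0 < n)%N).

Let s1 : 1 <= s. Proof. by case/andP: s12. Qed.
Let s2 : s <= 2. Proof. by case/andP: s12. Qed.
Let s_gt0 : 0 < s. Proof. by rewrite (lt_le_trans ltr01). Qed.
Let nR : 0 < n%:R :> R. Proof. by rewrite ltr0n. Qed.
Let n1R : 0 < n.+1%:R :> R. Proof. by rewrite ltr0n. Qed.

(* Convexity of [x `^ s] at the weight [n / (n + 1)], for which the [n]-th power of
   the left constant stays below [e ^ (s - 1)]. *)
Definition split_left : R := (n%:R / n.+1%:R) `^ (1 - s).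
Definition split_right : R := n.+1%:R `^ (s - 1).

Lemma split_left_right : split_pow s split_left split_right.
Proof.
pose t : R := n%:R / n.+1%:R.
have t01 : 0 < t < 1 by rewrite divr_gt0//= ltr_pdivrMr// mul1r ltr_nat.
have -> : split_right = (1 - t) `^ (1 - s); last exact: split_pow_convex.
have -> : 1 - t = n.+1%:R^-1.
  by rewrite /t -natr1; field; rewrite natr1 gt_eqF.
by rewrite -powR_inv1 ?ltW// -powRrM mulN1r opprB.
Qed.

Lemma split_leftE : split_left = expR ((s - 1) * ln (1 + n%:R^-1)).
Proof.
have -> : split_left = (1 + n%:R^-1) `^ (s - 1).
  rewrite /split_left (_ : n%:R / n.+1%:R = (1 + n%:R^-1)^-1); last first.
    by rewrite -natr1; field; rewrite natr1 !gt_eqF.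
  by rewrite -powR_inv1 ?ltW// -powRrM mulN1r opprB.
by rewrite /powR gt_eqF.
Qed.

Lemma split_left_ge1 : 1 <= split_left.
Proof.
rewrite split_leftE -[leLHS]expR0 ler_expR; apply: mulr_ge0; first by rewrite subr_ge0.
by apply: ln_ge0; rewrite lerDl invr_ge0 ltW.
Qed.

(** [split_left] is the power [s - 1] of [1 + 1/n], and [n * ln (1 + 1/n) <= 1]. *)
Lemma split_left_pow : split_left ^+ n <= expR (s - 1).
Proof.
rewrite split_leftE -expRM_natl ler_expR.
rewrite mulrCA -[leRHS]mulr1 ler_wpM2l ?subr_ge0//.
rewrite -[leRHS](mulfV (lt0r_neq0 nR)) ler_wpM2l ?(ltW nR)//.
by apply: le_ln1Dx; rewrite (lt_trans (ltrN10 _))// invr_gt0.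
Qed.

Lemma split_rightE : split_right = n%:R `^ (s - 1) * split_left.
Proof.
rewrite /split_left /split_right.
have -> : (n%:R / n.+1%:R) `^ (1 - s) = (n.+1%:R / n%:R) `^ (s - 1) :> R.
  have -> : n%:R / n.+1%:R = (n.+1%:R / n%:R)^-1 :> R by rewrite invf_div.
  by rewrite -powR_inv1 ?divr_ge0 ?ltW// -powRrM mulN1r opprB.
by rewrite -powRM ?divr_ge0 ?ltW// mulrC divfK// gt_eqF.
Qed.

Lemma split_right_ge0 : 0 <= split_right. Proof. exact: powR_ge0. Qed.
Lemma split_left_ge0 : 0 <= split_left. Proof. exact: powR_ge0. Qed.

(** One factor [split_left] contained in [split_right] completes the exponent [n.-1] to [n]; whence
    the factor (ne)^(1-s) in the first constant. *)
Lemma split_right_left_pow :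
  split_right * split_left ^+ n.-1 <= (n%:R * expR 1) `^ (s - 1).
Proof.
rewrite split_rightE -mulrA -exprS prednK//.
rewrite [leRHS]powRM ?(ltW nR) ?expR_ge0//.
rewrite ler_wpM2l ?powR_ge0//.
have -> : expR 1 `^ (s - 1) = expR (s - 1) :> R.
  by rewrite /powR gt_eqF ?expR_gt0// expRK mulr1.
exact: split_left_pow.
Qed.

Lemma sum_split_bounded (M : R) : 0 < M ->
  \sum_(i < n) (1 + split_left * M) ^+ i <=
  split_left ^+ n.-1 * ((1 + M) ^+ n / M).
Proof.
move=> M0.
have c1 := split_left_ge1; have c0 := split_left_ge0.
(* [split_left >= 1] allows factoring it out of [1 + split_left * M], so that its powers separate
   from those of [1 + M]. *)
apply: (@le_trans _ _ (\sum_(i < n) (split_left * (1 + M)) ^+ i)).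
  apply: ler_sum => i _; apply: lerXn2r.
  - by rewrite nnegrE addr_ge0// mulr_ge0// ltW.
  - by rewrite nnegrE mulr_ge0// addr_ge0// ltW.
  - by rewrite mulrDr mulr1 lerD2r.
apply: (le_trans (sum_exprM_le _ c1 _)); first by rewrite addr_ge0// ltW.
rewrite ler_wpM2l ?exprn_ge0//.
have := @geometric_sum_le R (1 + M) n; rewrite ltrDl M0 => /(_ isT).
by rewrite [1 + M - 1]addrAC subrr add0r.
Qed.

Lemma sum_split_one : \sum_(i < n) (split_left * 1) ^+ i <= n%:R * expR (s - 1).
Proof.
rewrite mulr1 mulrC mulr_natr.
apply: (@le_trans _ _ (\sum_(i < n) expR (s - 1))); last first.
  by rewrite sumr_const card_ord.
apply: ler_sum => i _; apply: le_trans split_left_pow.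
by apply: ler_weXn2l; [exact: split_left_ge1|rewrite ltnW].
Qed.

Lemma sum_split_gt1 (Rb : R) : 1 < Rb ->
  \sum_(i < n) (split_left * Rb) ^+ i <= expR (s - 1) * (Rb ^+ n / (Rb - 1)).
Proof.
move=> R1; have R0 : 0 <= Rb by rewrite (le_trans ler01)// ltW.
apply: (le_trans (sum_exprM_le _ split_left_ge1 R0)).
apply: ler_pM.
- by rewrite exprn_ge0// split_left_ge0.
- by rewrite sumr_ge0// => i _; rewrite exprn_ge0.
- apply: le_trans split_left_pow.
  by apply: ler_weXn2l; [exact: split_left_ge1|rewrite leq_pred].
- exact: geometric_sum_le.
Qed.

(** With [n] replaced by [n.+1] the exponents [s - 1] and [1 - s / 2] add up to [s / 2]; raised to
    the power [2 / s] this is a factor [n + 1], seen in the constants for R >= 1. *)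
Lemma split_right_root : split_right * n%:R `^ (1 - s / 2) <= n.+1%:R `^ (s / 2).
Proof.
apply: (@le_trans _ _ (split_right * n.+1%:R `^ (1 - s / 2))).
  rewrite ler_wpM2l ?split_right_ge0//.
  apply: ge0_ler_powR; rewrite ?nnegrE ?(ltW nR) ?(ltW n1R) ?ler_nat//.
  by rewrite subr_ge0 ler_pdivrMr// mul1r.
rewrite /split_right -powRD; last by rewrite (gt_eqF n1R) implybT.
by rewrite le_eqVlt; apply/orP; left; apply/eqP; congr (_ `^ _); field.
Qed.

End constants.

(** * From coordinate costs to the transport inequality *)

Lemma lt_ereal_real {R : realType} (x : R) (W : \bar R) : (x%:E < W)%E ->
  exists2 v, x < v & (v%:E < W)%E.
Proof.
case: W => [r| |] //; last by move=> _; exists (x + 1); rewrite ?ltrDl// ltry.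
by rewrite lte_fin => xr; exists ((x + r) / 2); rewrite ?lte_fin; lra.
Qed.

Section tuple_transport.
Context {R : realType} {d : measure_display} {X : measurableType d}.
Variables (dist : X -> X -> R) (s alpha c1 c2 : R) (rho : nat -> R) (n : nat).
Hypotheses (cell : cellular dist) (s12 : 1 <= s <= 2) (alpha0 : 0 < alpha).
Hypotheses (c10 : 0 <= c1) (c20 : 0 <= c2) (c12 : split_pow s c1 c2).
Variables (p : forall k : nat, k.-tuple X -> probability X R)
  (mu : forall k : nat, probability (k.-tuple X) R).
Hypothesis p_kernel : forall k, (k < n)%N -> is_kernel (p (k:=k)).
Hypothesis muS : forall k, (k < n)%N -> forall g : k.+1.-tuple X -> \bar R,
  (forall y, (0 <= g y)%E) -> measurable_fun setT g ->
  (\int[mu k.+1]_y g y = \int[mu k]_t \int[p t]_u g (tuple_snoc (t, u)))%E.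
Hypothesis rho_ge0 : forall l, (1 <= l <= n)%N -> 0 <= rho l.
Hypothesis p_transport : forall k, (k < n)%N -> forall t : k.-tuple X,
  transport_ineq dist s alpha (p t).
Hypothesis p_lipschitz : forall k, (k < n)%N -> forall t t' : k.-tuple X,
  (poweR (Wasserstein dist s (p t) (p t')) s <=
   (\sum_(j < k) rho (k - j)%N * (dist (tnth t j) (tnth t' j)) `^ s)%:E)%E.
Variable Pn : probability (n.-tuple X) R.
Hypothesis PnE : forall A, measurable A -> Pn A = mu n A.

Let s_gt0 : 0 < s. Proof. by case/andP: s12 => s1 _; rewrite (lt_le_trans ltr01). Qed.
Let dist0 x y : 0 <= dist x y. Proof. by case: cell => -[]. Qed.
Let pw0 x y : (0 <= ((dist x y) `^ s)%:E)%E. Proof. by rewrite lee_fin powR_ge0. Qed.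

Let dist_pow_s (x y : n.-tuple X) :
  (dist_pow dist s x y) `^ s = \sum_(j < n) (dist (tnth x j) (tnth y j)) `^ s.
Proof.
rewrite /dist_pow -powRrM mulVf ?gt_eqF// powRr1//.
by apply: sumr_ge0 => j _; exact: powR_ge0.
Qed.

(** Reduces the theorem to real recursions. If the inequality failed, a real [v] would lie strictly
    between its right side and the distance; the entropy is then enlarged a little and [e] taken so
    small that the total cost stays below the power [s] of [v]. *)
Lemma tuple_transport (B K : R) : (0 < n)%N -> 0 < B -> 0 <= K ->
  (forall (Phi e : R) (D E : nat -> R), 0 < Phi -> 0 < e ->
    (forall j, (j < n)%N -> 0 <= D j) -> (forall j, 0 <= E j) ->
    \sum_(j < n) E j <= Phi ->
    (forall j, (j < n)%N -> D j = c2 * (2 / alpha * E j) `^ (s / 2) +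
      c1 * \sum_(i < j) rho (j - i)%N * D i + e) ->
    \sum_(j < n) D j <= B^-1 * (2 / alpha * Phi) `^ (s / 2) + K * e) ->
  transport_ineq (@dist_pow R d X dist s n) s (alpha * B `^ (2 / s)) Pn.
Proof.
move=> n0 B0 K0 bound nu [y0 my0] Efin.
have dom : charge_of_finite_measure nu `<< Pn.
  by move: Efin; rewrite /Ent; case: pselect.
have dom' : nu `<< Pn by exact: dom.
(* This version of the derivative is finite and nonnegative at every point, not just almost
   everywhere. *)
pose F y := fine (Radon_Nikodym_SigmaFinite.f nu Pn y).
have Ff y : ((F y)%:E = Radon_Nikodym_SigmaFinite.f nu Pn y)%E.
  by rewrite fineK//; exact: Radon_Nikodym_SigmaFinite.f_fin_num.
have F0 y : 0 <= F y by rewrite fine_ge0//; exact: Radon_Nikodym_SigmaFinite.f_ge0.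
have mFE : measurable_fun setT (fun y => (F y)%:E).
  under eq_fun do rewrite Ff.
  by apply: (@measurable_int _ _ _ Pn); exact: Radon_Nikodym_SigmaFinite.f_integrable.
have mF : measurable_fun setT F by exact/measurable_EFinP.
have nuF A : measurable A -> nu A = (\int[Pn]_(y in A) (F y)%:E)%E.
  move=> mA; under eq_integral do rewrite Ff.
  exact: Radon_Nikodym_SigmaFinite.f_integral.
have hF : is_density Pn F.
  split => //; rewrite -nuF//; exact: probability_setT.
have nuE A : measurable A -> nu A = density hF A by exact: nuF.
have EntE := Ent_density nuE.
pose Phi0 := fine (Ent nu Pn).
have Phi0E : Ent nu Pn = Phi0%:E by rewrite fineK.
have Phi00 : 0 <= Phi0.
  by rewrite fine_ge0// EntE integral_ge0// => y _; rewrite lee_fin ent_fun_ge0.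
have intmu g : (\int[mu n]_y g y = \int[Pn]_y g y)%E.
  by apply: eq_measure_integral => A mA _; exact/esym/PnE.
have nuE' (g : n.-tuple X -> \bar R) : (forall y, (0 <= g y)%E) -> measurable_fun setT g ->
    (\int[nu]_y g y = \int[mu n]_y (g y * (F y)%:E))%E.
  by move=> g0 mg; rewrite intmu; exact: (integral_wrt_density nuE).
have HPhi : (\int[mu n]_y (ent_fun (F y))%:E <= Phi0%:E)%E by rewrite intmu -EntE Phi0E.
have mom (j : 'I_n) : exists x, (\int[nu]_y ((dist x (tnth y j)) `^ s)%:E < +oo)%E.
  exists (tnth y0 j); apply: le_lt_trans my0.
  apply: ge0_le_integral => //.
  - by apply: (measurable_dist_pow s cell (measurable_cst _)); exact: measurable_tnth.
  - under eq_fun do rewrite dist_pow_s -sumEFin.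
    apply: emeasurable_sum => i.
    by apply: (measurable_dist_pow s cell (measurable_cst _)); exact: measurable_tnth.
  - move=> y _; rewrite lee_fin dist_pow_s (bigD1 j)//= lerDl sumr_ge0// => i _.
    exact: powR_ge0.
rewrite leNgt; apply/negP => Hlt.
have Bs : 0 < B `^ (2 / s) by rewrite powR_gt0.
pose kappa := 2 / (alpha * B `^ (2 / s)).
have kappa0 : 0 < kappa by rewrite divr_gt0// mulr_gt0.
rewrite -/Phi0 -/kappa in Hlt.
set w := Num.sqrt (kappa * Phi0) in Hlt.
have w0 : 0 <= w by exact: sqrtr_ge0.
have [v wv vW] := lt_ereal_real Hlt.
have v0 : 0 < v by rewrite (le_lt_trans w0).
(* The entropy level for which the right side would equal [v]; it exceeds [Phi0] strictly. *)
pose Phi' := v ^+ 2 / kappa.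
have Phi'E : kappa * Phi' = v ^+ 2 by rewrite /Phi' mulrC divfK// gt_eqF.
have Phi0' : Phi0 < Phi'.
  rewrite -(ltr_pM2l kappa0) Phi'E -(sqr_sqrtr (_ : 0 <= kappa * Phi0)); last first.
    by rewrite mulr_ge0// ltW.
  by rewrite -/w ltrXn2r// nnegrE ltW.
(* The midpoint leaves room on both sides: above [Phi0] for the slacks added to the entropies, below
   [Phi'] for the term [K * e]. It is positive even if [Phi0 = 0]. *)
pose Phi := (Phi0 + Phi') / 2.
have PhiP : 0 < Phi by rewrite divr_gt0// ltr_wpDl// (le_lt_trans Phi00).
have PhiPhi' : Phi < Phi' by rewrite /Phi; lra.
have bE x : 0 <= x -> B^-1 * (2 / alpha * x) `^ (s / 2) = (kappa * x) `^ (s / 2).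
  move=> x0; have -> : kappa * x = B `^ (- (2 / s)) * (2 / alpha * x).
    by rewrite powRN /kappa invfM; ring.
  rewrite [RHS]powRM ?powR_ge0 ?mulr_ge0 ?invr_ge0 ?(ltW alpha0)//; congr (_ * _).
  rewrite -powRrM (_ : - (2 / s) * (s / 2) = -1); last by field; rewrite gt_eqF.
  by rewrite powR_inv1// ltW.
have gap : (kappa * Phi) `^ (s / 2) < v `^ s.
  have -> : v `^ s = (kappa * Phi') `^ (s / 2).
    rewrite Phi'E -powR_mulrn; last exact: ltW.
    by rewrite -powRrM; congr (_ `^ _); field.
  apply: gt0_ltr_powR; first exact: divr_gt0.
  - by rewrite nnegrE mulr_ge0 ?(ltW kappa0) ?(ltW PhiP).
  - by rewrite nnegrE mulr_ge0 ?(ltW kappa0)// (le_trans Phi00)// ltW.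
  - by rewrite ltr_pM2l.
have nR : 0 < n%:R :> R by rewrite ltr0n.
(* The two arguments give [n * e <= Phi - Phi0] and [K * e] at most the gap between the two
   costs. *)
pose e := Num.min ((Phi - Phi0) / n%:R) ((v `^ s - (kappa * Phi) `^ (s / 2)) / (K + 1)).
have K1 : 0 < K + 1 by rewrite ltr_wpDl.
have e0 : 0 < e.
  rewrite lt_min; apply/andP; split; apply: divr_gt0; rewrite // subr_gt0//.
  by rewrite /Phi; lra.
have ne : n%:R * e <= Phi - Phi0.
  by rewrite mulrC -ler_pdivlMr// ge_min lexx.
have Ke : K * e <= v `^ s - (kappa * Phi) `^ (s / 2).
  apply: (@le_trans _ _ ((K + 1) * e)); first by rewrite ler_wpM2r ?(ltW e0)// lerDl.
  by rewrite mulrC -ler_pdivlMr// ge_min lexx orbT.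
have [pi [D [E [cpi HD E0 HE rec]]]] := tuple_coupling cell s12 alpha0 c10 c20 c12
  p_kernel muS rho_ge0 p_transport p_lipschitz (leqnn n) F0 mF nuE' HPhi mom e0.
have mcoord (j : 'I_n) : measurable_fun setT (fun z : n.-tuple X * n.-tuple X =>
    ((dist (tnth z.1 j) (tnth z.2 j)) `^ s)%:E).
  apply: (measurable_dist_pow s cell).
    exact: (measurableT_comp (measurable_tnth j) measurable_fst).
  exact: (measurableT_comp (measurable_tnth j) measurable_snd).
have cpi' : couplings nu Pn pi.
  by move=> A mA; rewrite PnE//; exact: cpi.
have D0 j : (j < n)%N -> 0 <= D j.
  move=> jn; rewrite -lee_fin (le_trans _ (HD (Ordinal jn)))//.
  by apply: integral_ge0 => z _; exact: pw0.
have EPhi : \sum_(j < n) E j <= Phi.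
  by apply: (le_trans HE); rewrite -lerBrDl.
have := bound Phi e D E PhiP e0 D0 E0 EPhi rec.
rewrite bE ?(ltW PhiP)// => Hsum.
move: vW; rewrite ltNge => /negP; apply.
apply: (Wasserstein_le_cost s12 (ltW v0) cpi').
rewrite /transport_cost.
under eq_integral do rewrite dist_pow_s -sumEFin.
rewrite ge0_integral_sum//.
apply: (@le_trans _ _ (\sum_(j < n) (D j)%:E)%E).
  by apply: lee_sum => j _; exact: HD.
rewrite sumEFin lee_fin; apply: (le_trans Hsum).
by rewrite -lerBrDl.
Qed.

End tuple_transport.

(** * Reconstruction of the joint law from its conditional laws *)

Lemma conditional_integral {R : realType} {d d1 d2} {W : measurableType d}
  {S : measurableType d1} {Z : measurableType d2} (P : probability W R)
  (f : W -> S) (g : W -> Z) (k : S -> probability Z R) (hk : is_kernel k)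
  (mf : measurable_fun setT f) (mg : measurable_fun setT g) :
  (forall A B, measurable A -> measurable B ->
    P (f @^-1` A `&` g @^-1` B) = (\int[P]_(x in f @^-1` A) k (f x) B)%E) ->
  forall phi : S * Z -> \bar R, (forall z, (0 <= phi z)%E) ->
  measurable_fun setT phi ->
  (\int[P]_x phi (f x, g x) = \int[P]_x \int[k (f x)]_u phi (f x, u))%E.
Proof.
move=> H phi phi0 mphi.
have mfg : measurable_fun setT (fun x => (f x, g x)) by exact: measurable_fun_pair.
have mpair (s : S) : measurable_fun setT (fun u : Z => (s, u)).
  exact: measurable_pair1.
pose K (x : W) : probability (S * Z)%type R := image_probability (k (f x)) (mpair (f x)).
have hkf : is_kernel (fun x => k (f x)).
  by move=> U mU; exact: (measurableT_comp (hk U mU) mf).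
have hK : is_kernel K.
  move=> U mU.
  have := @measurable_kernel_integral _ _ _ _ _ _ hkf
    (fun z : W * Z => (\1_U (f z.1, z.2))%:E).
  rewrite (_ : (fun s => K s U) =
    (fun s => \int[k (f s)]_z (\1_U (f (s, z).1, (s, z).2))%:E)%E); last first.
    apply/funext => x; rewrite image_probabilityE.
    rewrite -[X in k (f x) X]setIT -integral_indic//.
    by rewrite -[X in measurable X]setTI; exact: (mpair (f x)).
  apply.
    by move=> z; rewrite lee_fin.
  apply/measurable_EFinP; apply: measurableT_comp; first exact: measurable_indic.
  apply: measurable_fun_pair; last exact: measurable_snd.
  exact: (measurableT_comp mf measurable_fst).
transitivity (\int[image_probability P mfg]_z phi z)%E.
  by rewrite integral_image_probability.
transitivity (\int[mixture hK P]_z phi z)%E; last first.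
  rewrite integral_mixture//; apply: eq_integral => x _.
  by rewrite integral_image_probability.
apply: eq_measure_integral => C mC _.
(* The law of the pair and the mixture are compared on rectangles, which generate the product
   sigma-algebra and are stable under intersection. *)
apply: (measure_unique [set A `*` B | A in measurable & B in measurable] (fun=> setT)) => //.
- exact: measurable_prod_measurableType.
- move=> _ _ [A1 mA1 [B1 mB1 <-]] [A2 mA2 [B2 mB2 <-]].
  exists (A1 `&` A2); first exact: measurableI.
  by exists (B1 `&` B2); [exact: measurableI|rewrite setXI].
- by move=> _; exists setT => //; exists setT => //; rewrite setXTT.
- by rewrite bigcup_const//; exists 0%N.
- move=> _ [A mA [B mB <-]].
  transitivity (P (f @^-1` A `&` g @^-1` B)); first by [].
  transitivity (\int[P]_x K x (A `*` B))%E; last exact/esym/mixtureE.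
  rewrite H// integral_mkcond; apply: eq_integral => x _.
  rewrite patchE; case: ifPn; rewrite ?notin_setE ?inE/= => fx.
    by congr (k (f x) _); apply/seteqP; split=> [u Bu|u []].
  rewrite image_probabilityE (_ : _ @^-1` _ = set0) ?measure0//.
  by apply/seteqP; split=> u //= -[].
- by move=> _; rewrite (le_lt_trans (probability_le1 _ _)) ?ltry.
Qed.

Section joint_law.
Context {R : realType} {d : measure_display} {X : measurableType d}.
Variables (n : nat) (P1 : probability X R)
  (p : forall k : nat, k.-1.-tuple X -> probability X R)
  (Pn : probability (n.-tuple X) R) (x0 : X).

(** The law of the coordinate of index [k], counted from 0, given the [k] preceding ones; the
    initial distribution is the kernel from the empty tuple. *)
Definition transition k : k.-tuple X -> probability X R :=
  match k return k.-tuple X -> probability X R with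
  | 0 => fun=> P1
  | k'.+1 => p (k:=k'.+2)
  end.

(** Reading with [nth] and the default [x0] gives a map for every [k], without carrying a proof of
    [k <= n]. *)
Definition initial_part k (x : n.-tuple X) : k.-tuple X := [tuple nth x0 x i | i < k].

Let measurable_nth k : measurable_fun setT (fun x : n.-tuple X => nth x0 x k).
Proof.
have [kn|nk] := ltnP k n; last first.
  rewrite (_ : (fun x : n.-tuple X => _) = cst x0); first exact: measurable_cst.
  by apply/funext => x; rewrite nth_default// size_tuple.
rewrite (_ : (fun x : n.-tuple X => _) = (@tnth n X)^~ (Ordinal kn)).
  exact: measurable_tnth.
by apply/funext => x; rewrite (tnth_nth x0).
Qed.

Lemma measurable_initial_part k : measurable_fun setT (@initial_part k).
Proof.
apply/measurable_fun_tnthP => i.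
rewrite (_ : _ \o _ = (fun x : n.-tuple X => nth x0 x i)); first exact: measurable_nth.
by apply/funext => x /=; rewrite tnth_mktuple.
Qed.

Definition initial_law k := image_probability Pn (@measurable_initial_part k).

Lemma initial_part_id x : initial_part n x = x.
Proof. by apply: eq_from_tnth => i; rewrite tnth_mktuple (tnth_nth x0). Qed.

Lemma initial_partE k (h : (k <= n)%N) x : initial_part k x = tprefix h x.
Proof. by apply: eq_from_tnth => i; rewrite !tnth_mktuple (tnth_nth x0). Qed.

Lemma initial_partS k x :
  initial_part k.+1 x = tuple_snoc (initial_part k x, nth x0 x k).
Proof.
apply: eq_from_tnth => i; rewrite tnth_mktuple (tnth_nth x0)/= nth_rcons size_map size_enum_ord.
case: ltngtP => ik.
- by rewrite -[in RHS](tnth_nth x0 (initial_part k x) (Ordinal ik)) tnth_mktuple.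
- by have := ltn_ord i; rewrite ltnS leqNgt ik.
- by rewrite ik.
Qed.

Hypothesis p_kernel : forall k : nat, (2 <= k <= n)%N -> forall B : set X, measurable B ->
  measurable_fun [set: k.-1.-tuple X] (fun x => (p x B : \bar R)).

Lemma transition_kernel k : (k < n)%N -> is_kernel (@transition k).
Proof. by case: k => [_ U mU|k kn U mU]; [exact: measurable_cst|exact: (p_kernel (k:=k.+2))]. Qed.

Hypothesis hn : (0 < n)%N.
Hypothesis initial : forall B : set X, measurable B ->
  Pn [set x | B (tnth x (Ordinal hn))] = P1 B.
Hypothesis conditional : forall (m : nat) (hm : (m < n)%N), (1 <= m)%N ->
  forall (A : set (m.-tuple X)) (B : set X), measurable A -> measurable B ->
  Pn [set x | A (tprefix (ltnW hm) x) /\ B (tnth x (Ordinal hm))] =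
  (\int[Pn]_(x in [set x | A (tprefix (ltnW hm) x)])
     p (k:=m.+1) (tprefix (ltnW hm) x) B)%E.

Lemma initial_lawS k (kn : (k < n)%N) (g : k.+1.-tuple X -> \bar R) :
  (forall y, (0 <= g y)%E) -> measurable_fun setT g ->
  (\int[initial_law k.+1]_y g y =
   \int[initial_law k]_t \int[transition t]_u g (tuple_snoc (t, u)))%E.
Proof.
move=> g0 mg.
have mgs : measurable_fun setT (fun tu : k.-tuple X * X => g (tuple_snoc tu)).
  exact: (measurableT_comp mg (@measurable_tuple_snoc _ _ k)).
have hk := transition_kernel kn.
rewrite integral_image_probability//.
rewrite [RHS]integral_image_probability; last 2 first.
- by move=> t; exact: integral_ge0.
- exact: (measurable_kernel_integral hk (phi := fun tu => g (tuple_snoc tu))).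
under eq_integral do rewrite initial_partS.
apply: (conditional_integral hk (@measurable_initial_part k) (@measurable_nth k)
  _ (fun tu => g0 (tuple_snoc tu)) mgs).
move=> A B mA mB; rewrite (_ : _ @^-1` A = [set x | A (tprefix (ltnW kn) x)]); last first.
  by apply/seteqP; split=> x /=; rewrite (initial_partE (ltnW kn)).
rewrite (_ : _ `&` _ =
    [set x | A (tprefix (ltnW kn) x) /\ B (tnth x (Ordinal kn))]); last first.
  by apply/seteqP; split=> x /=; rewrite (tnth_nth x0).
under eq_integral do rewrite (initial_partE (ltnW kn)).
case: k kn => [|k] kn in A mA g g0 mg mgs hk *; last exact: conditional.
rewrite /transition.
have tE (t : 0.-tuple X) : t = [tuple] by rewrite tuple0.
(* There is a single 0-tuple, so [A] is full or empty and the claim is the law of the first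
   coordinate. *)
have [A0|A0] := pselect (A [tuple]).
  rewrite (_ : [set x | A (tprefix (ltnW kn) x)] = setT); last first.
    by apply/seteqP; split=> x // _ /=; rewrite (tE (tprefix _ _)).
  rewrite integral_probability_cst -initial//; congr (Pn _).
  apply/seteqP; split=> x /=; last by move=> Bx; rewrite (tE (tprefix _ _)) !(tnth_nth x0) in Bx *.
  by case=> _; rewrite !(tnth_nth x0).
rewrite (_ : [set x | A (tprefix (ltnW kn) x)] = set0); last first.
  by apply/seteqP; split=> x //=; rewrite (tE (tprefix _ _)).
rewrite integral_set0 (_ : [set x | _ /\ _] = set0) ?measure0//.
by apply/seteqP; split=> x //= -[]; rewrite (tE (tprefix _ _)).
Qed.

End joint_law.

(** Shrinking the constant by [t ^+ 2] divides the bound by [t], so letting [t] tend to 1 recovers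
    it. This reaches R = 0, where the weight R^(1/s) would degenerate. *)
Lemma transport_ineq_limit {R : realType} {d} {Y : measurableType d}
  (dY : Y -> Y -> R) (s a : R) (mu : probability Y R) : 0 < a ->
  (forall t, 0 < t < 1 -> transport_ineq dY s (t ^+ 2 * a) mu) ->
  transport_ineq dY s a mu.
Proof.
move=> a0 H nu mnu Efin; rewrite leNgt; apply/negP.
set E := fine _; set x := Num.sqrt _ => Hlt.
have x0 : 0 <= x by exact: sqrtr_ge0.
have [v xv vW] := lt_ereal_real Hlt.
have v0 : 0 < v by rewrite (le_lt_trans x0).
have xv0 : 0 <= x / v by rewrite divr_ge0// ltW.
have xv1 : x / v < 1 by rewrite ltr_pdivrMr// mul1r.
(* Any [t] between [x / v] and 1 gives [x / t < v], contradicting [vW]. *)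
pose t := (1 + x / v) / 2.
have t01 : 0 < t < 1 by apply/andP; split; rewrite /t; lra.
have /andP[t0 t1] := t01.
have := H t t01 nu mnu Efin; rewrite -/E leNgt => /negP; apply.
apply: le_lt_trans vW; rewrite lee_fin.
rewrite (_ : 2 / (t ^+ 2 * a) * E = (2 / a * E) * t^-1 ^+ 2); last first.
  by field; rewrite !gt_eqF.
rewrite [_ * t^-1 ^+ 2]mulrC sqrtrM ?sqr_ge0// sqrtr_sqr ger0_norm ?invr_ge0 ?(ltW t0)//.
rewrite -/x mulrC ler_pdivrMr// mulrC -ler_pdivrMr// /t; lra.
Qed.

(** * The explicit constants for the joint law *)

Section joint_transport.
Context {R : realType} {d : measure_display} {X : measurableType d}.
Variables (dist : X -> X -> R) (n : nat) (hn : (0 < n)%N) (P1 : probability X R)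
  (p : forall k : nat, k.-1.-tuple X -> probability X R)
  (Pn : probability (n.-tuple X) R) (s alpha : R) (rho : nat -> R).
Hypothesis polish : polish_borel dist.
Hypothesis p_kernel : forall k : nat, (2 <= k <= n)%N -> forall B : set X, measurable B ->
  measurable_fun [set: k.-1.-tuple X] (fun x => (p x B : \bar R)).
Hypothesis initial : forall B : set X, measurable B ->
  Pn [set x | B (tnth x (Ordinal hn))] = P1 B.
Hypothesis conditional : forall (m : nat) (hm : (m < n)%N), (1 <= m)%N ->
  forall (A : set (m.-tuple X)) (B : set X), measurable A -> measurable B ->
  Pn [set x | A (tprefix (ltnW hm) x) /\ B (tnth x (Ordinal hm))] =
  (\int[Pn]_(x in [set x | A (tprefix (ltnW hm) x)])
     p (k:=m.+1) (tprefix (ltnW hm) x) B)%E.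
Hypotheses (s12 : 1 <= s <= 2) (alpha0 : 0 < alpha).
Hypothesis rho_ge0 : forall l : nat, (1 <= l <= n)%N -> 0 <= rho l.
Hypothesis P1_transport : transport_ineq dist s alpha P1.
Hypothesis p_transport : forall k : nat, (2 <= k <= n)%N -> forall x : k.-1.-tuple X,
  transport_ineq dist s alpha (p x).
Hypothesis p_lipschitz : forall k : nat, (2 <= k <= n)%N -> forall x y : k.-1.-tuple X,
  (poweR (Wasserstein dist s (p x) (p y)) s <=
   (\sum_(j < k.-1) rho (k.-1 - j)%N * (dist (tnth x j) (tnth y j)) `^ s)%:E)%E.

Let s1 : 1 <= s. Proof. by case/andP: s12. Qed.
Let s2 : s <= 2. Proof. by case/andP: s12. Qed.
Let s_gt0 : 0 < s. Proof. by rewrite (lt_le_trans ltr01). Qed.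
Let nR : 0 < n%:R :> R. Proof. by rewrite ltr0n. Qed.
Let n1R : 0 < n.+1%:R :> R. Proof. by rewrite ltr0n. Qed.

(** A space carrying a probability is nonempty; the point serves as default value in tuples and
    sequences. *)
Let inhabitant : exists x0 : X, True.
Proof.
apply: contrapT => h; have := probability_setT P1.
rewrite (_ : [set: X] = set0) ?measure0; last first.
  by apply/seteqP; split=> x // _; apply: h; exists x.
by move=> /esym/eqP; rewrite onee_eq0.
Qed.

Let x0 : X := projT1 (cid inhabitant).
Let cell : cellular dist. Proof. exact: (polish_cellular x0). Qed.

(** The diagonal coupling has cost zero. At the first coordinate the Lipschitz sum is empty and this
    is the bound it asks for. *)
Lemma Wasserstein_self (mu : probability X R) : Wasserstein dist s mu mu = 0%E.
Proof.
have [dist0 distxx _ _] : is_metric dist by case: polish.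
have mdiag : measurable_fun setT (fun x : X => (x, x)) by exact: measurable_fun_pair.
apply/eqP; rewrite eq_le Wasserstein_ge0 andbT.
apply: (@Wasserstein_le_cost _ _ _ _ _ s12 _ _ (image_probability mu mdiag)) => //.
  move=> A mA; split; rewrite [LHS](image_probabilityE mu mdiag).
    by congr (mu _); apply/seteqP; split=> [x []|x].
  by congr (mu _); apply/seteqP; split=> [x []|x].
rewrite /transport_cost integral_image_probability; last 2 first.
- by move=> z; rewrite lee_fin powR_ge0.
- exact: (measurable_dist_pow s cell measurable_fst measurable_snd).
under eq_integral => x _.
  rewrite (_ : dist _ _ = 0) ?powR0 ?gt_eqF//; last exact/distxx.
  over.
by rewrite integral0 lee_fin powR_ge0.
Qed.

Let th01 : 0 < s / 2 <= 1.
Proof. by rewrite divr_gt0//= ler_pdivrMr// mul1r. Qed.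

Lemma joint_transport (c1 c2 B K : R) : 0 <= c1 -> 0 <= c2 -> split_pow s c1 c2 ->
  0 < B -> 0 <= K ->
  (forall (Phi e : R) (D E : nat -> R), 0 < Phi -> 0 < e ->
    (forall j, (j < n)%N -> 0 <= D j) -> (forall j, 0 <= E j) ->
    \sum_(j < n) E j <= Phi ->
    (forall j, (j < n)%N -> D j = c2 * (2 / alpha * E j) `^ (s / 2) +
      c1 * \sum_(i < j) rho (j - i)%N * D i + e) ->
    \sum_(j < n) D j <= B^-1 * (2 / alpha * Phi) `^ (s / 2) + K * e) ->
  transport_ineq (@dist_pow R d X dist s n) s (alpha * B `^ (2 / s)) Pn.
Proof.
move=> c10 c20 c12.
apply: (@tuple_transport _ _ _ dist s alpha c1 c2 rho n cell s12 alpha0 c10 c20 c12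
  (transition P1 p) (initial_law Pn x0)) => //.
- by move=> k; exact: transition_kernel.
- by move=> k kn g; exact: initial_lawS.
- by case=> [kn t|k kn t]; [exact: P1_transport|exact: (p_transport (k:=k.+2))].
- case=> [kn t t'|k kn t t']; last exact: (p_lipschitz (k:=k.+2)).
  by rewrite /= Wasserstein_self big_ord0 poweR0r// gt_eqF.
- move=> A mA; transitivity (Pn (initial_part x0 n @^-1` A)); last by [].
  congr (Pn _).
  by apply/seteqP; split=> x /=; rewrite initial_part_id.
Qed.

Let a0 : 0 < 2 / alpha. Proof. by rewrite divr_gt0. Qed.
Let c10 := split_left_ge0 s n.
Let c20 := split_right_ge0 s n.

(** The geometric sum with ratio [1 + M] contributes [(1 + M) ^+ n / M]; the sources being bounded
    one by one, the power of [n] comes from [split_right] alone. *)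
Lemma bounded_transport (M : R) : 0 < M -> (forall l, (1 <= l <= n)%N -> rho l <= M) ->
  transport_ineq (@dist_pow R d X dist s n) s
    (alpha * (((n%:R * expR 1) `^ (1 - s) * M / (1 + M) ^+ n) `^ (2 / s))) Pn.
Proof.
move=> M0 rhoM.
have M1 : 0 < 1 + M by rewrite addr_gt0.
have ne : 0 < n%:R * expR 1 :> R by rewrite mulr_gt0// expR_gt0.
pose K := split_left s n ^+ n.-1 * ((1 + M) ^+ n / M).
have K0 : 0 <= K by rewrite mulr_ge0 ?exprn_ge0// divr_ge0 ?exprn_ge0// ltW.
apply: (joint_transport c10 c20 (split_left_right s12 hn) _ K0).
  by rewrite divr_gt0 ?exprn_gt0// mulr_gt0// powR_gt0.
move=> Phi e D E Phi0 e0 D0 E0 EPhi rec.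
apply: (le_trans (recursion_bounded c10 c20 a0 th01 Phi0 D0 E0 EPhi rec (ltW M0) rhoM)).
set H := (_ `^ (s / 2)); have H0 : 0 <= H by exact: powR_ge0.
apply: (@le_trans _ _ ((split_right s n * H + e) * K)).
  apply: ler_wpM2l; first by rewrite addr_ge0 ?(ltW e0)// mulr_ge0.
  exact: sum_split_bounded.
rewrite mulrDl [e * K]mulrC lerD2r.
rewrite !invfM !invrK -powRN opprB.
rewrite (_ : split_right s n * H * K =
  split_right s n * split_left s n ^+ n.-1 * ((1 + M) ^+ n / M * H)); last first.
  by rewrite /K; ring.
rewrite [leRHS](_ : _ = (n%:R * expR 1) `^ (s - 1) * ((1 + M) ^+ n / M * H)); last by ring.
apply: ler_wpM2r; first by rewrite mulr_ge0// divr_ge0 ?exprn_ge0// ltW.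
exact: split_right_left_pow.
Qed.

Section summable.
Variable Rb : R.
Hypotheses (Rb0 : 0 <= Rb) (rhoR : \sum_(1 <= j < n.+1) rho j <= Rb).

(** Common to R = 1 and R > 1, which differ in the bound [G] on the geometric sum. *)
Lemma summable_transport (B G : R) : 0 < B -> 0 <= G ->
  \sum_(i < n) (split_left s n * Rb) ^+ i <= G ->
  n.+1%:R `^ (s / 2) * G <= B^-1 ->
  transport_ineq (@dist_pow R d X dist s n) s (alpha * B `^ (2 / s)) Pn.
Proof.
move=> B0 G0 sumG GB.
have nG0 : 0 <= n%:R * G by rewrite mulr_ge0.
apply: (joint_transport c10 c20 (split_left_right s12 hn) B0 nG0).
move=> Phi e D E Phi0 e0 D0 E0 EPhi rec.
apply: (le_trans (recursion_summable c10 c20 (ltW e0) a0 th01 Phi0 D0 E0 EPhi rec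
  hn rho_ge0 Rb0 rhoR)).
set H := (_ `^ (s / 2)); have H0 : 0 <= H by exact: powR_ge0.
apply: (@le_trans _ _ ((split_right s n * (n%:R `^ (1 - s / 2) * H) + n%:R * e) * G)).
  apply: ler_wpM2l => //; rewrite addr_ge0// ?mulr_ge0 ?powR_ge0 ?(ltW e0)//.
rewrite mulrDl [n%:R * e * G]mulrAC lerD2r.
apply: (@le_trans _ _ (n.+1%:R `^ (s / 2) * G * H)); last by rewrite ler_wpM2r.
rewrite [leLHS](_ : _ = split_right s n * n%:R `^ (1 - s / 2) * (G * H)); last by ring.
rewrite -[leRHS]mulrA; apply: ler_wpM2r; first exact: mulr_ge0.
exact: split_right_root.
Qed.

(** At the weight [tau = Rb ^ (1/s)] one has [c1 * Rb = tau], and [c2 / (1 - c1 * Rb)] is the power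
    [-s] of [1 - tau]. This is what solving [D^(1/s) <= A^(1/s) + (Rb * D)^(1/s)] for [D] gives, so
    splitting by convexity loses nothing here. *)
Lemma contracting_transport : 0 < Rb < 1 ->
  transport_ineq (@dist_pow R d X dist s n) s
    (n%:R `^ (1 - 2 / s) * (1 - Rb `^ s^-1) ^+ 2 * alpha) Pn.
Proof.
move=> /andP[Rb0' Rb1].
pose tau := Rb `^ s^-1.
have tau0 : 0 < tau by exact: powR_gt0.
have tauE : tau `^ s = Rb by rewrite -powRrM mulVf ?gt_eqF// powRr1.
have tau1 : tau < 1.
  rewrite [ltRHS](_ : 1 = 1 `^ s^-1); last by rewrite powR1.
  by apply: gt0_ltr_powR; rewrite ?invr_gt0 ?nnegrE.
have tau1' : 0 < 1 - tau by rewrite subr_gt0.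
have t01 : 0 < tau < 1 by rewrite tau0.
have c1R : tau `^ (1 - s) * Rb = tau.
  by rewrite -[in X in _ * X]tauE -powRD ?subrK ?powRr1 ?(ltW tau0)// (gt_eqF tau0) implybT.
pose B := n%:R `^ (s / 2 - 1) * (1 - tau) `^ s.
have B0 : 0 < B by rewrite mulr_gt0// powR_gt0.
have -> : n%:R `^ (1 - 2 / s) * (1 - tau) ^+ 2 * alpha = alpha * B `^ (2 / s).
  rewrite mulrC; congr (_ * _).
  rewrite powRM ?powR_ge0// -!powRrM -(powR_mulrn _ (ltW tau1')).
  by congr (_ `^ _ * _ `^ _); field; rewrite gt_eqF.
have K0 : 0 <= n%:R / (1 - tau) by rewrite divr_ge0// ltW.
apply: (joint_transport (powR_ge0 _ _) (powR_ge0 _ _) (split_pow_convex s1 t01) B0 K0).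
move=> Phi e D E Phi0 e0 D0 E0 EPhi rec.
have := recursion_contracting (powR_ge0 _ _) (powR_ge0 _ _) (ltW e0) a0 th01 Phi0 D0 E0 EPhi rec
  hn rho_ge0 Rb0 rhoR.
rewrite c1R => /(_ tau1) /le_trans; apply.
set H := (_ `^ (s / 2)).
rewrite mulrDl [n%:R * e / _]mulrAC lerD2r.
rewrite le_eqVlt; apply/orP; left; apply/eqP.
rewrite /B invfM -!powRN opprB.
rewrite -[(1 - tau)^-1]powR_inv1 ?(ltW tau1')//.
rewrite (_ : (1 - tau) `^ (- s) = (1 - tau) `^ (1 - s) * (1 - tau) `^ (- 1)); last first.
  rewrite -powRD; last by rewrite (gt_eqF tau1') implybT.
  by congr (_ `^ _); ring.
by ring.
Qed.

End summable.

Lemma critical_transport : \sum_(1 <= j < n.+1) rho j <= 1 ->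
  transport_ineq (@dist_pow R d X dist s n) s
    (expR (2 / s - 2) * (n.+1%:R) `^ (- (2 / s) - 1) * alpha) Pn.
Proof.
move=> rho1.
(* The geometric sum is at most [n * expR (s - 1)]; relaxing [n] to [n.+1] merges it with the factor
   of exponent [s / 2]. *)
pose B : R := expR (1 - s) * n.+1%:R `^ (- 1 - s / 2).
have B0 : 0 < B by rewrite mulr_gt0 ?expR_gt0// powR_gt0.
have -> : expR (2 / s - 2) * (n.+1%:R) `^ (- (2 / s) - 1) * alpha = alpha * B `^ (2 / s).
  rewrite mulrC; congr (_ * _).
  rewrite powRM ?expR_ge0 ?powR_ge0// -powRrM; congr (_ * _ `^ _).
    by rewrite /powR gt_eqF ?expR_gt0// expRK; congr expR; field; rewrite gt_eqF.
  by field; rewrite gt_eqF.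
apply: (@summable_transport 1 ler01 rho1 B (n%:R * expR (s - 1)) B0).
- by rewrite mulr_ge0 ?expR_ge0.
- exact: sum_split_one.
- rewrite [leLHS](_ : _ = expR (s - 1) * (n.+1%:R `^ (s / 2) * n%:R)); last by ring.
  rewrite /B invfM -expRN opprB -powRN ler_wpM2l ?expR_ge0//.
  rewrite (_ : - (- 1 - s / 2) = s / 2 + 1); last by ring.
  rewrite powRD; last by rewrite (gt_eqF n1R) implybT.
  by rewrite powRr1 ?(ltW n1R)// ler_wpM2l ?powR_ge0// ler_nat.
Qed.

Lemma supercritical_transport (Rb : R) : 1 < Rb -> \sum_(1 <= j < n.+1) rho j <= Rb ->
  transport_ineq (@dist_pow R d X dist s n) s
    (((Rb - 1) / (expR (s - 1) * Rb ^+ n)) `^ (2 / s) * (alpha / n.+1%:R)) Pn.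
Proof.
move=> Rb1 rhoR; have Rb0 : 0 < Rb by rewrite (lt_trans ltr01).
have Rb10 : 0 < Rb - 1 by rewrite subr_gt0.
pose b := (Rb - 1) / (expR (s - 1) * Rb ^+ n).
have b0 : 0 < b by rewrite divr_gt0// mulr_gt0 ?expR_gt0// exprn_gt0.
have B0 : 0 < b * n.+1%:R `^ (- (s / 2)) by rewrite mulr_gt0// powR_gt0.
have -> : b `^ (2 / s) * (alpha / n.+1%:R) =
    alpha * (b * n.+1%:R `^ (- (s / 2))) `^ (2 / s).
  rewrite powRM ?powR_ge0 ?(ltW b0)// -powRrM.
  rewrite (_ : - (s / 2) * (2 / s) = -1); last by field; rewrite gt_eqF.
  by rewrite powR_inv1 ?(ltW n1R)//; ring.
apply: (@summable_transport Rb (ltW Rb0) rhoR _ (expR (s - 1) * (Rb ^+ n / (Rb - 1))) B0).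
- by rewrite mulr_ge0 ?expR_ge0// divr_ge0 ?exprn_ge0// ltW.
- exact: sum_split_gt1.
- rewrite invfM -powRN opprK mulrC ler_wpM2r ?powR_ge0//.
  by rewrite /b invf_div mulrA.
Qed.

Lemma subcritical_transport (Rb : R) : 0 <= Rb -> Rb < 1 ->
  \sum_(1 <= j < n.+1) rho j <= Rb ->
  transport_ineq (@dist_pow R d X dist s n) s
    (n%:R `^ (1 - 2 / s) * (1 - Rb `^ s^-1) ^+ 2 * alpha) Pn.
Proof.
rewrite le_eqVlt => /predU1P[<-{Rb}|Rb0] Rb1 rhoR; last first.
  by apply: contracting_transport => //; [exact: ltW|rewrite Rb0].
rewrite powR0 ?invr_eq0 ?gt_eqF// subr0 expr1n mulr1.
apply: transport_ineq_limit; first by rewrite mulr_gt0// powR_gt0.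
move=> t /andP[t0 t1].
have t1' : 0 < 1 - t by rewrite subr_gt0.
have u0 : 0 < (1 - t) `^ s by exact: powR_gt0.
have u1 : (1 - t) `^ s < 1.
  rewrite [ltRHS](_ : 1 = 1 `^ s); last by rewrite powR1.
  by apply: gt0_ltr_powR; rewrite ?nnegrE ?(ltW t1')// gtrBl.
(* A sum bounded by 0 is also bounded by [1 - t] to the power [s], and with this value
   [1 - Rb ^ (1/s)] equals [t]. *)
have := @contracting_transport _ (ltW u0) (le_trans rhoR (ltW u0)).
rewrite u0 u1 => /(_ isT).
rewrite -powRrM mulfV ?gt_eqF// powRr1 ?(ltW t1')// subKr.
by rewrite mulrAC mulrC.
Qed.

End joint_transport.

Theorem theorem2p1 (R : realType) (dX : measure_display) (X : measurableType dX)
  (dist : X -> X -> R) (n : nat) (hn : (0 < n)%N)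
  (P1 : probability X R)
  (p : forall k : nat, k.-1.-tuple X -> probability X R)
  (Pn : probability (n.-tuple X) R)
  (s alpha M : R) (rho : nat -> R) :
  (* (X, dist) is a complete separable metric space with its Borel sets *)
  polish_borel dist ->
  (* p_k(. | x^(k-1)) is a Markov kernel *)
  (forall k : nat, (2 <= k <= n)%N -> forall B : set X, measurable B ->
     measurable_fun [set: k.-1.-tuple X] (fun x => (p k x B : \bar R))) ->
  (* Pn = P^(n) is the joint law of (xi_1, ..., xi_n), with initial
     distribution P1 and conditional laws p_k of xi_k given xi^(k-1) *)
  (forall B : set X, measurable B ->
     Pn [set x | B (tnth x (Ordinal hn))] = P1 B) ->
  (forall (m : nat) (hm : (m < n)%N), (1 <= m)%N ->
     forall (A : set (m.-tuple X)) (B : set X), measurable A -> measurable B ->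
     Pn [set x | A (tprefix (ltnW hm) x) /\ B (tnth x (Ordinal hm))] =
     (\int[Pn]_(x in [set x | A (tprefix (ltnW hm) x)])
        p m.+1 (tprefix (ltnW hm) x) B)%E) ->
  1 <= s <= 2 -> 0 < alpha -> 0 < M ->
  (forall l : nat, (1 <= l <= n)%N -> 0 <= rho l <= M) ->
  (* (i) *)
  transport_ineq dist s alpha P1 ->
  (forall k : nat, (2 <= k <= n)%N -> forall x : k.-1.-tuple X,
     transport_ineq dist s alpha (p k x)) ->
  (* (ii) *)
  (forall k : nat, (2 <= k <= n)%N -> forall x y : k.-1.-tuple X,
     (poweR (Wasserstein dist s (p k x) (p k y)) s <=
      (\sum_(j < k.-1) rho (k.-1 - j)%N * (dist (tnth x j) (tnth y j)) `^ s)%:E)%E) ->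
  transport_ineq (@dist_pow R dX X dist s n) s
    (alpha * (((n%:R * expR 1) `^ (1 - s) * M / (1 + M) ^+ n) `^ (2 / s))) Pn
  /\
  (* (iii) *)
  (forall Rb : R, 0 <= Rb -> \sum_(1 <= j < n.+1) rho j <= Rb ->
     transport_ineq (@dist_pow R dX X dist s n) s
       (if Rb < 1 then n%:R `^ (1 - 2 / s) * (1 - Rb `^ s^-1) ^+ 2 * alpha
        else if Rb == 1 then expR (2 / s - 2) * (n.+1%:R) `^ (- (2 / s) - 1) * alpha
        else ((Rb - 1) / (expR (s - 1) * Rb ^+ n)) `^ (2 / s) * (alpha / n.+1%:R))
       Pn).
Proof.
move=> polish p_kernel initial conditional s12 alpha0 M0 rhoM tP1 tp lip.
have rho0 l : (1 <= l <= n)%N -> 0 <= rho l by move=> /rhoM/andP[].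
split=> [|Rb Rb0 rhoR].
  apply: (bounded_transport polish p_kernel initial conditional s12 alpha0 rho0 tP1 tp lip M0).
  by move=> l /rhoM/andP[].
case: ifPn => [Rb1|]; first exact:
  (subcritical_transport polish p_kernel initial conditional s12 alpha0 rho0 tP1 tp lip).
rewrite -leNgt le_eqVlt => /predU1P[Rb1|Rb1].
  rewrite -Rb1 eqxx in rhoR *.
  exact: (critical_transport polish p_kernel initial conditional s12 alpha0 rho0 tP1 tp lip).
rewrite gt_eqF//.
exact: (supercritical_transport polish p_kernel initial conditional s12 alpha0 rho0 tP1 tp lip).
Qed.
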